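(* Assume the following. (i) $f$ and $g$ are continuous. (ii) There are constants $\kappa>\frac12$, $C_\psi\ge 0$, $\alpha\ge 0$ such that for every $R\ge 0$ the function $\psi$ is Hölder on $I\times\{x\in E:|x|\le R\}$ with exponent $\kappa$ and a constant $K_R$, i.e. $|\psi(t,x)-\psi(s,y)|\le K_R(|t-s|^\kappa+|x-y|^\kappa)$ whenever $s,t\in I$, $|x|,|y|\le R$, and $K_R\le C_\psi(1+R^\alpha)$. (iii) $U$ is closed and convex. (iv) $\phi$ is continuous on $I\times E\times U$, convex in $u\in U$, and there are constants $C_\phi>0$, $\delta>0$, $r>1$ with $\phi(t,x,u)\ge C_\phi(|u|^r-|x|^\delta)$ for all $(t,x,u)\in I\times E\times U$. (v) $\xi\in E$ and there are nonnegative constants $C_s,C_e,\beta,\gamma$ such that for any control $u\in\mathcal U_r$ and any local solution $x$ of the state equation with control $u$ and initial condition $\xi$, $$\|\dot x\|_r\le C_s(1+\|u\|_r^\beta),\qquad \|x\|_\infty\le C_e(1+\|u\|_r^\gamma).$$ Further $\gamma(\alpha+\kappa-\frac12)+\frac\beta2<r$ and $\gamma\delta<r$. (vi) $f,g$ have continuous partial derivatives with respect to the second variable. (vii) $\phi$ has a continuous partial derivative with respect to the second variable. (viii) There exist constants $R>0$, $c\ge0$ and an integrable function $\mathfrak d:I\to\mathbb R_{\ge0}$ such that whenever $(x,u)$ is an admissible process, then for a.e. $t\in I$: $|y-x(t)|\le R$ implies $|D_2\phi(t,y,u(t))|\le c|\phi(t,y,u(t))|+\mathfrak d(t)$. (ix)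 $\psi$ has a partial derivative with respect to the second variable which is locally Hölder in $(t,x)$ with exponent larger than $\frac12$. Fix an observation path $\eta$ and let $(x,u)$ be a global minimiser of $$A(x,u)=\int_I\phi(t,x(t),u(t))\,dt+\int_I\psi(t,x(t))\,d\eta(t)$$ over all admissible processes with respect to $\xi$. Then for almost all $t\in I$ $$H(t,x(t),\lambda(t),u(t))=\inf_{v\in U}H(t,x(t),\lambda(t),v),$$ where $\lambda:I\to E'$ is the unique solution of the integral equation $$\lambda(t)=\int_t^T\lambda(s)\{D_2f(s,x(s))+D_2g(s,x(s))u(s)\}\,ds+\int_t^TD_2\phi(s,x(s),u(s))\,ds+\int_t^TD_2\psi(s,x(s))\,d\eta_s$$ and $$H(t,x,\lambda,v)=\phi(t,x,v)+\lambda\big(f(t,x)+g(t,x)v\big).$$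
   Context: $T>0$, $I=[0,T]$; $E$ is a finite-dimensional real vector space with norm $|\cdot|$ and dual $E'$; $d\in\mathbb N$; $U\subset E$ is the control set; $f:I\times E\to E$, $g:I\times E\to L(E,E)$, $\phi:I\times E\times E\to\mathbb R$, $\psi:I\times E\to L(\mathbb R^d,\mathbb R)$ are given functions. $D_k$ denotes the partial derivative with respect to the $k$-th argument; $D_2g(s,x)u\in L(E,E)$ is $z\mapsto(D_2g(s,x)z)u$. The state equation is $\dot x(t)=f(t,x(t))+g(t,x(t))u(t)$. A process with respect to $\xi$ is a pair $(x,u)$ with $u:I\to E$ measurable, $x:I\to E$ absolutely continuous, $x(0)=\xi$, and the state equation satisfied for a.e. $t\in I$. It is feasible if $u(t)\in U$ for a.e. $t\in I$; a feasible process is admissible if it has finite costs $A(x,u)$. A local solution is a solution of the state equation on a possibly smaller interval $[0,T_1]$, $T_1\le T$ (norms of $x,\dot x$ are then over $[0,T_1]$). $\|u\|_r=(\int_I|u(s)|^r ds)^{1/r}$, $\|u\|_\infty=\sup_{s\in I}|u(s)|$; $\mathcal U_r$ is the set of measurable $u:I\to E$ with $u(t)\in U$ a.e. and $\|u\|_r<\infty$. For $p\ge1$ the $p$-variation of a continuous function $x$ on $I$ is $[x]_p=(\sup\sum_i|x(t_{i+1})-x(t_i)|^p)^{1/p}$, the supremum being over finite dissections $0=t_0<\dots<t_n=T$. The Young integral $\int_I x\,dy$ is the limit of $\sum_i x(\tau_i)(y(t_{i+1})-y(t_i))$, $\tau_i\in[t_i,t_{i+1}]$, as the mesh of the dissections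 tends to $0$, required to exist independently of the choice of dissections and of the $\tau_i$. An observation path is a continuous function $\eta:I\to\mathbb R^d$ with $[\eta]_p<\infty$ for every $p>2$; integrals against $\eta$ are Young integrals, and $\int_t^TD_2\psi(s,x(s))\,d\eta_s$ is the element of $E'$ given by $z\mapsto\int_t^TD_2\psi(s,x(s))z\,d\eta_s$. *)

(* Defs.v *)
From HB Require Import structures.
From mathcomp Require Import all_boot all_order all_algebra.
From mathcomp Require Import all_classical all_reals all_analysis.

Set Implicit Arguments.
Unset Strict Implicit.
Unset Printing Implicit Defensive.

Import Order.TTheory GRing.Theory Num.Theory.
Import numFieldNormedType.Exports.

Local Open Scope classical_set_scope.
Local Open Scope ring_scope.

(* Finite-dimensional normed spaces, with an arbitrary norm. *)
#[short(type="normedVectType")]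
HB.structure Definition NormedVector (R : numFieldType) :=
  {V of NormedModule R V & Vector R V}.

Section ContinuousLinear.
Context {R : realType} (V W : normedModType R).

Definition clin_pred : {pred V -> W} :=
  mem [set A : V -> W | linear A /\ continuous A].

Record clin := CLin { clin_fun :> V -> W ; clinP : clin_fun \in clin_pred }.

HB.instance Definition _ := [isSub for clin_fun].
HB.instance Definition _ := [Choice of clin by <:].

Lemma clin_pred_submod : submod_closed clin_pred.
Proof.
split=> [|a A B].
  rewrite inE /=; split=> [a x y|x]; first by rewrite /= scaler0 addr0.
  exact: cst_continuous.
rewrite !inE /= => -[lA cA] [lB cB]; split=> [k x y|x].
  rewrite !fctE lA lB !scalerDr !scalerA (mulrC a k) -!addrA; congr (_ + _).
  by rewrite addrCA.
by apply: cvgD; [apply: cvgZr; exact: cA|exact: cB].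
Qed.

HB.instance Definition _ := GRing.isSubmodClosed.Build _ _ clin_pred
  clin_pred_submod.
HB.instance Definition _ := [SubChoice_isSubLmodule of clin by <:].

Lemma clin_linear (A : clin) : linear A.
Proof. by case: A => A /= /[!inE] -[]. Qed.

Lemma clin_continuous (A : clin) : continuous A.
Proof. by case: A => A /= /[!inE] -[]. Qed.

HB.instance Definition _ (A : clin) :=
  GRing.isLinear.Build R V W *:%R A (@clin_linear A).

Definition opnorm (A : clin) : R :=
  sup [set `|A x| | x in [set x : V | `|x| <= 1]].

Lemma opnorm_has_sup (A : clin) :
  has_sup [set `|A x| | x in [set x : V | `|x| <= 1]].
Proof.
split; first by exists `|A 0|, 0 => //=; rewrite normr0.
have /linear_bounded_continuous/bounded_funP/(_ 1)[M AM] :=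
  @clin_continuous A.
by exists M => _ [x /= x1 <-]; exact: AM.
Qed.

Lemma opnorm_ub (A : clin) x : `|x| <= 1 -> `|A x| <= opnorm A.
Proof. by move=> x1; apply: (ub_le_sup (opnorm_has_sup A).2); exists x. Qed.

Lemma opnorm_lub (A : clin) M :
  (forall x, `|x| <= 1 -> `|A x| <= M) -> opnorm A <= M.
Proof.
move=> AM; apply: ge_sup; first exact: (opnorm_has_sup A).1.
by move=> _ [x /= x1 <-]; exact: AM.
Qed.

Lemma opnormD (A B : clin) : opnorm (A + B) <= opnorm A + opnorm B.
Proof.
apply: opnorm_lub => x x1.
by rewrite (le_trans (ler_normD _ _))// lerD ?opnorm_ub.
Qed.

Lemma opnormZ_le a (A : clin) : opnorm (a *: A) <= `|a| * opnorm A.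
Proof.
apply: opnorm_lub => x x1.
by rewrite [X in `|X|](_ : _ = a *: A x)// normrZ ler_wpM2l ?opnorm_ub.
Qed.

Lemma opnormZ a (A : clin) : opnorm (a *: A) = `|a| * opnorm A.
Proof.
have [->|a0] := eqVneq a 0.
  apply/eqP; rewrite normr0 mul0r eq_le; apply/andP; split.
    by rewrite (le_trans (opnormZ_le _ _))// normr0 mul0r.
  by rewrite (le_trans _ (opnorm_ub (0 *: A) (x := 0) _))// normr0.
apply/eqP; rewrite eq_le opnormZ_le /= mulrC -ler_pdivlMr ?normr_gt0//.
rewrite mulrC -normfV -{1}(scale1r A) -(mulVf a0) -scalerA.
exact: opnormZ_le.
Qed.

Lemma opnorm_eq0 (A : clin) : opnorm A = 0 -> A = 0.
Proof.
move=> A0; apply/val_inj/funext => x /=.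
have [->|x0] := eqVneq x 0; first exact: linear0.
have nx0 : `|x| != 0 by rewrite normr_eq0.
have : `|A (`|x|^-1 *: x)| <= 0 by rewrite -A0 opnorm_ub ?normfZV.
by rewrite normr_le0 linearZ/= scaler_eq0 invr_eq0 (negbTE nx0) => /eqP.
Qed.

HB.instance Definition _ :=
  Lmodule_isNormed.Build R clin opnormD opnormZ opnorm_eq0.

End ContinuousLinear.

Notation "''L' ( V , W )" := (clin V W) : type_scope.

Definition frechet {R : realType} {V W : normedModType R} (F : V -> W) (x : V) :
  'L(V, W) := insubd 0 ('d F x : V -> W).

Lemma frechetE {R : realType} {V W : normedModType R} (F : V -> W) (x : V) :
  differentiable F x -> frechet F x = 'd F x :> (V -> W).
Proof.
move=> dF; rewrite [LHS]val_insubd ifT// inE; split; last exact: diff_continuous.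
by move=> a u v; rewrite linearP.
Qed.

(* R with the sigma-algebra of Lebesgue measurable sets, and the complete
   Lebesgue measure on it; measurability, integrability and "almost everywhere"
   refer to these. *)
Notation lebT R := (caratheodory_type (@wlength R idfun)^*%mu).
Notation leb := (completed_lebesgue_measure).

Section Paths.
Context {R : realType} {E : normedModType R}.
Implicit Types (a b r p : R) (u x : R -> E).

Definition lmeasurable a b u :=
  measurable_fun (`[a, b] : set (lebT R))
    (u : lebT R -> g_sigma_algebraType (@open E)).

Definition Lr_norm r a b u : \bar R :=
  ((\int[leb]_(t in `[a, b]) (`|u t| `^ r)%:E) `^ r^-1)%E.

Definition sup_norm a b x : \bar R := ereal_sup [set `|x t|%:E | t in `[a, b]].

Definition abs_continuous a b x := forall e, 0 < e -> exists2 d, 0 < d &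
  forall (n : nat) (l r : 'I_n -> R),
    (forall i, [/\ a <= l i, l i <= r i & r i <= b]) ->
    trivIset setT (fun i => `]l i, r i[%classic) ->
    \sum_(i < n) (r i - l i) < d -> \sum_(i < n) `|x (r i) - x (l i)| < e.

Definition p_variation p a b x : \bar R :=
  ((ereal_sup [set (\sum_(i < size s)
       `|x (nth b s i) - x (nth b (a :: s) i)| `^ p)%:E
     | s in [set s | itv_partition a b s]]) `^ p^-1)%E.

End Paths.

Section Young.
Context {R : realType} {V W : normedModType R}.
Implicit Types (a b : R) (X : R -> 'L(V, W)) (y : R -> V).

(* l is the Young integral of X against y over [a, b]; the dissection consists
   of the points of a :: s. *)
Definition is_young_integral a b X y (l : W) :=
  forall e, 0 < e -> exists2 d, 0 < d &
  forall (s : seq R) (tau : nat -> R), itv_partition a b s ->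
    (forall i, (i < size s)%N ->
      [/\ nth b s i - nth b (a :: s) i < d,
          nth b (a :: s) i <= tau i & tau i <= nth b s i]) ->
    `|\sum_(i < size s) X (tau i) (y (nth b s i) - y (nth b (a :: s) i)) - l|
      < e.

Definition young_integrable a b X y := exists l, is_young_integral a b X y l.

Definition young_integral a b X y : W := get (is_young_integral a b X y).

End Young.

(* R^d carries the supremum norm; finiteness of the p-variation does not depend
   on the choice of the norm. *)
Definition observation_path {R : realType} {d : nat} (T : R)
    (eta : R -> 'rV[R]_d) :=
  {within `[0, T], continuous eta} /\
  forall p, 2 < p -> (p_variation p 0 T eta < +oo)%E.

Section Holder.
Context {R : realType} {E F : normedModType R}.

Definition holder_on (A : set (R * E)) (kappa K : R) (h : R -> E -> F) :=
  forall p q, A p -> A q ->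
    `|h p.1 p.2 - h q.1 q.2|
      <= K * (`|p.1 - q.1| `^ kappa + `|p.2 - q.2| `^ kappa).

Definition locally_holder_on (A : set (R * E)) (kappa : R) (h : R -> E -> F) :=
  forall p, A p -> exists2 B, nbhs p B & exists K, holder_on (A `&` B) kappa K h.

End Holder.

Section ControlProblem.
Context {R : realType} {E : normedVectType R} {d : nat}.
Variables (T : R) (U : set E) (xi : E).
Variables (f : R -> E -> E) (g : R -> E -> 'L(E, E)).
Variables (phi : R -> E -> E -> R) (psi : R -> E -> 'L('rV[R]_d, R^o)).
Variable (eta : R -> 'rV[R]_d).

Definition solves_state_eq (T1 : R) (x u : R -> E) :=
  [/\ abs_continuous 0 T1 x, x 0 = xi &
      {ae leb, forall t : R, t \in `[0, T1] ->
        is_derive t (1 : R) x (f t (x t) + g t (x t) (u t))}].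

Definition control_in_U (u : R -> E) :=
  {ae leb, forall t : R, t \in `[0, T] -> U (u t)}.

Definition Lr_control (r : R) (u : R -> E) :=
  [/\ lmeasurable 0 T u, control_in_U u & (Lr_norm r 0 T u < +oo)%E].

Definition process (x u : R -> E) :=
  lmeasurable 0 T u /\ solves_state_eq T x u.

Definition feasible (x u : R -> E) := process x u /\ control_in_U u.

(* phi is bounded below along a process, up to an integrable function, so that
   finiteness of its integral means integrability. *)
Definition finite_cost (x u : R -> E) :=
  leb.-integrable `[0, T] (fun t => (phi t (x t) (u t))%:E) /\
  young_integrable 0 T (fun t => psi t (x t)) eta.

Definition cost (x u : R -> E) : R :=
  \int[leb]_(t in `[0, T]) phi t (x t) (u t) +
  young_integral 0 T (fun t => psi t (x t)) eta.

Definition admissible (x u : R -> E) := feasible x u /\ finite_cost x u.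

Definition global_minimiser (x u : R -> E) :=
  admissible x u /\ forall y v, admissible y v -> cost x u <= cost y v.

Definition Df (t : R) (x : E) : 'L(E, E) := frechet (f t) x.
Definition Dg (t : R) (x : E) : 'L(E, 'L(E, E)) := frechet (g t) x.
Definition Dphi (t : R) (x u : E) : 'L(E, R^o) :=
  frechet (fun y => phi t y u : R^o) x.
Definition Dpsi (t : R) (x : E) : 'L(E, 'L('rV[R]_d, R^o)) := frechet (psi t) x.

(* The E'-valued integral equation, evaluated at an arbitrary z : E; a solution
   is any lambda for which all the integrals involved exist. *)
Definition costate_eq (x u : R -> E) (lambda : R -> 'L(E, R^o)) :=
  (forall z, [/\
    leb.-integrable `[0, T] (fun s =>
      (lambda s (Df s (x s) z + Dg s (x s) z (u s)))%:E),
    leb.-integrable `[0, T] (fun s => (Dphi s (x s) (u s) z)%:E) &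
    forall t : R, t \in `[0, T] ->
      young_integrable t T (fun s => Dpsi s (x s) z) eta /\
      lambda t z =
        \int[leb]_(s in `[t, T]) lambda s (Df s (x s) z + Dg s (x s) z (u s)) +
        \int[leb]_(s in `[t, T]) Dphi s (x s) (u s) z +
        young_integral t T (fun s => Dpsi s (x s) z) eta]).

Definition hamiltonian (t : R) (x : E) (lambda : 'L(E, R^o)) (v : E) : R :=
  phi t x v + lambda (f t x + g t x v).

End ControlProblem.

(* Main.v *)
(* Let v0 be a point of U and S a measurable subset of I. As U is convex, the
   controls u + e 1_S (v0 - u), 0 < e <= 1, are feasible. The difference quotients
   (x_e - x) / e of their trajectories solve Volterra equations whose right-hand
   sides converge, so they converge uniformly to the solution h of the linearised
   equation. The difference quotients of psi along x_e are Hoelder with respect to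
   one superadditive control, uniformly in e, so by the sewing lemma their Young
   integrals against eta converge to that of D_2 psi h. Convexity of phi in the
   control bounds the difference quotients of the running cost from above by
   functions that (viii) dominates. Minimality then gives
     0 <= int D_2 phi h + int D_2 psi h d eta + int_S (phi(v0) - phi(u)),
   and pairing h with lambda turns the right-hand side into the integral over S of
   H(v0) - H(u): the sum of lambda h and the primitives of the remaining terms has
   increments that are small relative to a control, hence is constant. Choosing
   S = {H(v0) < H(u)} shows that S is negligible, and letting v0 run through a
   countable dense subset of U gives the minimum condition. The equation for lambda
   is solved, uniquely, by Picard iteration in a weighted supremum norm. *)
From HB Require Import structures.
Require Import Defs.
From mathcomp Require Import all_boot all_order all_algebra.
From mathcomp Require Import all_classical all_reals all_analysis.
From mathcomp Require Import measurable_realfun ring lra.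

Set Implicit Arguments.
Unset Strict Implicit.
Unset Printing Implicit Defensive.

Import Order.TTheory GRing.Theory Num.Theory.
Import numFieldNormedType.Exports.

Local Open Scope classical_set_scope.
Local Open Scope ring_scope.

(** * Coordinates on a finite-dimensional normed space *)

(** The control [u] is unbounded; coercivity makes it integrable and no more. Lipschitz and growth
    bounds therefore have the form [C * (1 + |u s|)], and the integral equations become contractions
    only after weighting by exponentials of the primitive of such a function. Neither [C] nor the
    weight depends on [e], so the quotients [y = (x_e - x) / e] are bounded uniformly and [x + e y]
    stays in a fixed compact tube around [x] once [e] is small.

    [lambda] inherits the roughness of [eta], so there is no product rule for [lambda h]. Instead
    [h] is frozen at the left end of a short interval, which turns the costate equation into one for
    a fixed vector. The rough parts then cancel up to remainders of order w^th with th > 1, and the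
    others carry an oscillation of [lambda] or [h] as a small factor.

    The norm of [E] is arbitrary, so compactness, integration and completeness pass through
    coordinates in a basis, at the cost of a constant in the estimates. *)

Lemma cvg_sumr (R : realType) (V : normedModType R) (I : finType) (X : Type)
    (F : set_system X) (h : I -> X -> V) (l : I -> V) : Filter F ->
  (forall i, h i x @[x --> F] --> l i) ->
  \sum_i h i x @[x --> F] --> \sum_i l i.
Proof.
by move=> FF hl; apply: cvg_big => //; exact: add_continuous.
Qed.

Section FiniteDimensional.
Context {R : realType} {E : normedVectType R}.

Definition ebasis (i : 'I_(\dim {:E})) : E := (vbasis {:E})`_i.
Definition ecoord (i : 'I_(\dim {:E})) : E -> R := coord (vbasis {:E}) i.

Lemma ecoord_sum (x : E) : x = \sum_i ecoord i x *: ebasis i.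
Proof. exact/coord_vbasis/memvf. Qed.

Lemma ecoordD i : {morph ecoord i : x y / x + y}.
Proof. by move=> x y; rewrite /ecoord linearD. Qed.

Lemma ecoordB i : {morph ecoord i : x y / x - y}.
Proof. by move=> x y; rewrite /ecoord linearB. Qed.

Lemma ecoordZ i a x : ecoord i (a *: x) = a * ecoord i x.
Proof. by rewrite /ecoord linearZ. Qed.

Lemma ecoord_basis i j : ecoord i (ebasis j) = (i == j)%:R.
Proof.
by rewrite /ecoord /ebasis coord_free ?(basis_free (vbasisP _))// eq_sym.
Qed.

(** The coordinate space carries the supremum norm, for which closed bounded sets are compact;
    [ecomb] transports this to [E]. *)
Definition ecomb (a : 'rV[R]_(\dim {:E})) : E := \sum_i a 0 i *: ebasis i.

Lemma ecomb_continuous : continuous ecomb.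
Proof.
move=> a; apply: (@cvg_sumr R E _ _ (nbhs a)) => i.
by apply: cvgZr_tmp; exact: coord_continuous.
Qed.

Lemma ecombK i a : ecoord i (ecomb a) = a 0 i.
Proof.
rewrite /ecomb /ecoord linear_sum (bigD1 i)//= big1 ?addr0 => [|j ji].
  by rewrite -/(ecoord i _) ecoordZ ecoord_basis eqxx mulr1.
by rewrite -/(ecoord i _) ecoordZ ecoord_basis eq_sym (negbTE ji) mulr0.
Qed.

Lemma ecombE x : ecomb (\row_i ecoord i x) = x.
Proof. by rewrite [RHS]ecoord_sum; apply: eq_bigr => i _; rewrite mxE. Qed.

Lemma ecombZ k a : ecomb (k *: a) = k *: ecomb a.
Proof.
by rewrite scaler_sumr; apply: eq_bigr => i _; rewrite mxE scalerA.
Qed.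

(** Equivalence of norms: [|ecomb a|] attains a minimum on the unit sphere of the coordinate space,
    positive because coordinates are unique; [c] is its inverse. *)
Lemma ecoord_bounded :
  exists2 c : R, 0 < c & forall i x, `|ecoord i x| <= c * `|x|.
Proof.
pose S : set 'rV[R]_(\dim {:E}) := [set a | `|a| = 1].
(* If the sphere is empty there is no coordinate at all: otherwise the normalised all-ones vector
   would lie on it. *)
have [S0|/set0P[a0 Sa0]] := eqVneq S set0.
  exists 1 => // i x; exfalso.
  have : S (`|const_mx 1 : 'rV[R]_(\dim {:E})|^-1 *: const_mx 1).
    rewrite /S /= normfZV//; apply/eqP => /matrixP/(_ 0 i).
    by rewrite !mxE => /eqP; rewrite oner_eq0.
  by rewrite S0.
have cS : compact S.
  apply: bounded_closed_compact.
    by exists 1; split => // M M1 a /= ->; exact/ltW.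
  have -> : S = (fun a => `|a|) @^-1` [set 1] by [].
  apply: preimage_closed; last exact: closed_eq.
  by move=> a _; exact: norm_continuous.
have cN : {within S, continuous (fun a => `|ecomb a|)}.
  apply: continuous_subspaceT => a.
  exact: (continuous_comp (@ecomb_continuous a) (@norm_continuous _ _ _)).
have [a /[!inE] Sa amin] := compact_EVT_min (ex_intro _ a0 Sa0) cS cN.
have ma0 : 0 < `|ecomb a|.
  rewrite normr_gt0; apply/eqP => ea0.
  move: Sa; rewrite /S /= => na; suff: a = 0 by move=> a00; move: na; rewrite a00 normr0 => /esym/eqP; rewrite oner_eq0.
  by apply/rowP => i; rewrite -ecombK ea0 /ecoord linear0 mxE.
exists `|ecomb a|^-1; first by rewrite invr_gt0.
move=> i x; rewrite mulrC ler_pdivlMr//.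
pose b : 'rV[R]_(\dim {:E}) := \row_i ecoord i x.
have bi : `|ecoord i x| <= `|b|.
  rewrite {2}/Num.Def.normr /= mx_normrE.
  have -> : ecoord i x = b 0 i by rewrite mxE.
  exact: (le_bigmax _ (fun ij : 'I_1 * 'I_(\dim {:E}) => `|b ij.1 ij.2|) (0, i)).
have [b0|b0] := eqVneq b 0.
  by move: bi; rewrite b0 normr0 normr_le0 => /eqP ->; rewrite normr0 mul0r.
have := amin (`|b|^-1 *: b); rewrite inE /S /= normfZV// => /(_ erefl).
rewrite ecombZ ecombE normrZ normfV normr_id => abx.
apply: (le_trans (ler_wpM2r (normr_ge0 _) bi)).
by rewrite mulrC -ler_pdivlMr ?normr_gt0// mulrC.
Qed.

Lemma norm_le_ecoord x : `|x| <= \sum_i `|ecoord i x| * `|ebasis i|.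
Proof.
rewrite {1}[x]ecoord_sum; apply: (le_trans (ler_norm_sum _ _ _)).
by apply: ler_sum => i _; rewrite normrZ.
Qed.

Lemma ecoord_continuous i : continuous (ecoord i).
Proof.
have [c c0 cb] := ecoord_bounded.
move=> x; apply/cvgrPdist_lt => e e0.
near=> y; rewrite -ecoordB (le_lt_trans (cb _ _))// mulrC -ltr_pdivlMr//.
near: y; apply/nbhs_normP; exists (e / c); first by rewrite /= divr_gt0.
by move=> y.
Unshelve. all: by end_near. Qed.

Lemma findim_linear_continuous (V : normedModType R) (A : E -> V) :
  linear A -> continuous A.
Proof.
move=> lA.
have -> : A = fun x => \sum_i ecoord i x *: A (ebasis i).
  apply/funext => x; rewrite {1}[x]ecoord_sum.
  pose A' : {linear E -> V} :=
    HB.pack A (GRing.isLinear.Build R E V *:%R A lA).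
  rewrite -[A]/(A' : E -> V) linear_sum; apply: eq_bigr => i _.
  by rewrite linearZ.
move=> x; apply: (@cvg_sumr R V _ _ (nbhs x)) => i.
by apply: cvgZr_tmp; exact: ecoord_continuous.
Qed.

Lemma findim_ball_compact (M : R) : compact [set z : E | `|z| <= M].
Proof.
have [c c0 cb] := ecoord_bounded.
have [M0|M0] := ltP M 0.
  rewrite (_ : [set _ | _] = set0); first exact: compact0.
  by apply/seteqP; split => // z /= zM; have := le_lt_trans zM M0; rewrite normr_lt0.
pose K : set 'rV[R]_(\dim {:E}) := [set a | `|ecomb a| <= M].
have -> : [set z : E | `|z| <= M] = ecomb @` K.
  apply/seteqP; split => [z /= zM|_ [a Ka <-]//].
  by exists (\row_i ecoord i z); rewrite /K /= ecombE.
apply: continuous_compact.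
  apply: continuous_subspaceT; exact: ecomb_continuous.
apply: bounded_closed_compact.
  exists (c * M); split => [|N MN a Ka]; first exact: num_real.
  rewrite /Num.Def.normr /= mx_normrE; apply: bigmax_le.
    by apply: le_trans (ltW MN); rewrite mulr_ge0// ltW.
  move=> [j i] _ /=; rewrite (ord1 j) -ecombK.
  by rewrite (le_trans (cb _ _))// (le_trans _ (ltW MN))// ler_wpM2l// ltW.
rewrite /K (_ : [set _ | _] = (fun a => `|ecomb a|) @^-1` [set r | r <= M])//.
apply: preimage_closed; last exact: closed_le.
move=> a _; exact: (continuous_comp (@ecomb_continuous a) (@norm_continuous _ _ _)).
Qed.

Definition erat (q : 'rV[rat]_(\dim {:E})) : E := ecomb (map_mx ratr q).

Lemma erat_dense (x : E) (e : R) : 0 < e -> exists q, `|x - erat q| < e.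
Proof.
move=> e0.
pose B := \sum_i `|ebasis i|.
have B0 : 0 <= B by apply: sumr_ge0.
pose e' := e / (1 + B).
have e'0 : 0 < e' by rewrite divr_gt0// ltr_pwDl.
have ex i : exists q : rat, `|ecoord i x - ratr q| < e'.
  have [q] : exists q : rat, ratr q \in `]ecoord i x - e', ecoord i x + e'[.
    by apply: rat_in_itvoo; rewrite ltrBlDr -addrA ltrDl addr_gt0.
  by rewrite in_itv/= => /andP[q1 q2]; exists q; rewrite ltr_norml; apply/andP; split; lra.
have [q qP] := choice ex.
exists (\row_i q i); apply: (le_lt_trans (norm_le_ecoord _)).
apply: (@le_lt_trans _ _ (\sum_i e' * `|ebasis i|)).
  apply: ler_sum => i _; rewrite ler_wpM2r//.
  by rewrite ecoordB /erat ecombK !mxE ltW.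
rewrite -mulr_sumr -/B /e' mulrAC ltr_pdivrMr ?ltr_pwDl// ltr_pM2l//.
by rewrite ltrDr.
Qed.

(** Rational points need not lie in [U]. To each rational point and each [m] is attached a point of
    [U] within 1/(m+1) of it whenever there is one, and [u0] otherwise. *)
Lemma dense_sequence (U : set E) : U !=set0 ->
  exists2 v : nat -> E, (forall k, U (v k)) &
    forall x e, U x -> 0 < e -> exists k, `|x - v k| < e.
Proof.
move=> [u0 Uu0].
pose P (qm : 'rV[rat]_(\dim {:E}) * nat) (v : E) := U v /\
  ((exists2 w, U w & `|w - erat qm.1| < qm.2.+1%:R^-1) ->
  `|v - erat qm.1| < qm.2.+1%:R^-1).
have exv qm : exists v, P qm v.
  have [[w Uw wq]|nw] := pselect (exists2 w, U w & `|w - erat qm.1| < qm.2.+1%:R^-1).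
    by exists w.
  by exists u0.
have [v vP] := choice exv.
exists (fun k => if unpickle k is Some qm then v qm else u0).
  by move=> k; case: unpickle => // qm; have [] := vP qm.
move=> x e Ux e0.
have [m me] : exists m, m.+1%:R^-1 < e / 2.
  have := near_infty_natSinv_lt (PosNum (divr_gt0 e0 (ltr0n R 2))).
  by move=> [m _ /(_ m (leqnn m))] ?; exists m.
have m0 : 0 < m.+1%:R^-1 :> R by rewrite invr_gt0 ltr0n.
have [q xq] := erat_dense x m0.
exists (pickle (q, m)); rewrite pickleK.
have [Uv /(_ _)vq] := vP (q, m).
have {}vq := vq (ex_intro2 _ _ x Ux xq).
rewrite (_ : x - _ = (x - erat q) - (v (q, m) - erat q)); last by rewrite opprB addrA subrK.
rewrite (le_lt_trans (ler_normB _ _))//.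
by rewrite (splitr e) ltrD// (lt_trans _ me).
Qed.


End FiniteDimensional.

(** * The sewing lemma and Young integrals *)

Section Sewing.
Context {R : realType} (T : R).
Implicit Types (w : R -> R -> R) (s r t e : R).

(** A control in the sense of rough paths. In place of joint continuity, smallness on short
    intervals is asked, uniformly in their position. *)
Definition control w :=
  [/\ forall s t, 0 <= s -> s <= t -> t <= T -> 0 <= w s t,
      forall s r t, 0 <= s -> s <= r -> r <= t -> t <= T ->
        w s r + w r t <= w s t &
      forall e, 0 < e -> exists2 d, 0 < d &
        forall s t, 0 <= s -> s <= t -> t <= T -> t - s < d -> w s t < e].

Variable w : R -> R -> R.
Hypothesis cw : control w.

Lemma control_ge0 s t : 0 <= s -> s <= t -> t <= T -> 0 <= w s t.
Proof. by case: cw => h _ _; exact: h. Qed.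

Lemma control_refl s : 0 <= s -> s <= T -> w s s = 0.
Proof.
move=> s0 sT; case: cw => w0 wD _.
have := wD _ _ _ s0 (lexx s) (lexx s) sT; have := w0 _ _ s0 (lexx s) sT.
lra.
Qed.

Lemma control_le s t s' t' : 0 <= s' -> s' <= s -> s <= t -> t <= t' ->
  t' <= T -> w s t <= w s' t'.
Proof.
move=> s'0 s's st tt' t'T; case: cw => w0 wD _.
have s0 : 0 <= s by exact: le_trans s's.
have st' : s <= t' by exact: le_trans tt'.
have := wD _ _ _ s'0 s's st' t'T; have := wD _ _ _ s0 st tt' t'T.
have := w0 _ _ s'0 s's (le_trans st' t'T).
have := w0 _ _ (le_trans s0 st) tt' t'T.
lra.
Qed.

(** Dissections are monotone infinite sequences, so that index ranges can be cut anywhere without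
    re-indexing; a finite dissection is continued by its last point. *)
Definition points (c : nat -> R) :=
  (forall k, 0 <= c k <= T) /\ {homo c : i j / (i <= j)%N >-> i <= j}.

Lemma pointsP c : (forall k, 0 <= c k <= T) -> (forall k, c k <= c k.+1) ->
  points c.
Proof. by move=> h h'; split => //; apply/nondecreasing_seqP. Qed.

Lemma control_sum c i j : points c -> (i <= j)%N ->
  \sum_(i <= k < j) w (c k) (c k.+1) <= w (c i) (c j).
Proof.
move=> [c01 cm]; elim: j => [|j IH].
  rewrite leqn0 => /eqP ->; rewrite big_geq//.
  by apply: control_ge0 => //; have /andP[] := c01 0%N.
rewrite leq_eqVlt => /predU1P[->|]; last rewrite ltnS => ij.
  rewrite big_geq//; apply: control_ge0 => //;
  by have /andP[] := c01 j.+1.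
rewrite big_nat_recr//=; apply: le_trans (lerD (IH ij) (lexx _)) _.
case: cw => _ wD _; apply: wD; first by have /andP[] := c01 i.
- exact: cm.
- exact: cm.
- by have /andP[] := c01 j.+1.
Qed.

Lemma powR_split_le (th e z : R) : 1 < th -> 0 <= z -> z <= e ->
  z `^ th <= e `^ (th - 1) * z.
Proof.
move=> th1 z0 ze.
have [->|zn0] := eqVneq z 0.
  by rewrite powR0 ?mulr0// gt_eqF// (lt_trans ltr01).
have -> : z `^ th = z `^ (th - 1) * z.
  rewrite -{3}(powRr1 z0) -powRD ?subrK//.
  by rewrite zn0 implybT.
rewrite ler_wpM2r//; apply: ge0_ler_powR => //.
- by rewrite subr_ge0 ltW.
- by rewrite nnegrE (le_trans z0).
Qed.

Variables (th C : R) (Xi : R -> R -> R).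
Hypothesis th1 : 1 < th.
Hypothesis C0 : 0 <= C.
Hypothesis Xi0 : forall s, Xi s s = 0.
Hypothesis XiD : forall s r t, 0 <= s -> s <= r -> r <= t -> t <= T ->
  `|Xi s t - Xi s r - Xi r t| <= C * w s t `^ th.

(** The solution K of K = 2^(1 - th) K + 2 C, the balance of one cut of a dissection. *)
Definition sewing_cst := 2 * C / (1 - 2 `^ (1 - th)).

Let two_th : 2 `^ (1 - th) < 1 :> R.
Proof.
rewrite /powR gt_eqF// -[ltRHS]expR0 ltr_expR nmulr_rlt0 ?subr_lt0//.
by rewrite ln_gt0// ltr1n.
Qed.

Lemma sewing_cst_ge0 : 0 <= sewing_cst.
Proof. by rewrite divr_ge0 ?mulr_ge0// subr_ge0 ltW. Qed.

Let powR_half z : 0 <= z -> (z / 2) `^ th = z `^ th * (2 `^ (1 - th) / 2).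
Proof.
move=> z0; rewrite powRM ?invr_ge0//; congr (_ * _).
rewrite -(@powR_inv1 _ 2)// -powRrM -powRD; last by rewrite pnatr_eq0 implybT.
by congr (_ `^ _); ring.
Qed.

(* Cut where the control reaches half of its total: this loses two defects and
   leaves two shorter sums, whose errors add up to a fraction
   [2 `^ (1 - th) < 1] of the claimed bound. *)
Lemma sewing_sum c i j : points c -> (i <= j)%N ->
  `|\sum_(i <= k < j) Xi (c k) (c k.+1) - Xi (c i) (c j)|
     <= sewing_cst * w (c i) (c j) `^ th.
Proof.
move=> pc; have [c01 cm] := pc.
have cpos k : 0 <= c k by have /andP[] := c01 k.
have cT k : c k <= T by have /andP[] := c01 k.
move: {2}(j - i)%N (leqnn (j - i)) => n; elim: n i j => [|n IH] i j.
  rewrite leqn0 subn_eq0 => ji ij; have -> : i = j by apply/eqP; rewrite eqn_leq ij.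
  by rewrite big_geq// Xi0 subrr normr0 mulr_ge0 ?sewing_cst_ge0 ?powR_ge0.
move=> jin; rewrite leq_eqVlt => /predU1P[->|ij].
  by rewrite big_geq// Xi0 subrr normr0 mulr_ge0 ?sewing_cst_ge0 ?powR_ge0.
have W0 : 0 <= w (c i) (c j) by apply: control_ge0 => //; exact/cm/ltnW.
pose P m := (i <= m < j)%N && (w (c i) (c m) <= w (c i) (c j) / 2).
have Pi : exists m, P m.
  by exists i; rewrite /P leqnn ij/= control_refl// divr_ge0.
have Pj m : P m -> (m <= j)%N by case/andP => /andP[_ /ltnW].
case: (ex_maxnP Pi Pj) => m /andP[/andP[im mj] wm] mmax.
have wm' : w (c m.+1) (c j) <= w (c i) (c j) / 2.
  (* Maximality of [m] puts more than half of the control on [[c i, c m.+1]], so superadditivity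
     leaves at most half for the rest. *)
  move: mj; rewrite leq_eqVlt => /predU1P[->|mj].
    by rewrite control_refl// divr_ge0.
  have : ~~ P m.+1 by apply/negP => /mmax; rewrite ltnn.
  rewrite /P (leq_trans im)//= mj/= -ltNge => wm1.
  case: cw => _ wD _.
  have := wD _ _ _ (cpos i) (cm _ _ (leq_trans im (leqnSn m)))
    (cm _ _ (ltnW mj)) (cT j).
  lra.
have half_le z : 0 <= z -> z <= w (c i) (c j) / 2 ->
    z `^ th <= w (c i) (c j) `^ th * (2 `^ (1 - th) / 2).
  move=> z0 zw; rewrite -powR_half//; apply: ge0_ler_powR => //.
  - by rewrite (le_trans _ (ltW th1)).
  - by rewrite nnegrE divr_ge0.
have mi : (m - i <= n)%N.
  by rewrite -ltnS (leq_trans _ jin)// ltn_sub2r.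
have jm : (j - m.+1 <= n)%N.
  by rewrite -ltnS (leq_trans _ jin)// subnSK// leq_sub2l.
have h1 := IH _ _ mi im; have h2 := IH _ _ jm mj.
rewrite (big_cat_nat im (ltnW mj))/= (big_ltn mj).
have d1 := XiD (cpos i) (cm _ _ (leq_trans im (leqnSn m))) (cm _ _ mj) (cT j).
have d2 := XiD (cpos i) (cm _ _ im) (cm _ _ (leqnSn m)) (cT m.+1).
have d2' : C * w (c i) (c m.+1) `^ th <= C * w (c i) (c j) `^ th.
  rewrite ler_wpM2l//; apply: ge0_ler_powR => //.
  - by rewrite (le_trans _ (ltW th1)).
  - by rewrite nnegrE control_ge0// cm// (leq_trans im).
  - by apply: control_le => //; apply: cm => //; rewrite (leq_trans im).
have K0 := sewing_cst_ge0.
have h1' : sewing_cst * w (c i) (c m) `^ th <=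
    sewing_cst * (w (c i) (c j) `^ th * (2 `^ (1 - th) / 2)).
  by rewrite ler_wpM2l// half_le// control_ge0// cm.
have h2' : sewing_cst * w (c m.+1) (c j) `^ th <=
    sewing_cst * (w (c i) (c j) `^ th * (2 `^ (1 - th) / 2)).
  by rewrite ler_wpM2l// half_le// control_ge0// cm.
have KE : sewing_cst * w (c i) (c j) `^ th =
    2 * (sewing_cst * (w (c i) (c j) `^ th * (2 `^ (1 - th) / 2))) +
    2 * (C * w (c i) (c j) `^ th).
  have n0 : 1 - 2 `^ (1 - th) != 0 :> R by rewrite subr_eq0 gt_eqF.
  by rewrite /sewing_cst; field.
rewrite KE.
move: h1 h2 d1 d2; rewrite !ler_norml.
move: h1' h2' d2'.
set a1 := \sum_(i <= _ < _) _; set a2 := \sum_(_ <= _ < _) _.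
lra.
Qed.


(** The uniform grid with [n.+1] cells, capped at [T] so that every index is allowed. *)
Definition grid n k : R := Num.min (k%:R * T / n.+1%:R) T.

Hypothesis T0 : 0 < T.

Lemma grid_points n : points (grid n).
Proof.
have n0 : 0 < n.+1%:R :> R by rewrite ltr0n.
apply: pointsP => k.
  by rewrite /grid le_min ge_min lexx orbT andbT (ltW T0) divr_ge0 ?mulr_ge0// ltW.
rewrite /grid le_min !ge_min lexx orbT andbT.
by rewrite ler_wpM2r ?invr_ge0 ?ler0n// ler_wpM2r ?ler_nat// ltW.
Qed.

Lemma grid0 n : grid n 0 = 0.
Proof. by rewrite /grid !mul0r min_l// ltW. Qed.

Lemma gridT n : grid n n.+1 = T.
Proof. by rewrite /grid mulrAC divff ?pnatr_eq0// mul1r minxx. Qed.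

Lemma grid_mesh d : 0 < d ->
  exists n0, forall n k, (n0 <= n)%N -> grid n k.+1 - grid n k < d.
Proof.
move=> d0; have [n0 n0P] : exists n0 : nat, T / d < n0%:R.
  by exists (Num.bound (T / d)); exact: archi_boundP (ltW (divr_gt0 T0 d0)).
exists n0 => n k n0n.
have n1 : 0 < n.+1%:R :> R by rewrite ltr0n.
have Tn : T / n.+1%:R < d.
  rewrite ltr_pdivrMr// mulrC -ltr_pdivrMr//.
  by rewrite (lt_le_trans n0P)// ler_nat (leq_trans n0n).
have Tn0 : 0 < T / n.+1%:R by exact: divr_gt0.
rewrite /grid -[k.+1]addn1 natrD !mulrDl mul1r.
move: Tn Tn0; set a := k%:R * T / _; set b := T / _ => Tn Tn0; case: (leP a T); case: (leP (a + b) T); lra.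
Qed.

(** As [th > 1], a factor w^(th - 1) is arbitrarily small on short intervals; this is why sums of
    such powers vanish with the mesh. *)
Lemma control_small_powR e : 0 < e -> exists2 d, 0 < d &
  forall s t, 0 <= s -> s <= t -> t <= T -> t - s < d ->
    w s t `^ th <= e * w s t.
Proof.
move=> e0; case: (cw) => w0 _ /(_ (e `^ (th - 1)^-1)).
rewrite powR_gt0// => /(_ erefl)[d d0 dw]; exists d => // s t s0 st tT std.
have -> : e = (e `^ (th - 1)^-1) `^ (th - 1).
  by rewrite -powRrM mulVf ?powRr1 ?ltW// subr_eq0 gt_eqF.
apply: powR_split_le => //; first exact: w0.
exact/ltW/dw.
Qed.

Lemma control_sum_small e : 0 < e -> exists2 d, 0 < d &
  forall c i j, points c -> (i <= j)%N ->
    (forall k, (i <= k < j)%N -> c k.+1 - c k < d) ->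
    \sum_(i <= k < j) w (c k) (c k.+1) `^ th <= e.
Proof.
move=> e0; have W0 : 0 <= w 0 T by apply: control_ge0 => //; exact: ltW.
have We : 0 < e / (1 + w 0 T) by rewrite divr_gt0// ltr_pwDl.
have [d d0 dw] := control_small_powR We; exists d => // c i j pc ij cd.
have [c01 cm] := pc.
apply: (@le_trans _ _ (\sum_(i <= k < j) e / (1 + w 0 T) * w (c k) (c k.+1))).
  apply: ler_sum_nat => k kij; apply: dw; last exact: cd.
  - by have /andP[] := c01 k.
  - exact: cm.
  - by have /andP[] := c01 k.+1.
rewrite -mulr_sumr mulrAC ler_pdivrMr ?ltr_pwDl// ler_pM2l//.
rewrite (le_trans (control_sum pc ij))// (@le_trans _ _ (w 0 T))// ?lerDr//.
have /andP[ci0 _] := c01 i; have /andP[_ cjT] := c01 j.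
by apply: control_le => //; exact: cm.
Qed.

Let J n t := \sum_(0 <= k < n.+1)
  Xi (Num.min (grid n k) t) (Num.min (grid n k.+1) t).
Let err n := C * \sum_(0 <= k < n.+1) w (grid n k) (grid n k.+1) `^ th.

(** The sums over the grid stopped at [t] and at [s] differ by the sum over the grid clipped to
    [[s, t]], except in the cell that straddles [s], whose defect is bounded by the corresponding
    term of [err n]. The clipped sum is compared with [Xi s t] by [sewing_sum]. *)
Let J_germ n s t : 0 <= s -> s <= t -> t <= T ->
  `|J n t - J n s - Xi s t| <= sewing_cst * w s t `^ th + err n.
Proof.
move=> s0 st tT; have pg := grid_points n; have [g01 gm] := pg.
pose c k := Num.max s (Num.min (grid n k) t).
have pc : points c.
  split=> [k|i j ij].
    rewrite /c; move: (g01 k); move: (grid n k) => a /andP[_ aT].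
    by rewrite le_max s0/= ge_max (le_trans st tT)/= ge_min aT.
  rewrite /c; move: (gm _ _ ij); move: (grid n i) (grid n j) => a b ab.
  rewrite ge_max le_max lexx/= le_max; apply/orP; right.
  by rewrite le_min !ge_min ab lexx orbT.
have c0 : c 0%N = s by rewrite /c grid0 min_l ?(le_trans s0)// max_l.
have cn : c n.+1 = t by rewrite /c gridT min_r// max_r.
have := sewing_sum pc (leq0n n.+1); rewrite c0 cn => ss.
rewrite (_ : J n t - _ - _ = (\sum_(0 <= k < n.+1) Xi (c k) (c k.+1) - Xi s t) +
    (J n t - J n s - \sum_(0 <= k < n.+1) Xi (c k) (c k.+1))); last by ring.
rewrite (le_trans (ler_normD _ _))// lerD//.
rewrite /J -!sumrB /err mulr_sumr (le_trans (ler_norm_sum _ _ _))//.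
apply: ler_sum => k _.
have /andP[a0 aT] := g01 k; have /andP[b0 bT] := g01 k.+1.
have ab := gm _ _ (leqnSn k); rewrite /c.
move: (grid n k) (grid n k.+1) a0 aT b0 bT ab => a b a0 aT b0 bT ab.
have rhs0 : 0 <= C * w a b `^ th by rewrite mulr_ge0// powR_ge0.
(* The cell lies to the left of [s]: the two stopped terms agree and the clipped cell is a point. *)
have [bs|sb] := leP b s.
  have as_ := le_trans ab bs; have bt := le_trans bs st.
  rewrite (min_l (le_trans as_ st)) (min_l bt) ?(min_l as_).
  by rewrite ?(max_l as_) ?(max_l bs) Xi0 subrr subr0 normr0.
have [sa|as_] := leP s a.
  rewrite ?(min_r sa) ?(min_r (ltW sb)) Xi0 subr0.
  rewrite !max_r ?subrr ?normr0// le_min ?sa ?(ltW sb) ?st//.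
rewrite (min_l (le_trans (ltW as_) st)) ?(min_l (ltW as_)) ?(min_r (ltW sb)).
rewrite (max_l (ltW as_)) max_r; last by rewrite le_min (ltW sb).
apply: (le_trans (XiD _ _ _ _)) => //.
- exact: ltW.
- by rewrite le_min (ltW sb).
- by rewrite ge_min bT.
rewrite ler_wpM2l//; apply: ge0_ler_powR.
- by rewrite (le_trans _ (ltW th1)).
- rewrite nnegrE control_ge0// ?ge_min ?bT//.
  by rewrite le_min ab (le_trans (ltW as_)).
- by rewrite nnegrE control_ge0.
- apply: control_le => //; last by rewrite ge_min lexx.
  by rewrite le_min ab (le_trans (ltW as_)).
Qed.

Let err_small e : 0 < e -> \forall n \near \oo, err n <= e.
Proof.
move=> e0; have Ce : 0 < e / (1 + C) by rewrite divr_gt0// ltr_pwDl.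
have [d d0 dw] := control_sum_small Ce.
have [n0 n0P] := grid_mesh d0; exists n0 => // n /= n0n.
rewrite /err (@le_trans _ _ (C * (e / (1 + C))))//.
  rewrite ler_wpM2l//; apply: dw => //; first exact: grid_points.
  by move=> k _; exact: n0P.
by rewrite mulrCA ger_pMr// ler_pdivrMr ?ltr_pwDl// mul1r lerDr.
Qed.

(** By [J_germ] the sums [J n t] are bounded in [n], so along an ultrafilter finer than the filter
    at infinity they converge for every [t] at once, and no Cauchy estimate under refinement is
    made. The germ estimate survives the limit because [err n] tends to 0. *)
Theorem sewing : exists J : R -> R, forall s t, 0 <= s -> s <= t -> t <= T ->
  `|J t - J s - Xi s t| <= sewing_cst * w s t `^ th.
Proof.
have [G [GU ooG]] := @ultraFilterLemma nat \oo _.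
have JG t : exists l : R, 0 <= t -> t <= T -> J n t @[n --> G] --> l.
  have [/andP[t0 tT]|t01] := boolP ((0 <= t) && (t <= T)); last first.
    by exists 0 => t0 tT; move: t01; rewrite t0 tT.
  pose B := `|Xi 0 t| + (sewing_cst * w 0 t `^ th + 1).
  have [l [_ Jl]] : (`[- B, B]%classic `&`
      [set p : R | J n t @[n --> G] --> p]) !=set0; last by exists l.
  have [|l [lB cl]] := @segment_compact R (- B) B (J n t @[n --> G]); last first.
    exists l; split => // V Vl.
    have [//|nV] := @in_ultra_setVsetC _ G ((fun n => J n t) @^-1` V) GU.
    by have [x [nVx Vx]] := cl (~` V) V nV Vl; exfalso; exact: nVx.
  apply: ooG; near=> n.
  have J0 : J n 0 = 0.
    rewrite /J big1_seq// => k _; have [g01 _] := grid_points n.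
    have /andP[g0 _] := g01 k; have /andP[g1 _] := g01 k.+1.
    by rewrite !min_r.
  have := J_germ n (lexx 0) t0 tT; rewrite J0 subr0.
  have : err n <= 1 by near: n; exact: err_small.
  rewrite /= in_itv/= -ler_norml => en /le_trans => /(_ _ (lerD (lexx _) en)) h.
  rewrite -[J n t](subrK (Xi 0 t)) addrC (le_trans (ler_normD _ _))//.
  by rewrite lerD.
have [L LJ] := choice JG; exists L => s t s0 st tT.
have sT := le_trans st tT; have t0 := le_trans s0 st.
apply/ler_addgt0Pr => e e0.
apply: (@cvgr_to_le _ G _ R (fun n => `|J n t - J n s - Xi s t|)).
  apply: cvg_norm; apply: cvgB; last exact: cvg_cst.
  by apply: cvgB; exact: LJ.
apply: ooG; near=> n.
apply: (le_trans (J_germ n s0 st tT)); rewrite lerD//.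
by near: n; exact: err_small.
Unshelve. all: by end_near. Qed.
End Sewing.

(** * Functions with increments small relative to a control *)

Section SmallIncrements.
Context {R : realType} (T : R) (w : R -> R -> R).
Hypothesis (T0 : 0 < T) (cw : control T w).

Lemma fine_points a b d : 0 <= a -> a <= b -> b <= T -> 0 < d ->
  exists c N, [/\ points T c, c 0%N = a, c N = b,
    forall k, a <= c k <= b & forall k, c k.+1 - c k < d].
Proof.
move=> a0 ab bT d0; have [n /(_ n)] := grid_mesh T0 d0.
move=> /(_ _ (leqnn n)) mesh; have [g01 gm] := grid_points T0 n.
have cm k : Num.max a (Num.min (grid T n k) b) <=
    Num.max a (Num.min (grid T n k.+1) b).
  move: (gm _ _ (leqnSn k)); move: (grid T n k) (grid T n k.+1) => x y xy.
  rewrite ge_max le_max lexx/= le_max; apply/orP; right.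
  by rewrite le_min !ge_min xy lexx orbT.
have cab k : a <= Num.max a (Num.min (grid T n k) b) <= b.
  move: (grid T n k) => x.
  by rewrite le_max lexx/= ge_max ab/= ge_min lexx orbT.
exists (fun k => Num.max a (Num.min (grid T n k) b)), n.+1; split => //.
- apply: pointsP => // k; have /andP[h1 h2] := cab k.
  by rewrite (le_trans a0 h1) (le_trans h2 bT).
- by rewrite grid0// min_l ?(le_trans a0)// max_l.
- by rewrite gridT min_r// max_r.
- move=> k; apply: le_lt_trans (mesh k); move: (gm _ _ (leqnSn k)).
  move: (grid T n k) (grid T n k.+1) => x y xy.
  rewrite !minEle !maxEle; repeat (case: ifPn; rewrite -?ltNge); lra.
Qed.

(** Summed over a fine dissection, the decrease of [Phi] is at most [e] times [w a b], for every
    [e]. This takes the place of a sign condition on a derivative. *)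
Lemma le_small_increments (Phi : R -> R) a b :
  0 <= a -> a <= b -> b <= T ->
  (forall e, 0 < e -> exists2 d, 0 < d & forall s t,
    a <= s -> s <= t -> t <= b -> t - s < d -> Phi s - Phi t <= e * w s t) ->
  Phi a <= Phi b.
Proof.
move=> a0 ab bT small; apply/ler_addgt0Pr => e e0.
have W0 : 0 <= w a b by apply: (control_ge0 cw).
have [d d0 dP] := small _ (divr_gt0 e0 (ltr_pwDl ltr01 W0)).
have [c [N [pc c0 cN cab cd]]] := fine_points a0 ab bT d0.
have [_ cm] := pc.
have : \sum_(0 <= k < N) (Phi (c k) - Phi (c k.+1)) <= e.
  apply: (@le_trans _ _ (\sum_(0 <= k < N) e / (1 + w a b) * w (c k) (c k.+1))).
    apply: ler_sum => k _; apply: dP; last exact: cd.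
    - by have /andP[] := cab k.
    - exact: cm.
    - by have /andP[] := cab k.+1.
  rewrite -mulr_sumr mulrAC ler_pdivrMr ?ltr_pwDl// ler_pM2l//.
  rewrite (le_trans (control_sum cw pc (leq0n N)))//.
  by rewrite c0 cN lerDr.
rewrite -[X in X <= _]opprK -sumrN.
under eq_bigr do rewrite opprB.
by rewrite (telescope_sumr (Phi \o c))//= c0 cN; lra.
Qed.

Lemma eq_small_increments (Phi : R -> R) a b :
  0 <= a -> a <= b -> b <= T ->
  (forall e, 0 < e -> exists2 d, 0 < d & forall s t,
    a <= s -> s <= t -> t <= b -> t - s < d ->
    `|Phi t - Phi s| <= e * w s t) ->
  Phi a = Phi b.
Proof.
move=> a0 ab bT small; apply/eqP; rewrite eq_le; apply/andP; split.
  apply: le_small_increments => // e /small[d d0 dP]; exists d => // s t sa st tb std.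
  by apply: le_trans (dP s t sa st tb std); rewrite distrC ler_norm.
rewrite -lerN2; apply: (@le_small_increments (fun t => - Phi t)) => // e.
move=> /small[d d0 dP]; exists d => // s t sa st tb std.
by apply: le_trans (dP s t sa st tb std); rewrite opprK addrC ler_norm.
Qed.

Variable (th : R).
Hypothesis th1 : 1 < th.

Lemma sewing_riemann K (Xi : R -> R -> R) (J : R -> R) c i j :
  (forall s t, 0 <= s -> s <= t -> t <= T ->
    `|J t - J s - Xi s t| <= K * w s t `^ th) ->
  points T c -> (i <= j)%N ->
  `|\sum_(i <= k < j) Xi (c k) (c k.+1) - (J (c j) - J (c i))|
    <= K * \sum_(i <= k < j) w (c k) (c k.+1) `^ th.
Proof.
move=> JXi [c01 cm] ij; rewrite -(telescope_sumr (J \o c))// -sumrB.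
rewrite mulr_sumr (le_trans (ler_norm_sum _ _ _))//.
apply: ler_sum => k _; rewrite distrC /=; apply: JXi.
- by have /andP[] := c01 k.
- exact: cm.
- by have /andP[] := c01 k.+1.
Qed.

(** The constant [K] and the control are common to all [n], so one fine dissection brings every
    [Jn n] within [e / 3] of its Riemann sum; on that fixed dissection the finite sums converge
    termwise. *)
Lemma sewing_cvg K (Xin : nat -> R -> R -> R) (Jn : nat -> R -> R)
    (Xi : R -> R -> R) (J : R -> R) :
  (forall n s t, 0 <= s -> s <= t -> t <= T ->
    `|Jn n t - Jn n s - Xin n s t| <= K * w s t `^ th) ->
  (forall s t, 0 <= s -> s <= t -> t <= T ->
    `|J t - J s - Xi s t| <= K * w s t `^ th) ->
  (forall s t, 0 <= s -> s <= t -> t <= T -> Xin n s t @[n --> \oo] --> Xi s t) ->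
  (Jn n T - Jn n 0) @[n --> \oo] --> J T - J 0.
Proof.
move=> JXn JX Xcvg; apply/cvgrPdist_le => e e0.
have Ke : 0 < e / 3 / (1 + `|K|) by rewrite !divr_gt0// ltr_pwDl.
have [d d0 dP] := control_sum_small cw th1 T0 Ke.
have [c [N [pc c0 cN cab cd]]] := fine_points (lexx 0) (ltW T0) (lexx T) d0.
have small : `|K * \sum_(0 <= k < N) w (c k) (c k.+1) `^ th| <= e / 3.
  have S0 : 0 <= \sum_(0 <= k < N) w (c k) (c k.+1) `^ th.
    by apply: sumr_ge0 => k _; exact: powR_ge0.
  rewrite normrM (ger0_norm S0).
  apply: (@le_trans _ _ (`|K| * (e / 3 / (1 + `|K|)))).
    by rewrite ler_wpM2l//; apply: dP => // k _; exact: cd.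
  by rewrite mulrCA ger_pMr ?divr_gt0// ler_pdivrMr ?ltr_pwDl// mul1r lerDr.
have [c01 cm] := pc.
have : \sum_(0 <= k < N) Xin n (c k) (c k.+1) @[n --> \oo] -->
    \sum_(0 <= k < N) Xi (c k) (c k.+1).
  apply: cvg_big => [|k _]; first exact: add_continuous.
  apply: Xcvg; [by have /andP[] := c01 k|exact: cm|].
  by have /andP[] := c01 k.+1.
move=> /cvgrPdist_le/(_ _ (divr_gt0 e0 (ltr0n R 3))); apply: filterS => n.
have := sewing_riemann (JXn n) pc (leq0n N).
have := sewing_riemann JX pc (leq0n N); rewrite c0 cN.
move: small; rewrite !ler_norml.
set S1 := \sum_(_ <= _ < _) Xi _ _; set S2 := \sum_(_ <= _ < _) Xin _ _ _.
set Z := K * _; lra.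
Qed.

End SmallIncrements.

(** * Existence of Young integrals *)

Section YoungExistence.
Context {R : realType} {V : normedModType R} (T : R) (w : R -> R -> R).
Hypothesis (T0 : 0 < T) (cw : control T w).
Variables (kap iota : R) (y : R -> V).
Hypothesis (kap0 : 0 < kap) (iota0 : 0 < iota) (th1 : 1 < kap + iota).
Hypothesis hy : forall s t, 0 <= s -> s <= t -> t <= T ->
  `|y t - y s| <= w s t `^ iota.

Definition control_holder (X : R -> 'L(V, R^o)) (C : R) :=
  forall s t, 0 <= s -> s <= t -> t <= T -> `|X t - X s| <= C * w s t `^ kap.

(** The sewing estimate for the germ [X s (y t - y s)]. Unlike the bare integral it keeps the local
    expansion of [J], which the duality argument needs. *)
Definition young_primitive (X : R -> 'L(V, R^o)) (C : R) (J : R -> R) :=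
  forall s t, 0 <= s -> s <= t -> t <= T ->
    `|J t - J s - X s (y t - y s)|
      <= sewing_cst (kap + iota) C * w s t `^ (kap + iota).

Lemma opnormP (W1 W2 : normedModType R) (A : 'L(W1, W2)) x :
  `|A x| <= `|A| * `|x|.
Proof.
have [->|x0] := eqVneq x 0; first by rewrite linear0 !normr0 mulr0.
have nx : 0 < `|x| by rewrite normr_gt0.
rewrite -ler_pdivrMr//.
have := @opnorm_ub _ _ _ A (`|x|^-1 *: x); rewrite normfZV// => /(_ (lexx _)).
by rewrite linearZ/= normrZ normfV normr_id mulrC.
Qed.

Let w_powRM s r t : 0 <= s -> s <= r -> r <= t -> t <= T ->
  w s r `^ kap * w r t `^ iota <= w s t `^ (kap + iota).
Proof.
move=> s0 sr rt tT.
have w1 : 0 <= w s r by apply: (control_ge0 cw) => //; exact: le_trans tT.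
have w2 : 0 <= w r t by apply: (control_ge0 cw) => //; exact: le_trans sr.
have w3 : 0 <= w s t by apply: (control_ge0 cw) => //; exact: le_trans rt.
rewrite powRD; last by rewrite gt_eqF// addr_gt0.
have [kap0' iota0'] := (ltW kap0, ltW iota0).
apply: ler_pM; rewrite ?powR_ge0//; apply: ge0_ler_powR; rewrite ?nnegrE//.
  exact: (control_le cw).
exact: (control_le cw).
Qed.

Lemma young_primitive_exists X C : 0 <= C -> control_holder X C ->
  exists J, young_primitive X C J.
Proof.
move=> C0 hX.
have Xi0 s : X s (y s - y s) = 0 by rewrite subrr linear0.
apply: (sewing cw th1 C0 Xi0 _ T0) => s r t s0 sr rt tT.
(* The defect of the germ is a product of increments over [[s, r]] and [[r, t]], each bounded by a
   power of the control. *)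
have -> : X s (y t - y s) - X s (y r - y s) - X r (y t - y r) =
    - ((X r - X s) (y t - y r)).
  rewrite (_ : y t - y s = (y t - y r) + (y r - y s)); last by rewrite addrA subrK.
  rewrite linearD addrK.
  by have -> : (X r - X s) (y t - y r) = X r (y t - y r) - X s (y t - y r) by []; rewrite opprB.
rewrite normrN (le_trans (opnormP _ _))//.
apply: (@le_trans _ _ (C * w s r `^ kap * w r t `^ iota)).
  apply: ler_pM => //; last by apply: hy => //; exact: le_trans sr.
  by apply: hX => //; exact: le_trans tT.
by rewrite -mulrA ler_wpM2l// w_powRM.
Qed.

(** With default value [b] the list is continued by its end point, which gives an infinite monotone
    sequence. *)
Lemma partition_points a b s : 0 <= a -> b <= T -> itv_partition a b s ->
  points T (fun k => nth b (a :: s) k) /\ nth b (a :: s) (size s) = b.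
Proof.
move=> a0 bT [ps /eqP ls].
have lastE : nth b (a :: s) (size s) = b by rewrite -[in RHS]ls (last_nth b).
have step k : nth b (a :: s) k <= nth b (a :: s) k.+1.
  have [ks|sk] := ltnP k (size s); first exact/ltW/(pathP b ps).
  have -> : nth b (a :: s) k.+1 = b by rewrite nth_default.
  move: sk; rewrite leq_eqVlt => /predU1P[<-|sk]; first by rewrite lastE.
  by rewrite nth_default.
have mono : {homo (fun k => nth b (a :: s) k) : i j / (i <= j)%N >-> i <= j}.
  exact/nondecreasing_seqP.
split=> //; split => // k; rewrite (le_trans a0 (mono 0%N k _))//=.
rewrite (le_trans _ bT)//; have := mono k (maxn k (size s).+1) (leq_maxl _ _).
by rewrite [X in _ <= X]nth_default// leq_maxr.
Qed.

(** Moving the evaluation point from the left end of a cell to [tau k] costs at most C w^th on that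
    cell, the same order as the sewing error; both sums vanish with the mesh. *)
Lemma young_primitive_integral X C J a b : 0 <= C -> control_holder X C ->
  young_primitive X C J -> 0 <= a -> a <= b -> b <= T ->
  is_young_integral a b X y (J b - J a).
Proof.
move=> C0 hX JX a0 ab bT e e0.
set K := sewing_cst (kap + iota) C.
have K0 : 0 <= K by exact: sewing_cst_ge0.
have CK0 : 0 <= C + K by rewrite addr_ge0.
have Ke : 0 < e / 2 / (1 + (C + K)) by rewrite !divr_gt0// ltr_pwDl.
have [d d0 dP] := control_sum_small cw th1 T0 Ke.
exists d => // s tau ps taus.
have [pc cN] := partition_points a0 bT ps; have [c01 cm] := pc.
pose c k := nth b (a :: s) k.
have -> : \sum_(i < size s) X (tau i) (y (nth b s i) - y (nth b (a :: s) i)) =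
    \sum_(0 <= i < size s) X (tau i) (y (c i.+1) - y (c i)) by rewrite big_mkord.
have := sewing_riemann JX pc (leq0n (size s)); rewrite cN/= -/K -/(c _) => h.
have cd k : (0 <= k < size s)%N -> c k.+1 - c k < d.
  by move=> /andP[_ /taus[]].
have {}dP := dP c 0%N (size s) pc (leq0n _) cd.
set S := \sum_(0 <= k < size s) w (c k) (c k.+1) `^ (kap + iota) in h dP *.
have h2 : `|\sum_(0 <= i < size s) X (tau i) (y (c i.+1) - y (c i)) -
    \sum_(0 <= i < size s) X (c i) (y (c i.+1) - y (c i))| <= C * S.
  rewrite -sumrB /S mulr_sumr (le_trans (ler_norm_sum _ _ _))//.
  apply: ler_sum_nat => k /andP[_ /taus[_ ct tc]].
  have -> : X (tau k) (y (c k.+1) - y (c k)) - X (c k) (y (c k.+1) - y (c k)) =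
    (X (tau k) - X (c k)) (y (c k.+1) - y (c k)) by [].
  have ck0 : 0 <= c k by have /andP[] := c01 k.
  have ckT : c k.+1 <= T by have /andP[] := c01 k.+1.
  have ckk : c k <= c k.+1 by exact: cm.
  have wk : 0 <= w (c k) (c k.+1) by exact: (control_ge0 cw).
  rewrite powRD; last by rewrite gt_eqF// addr_gt0.
  rewrite (le_trans (opnormP _ _))// mulrA; apply: ler_pM => //; last exact: hy.
  apply: (@le_trans _ _ (C * w (c k) (tau k) `^ kap)).
    by apply: hX => //; exact: le_trans ckT.
  rewrite ler_wpM2l//; apply: ge0_ler_powR; rewrite ?nnegrE//.
  - exact: ltW.
  - by apply: (control_ge0 cw) => //; exact: le_trans ckT.
  - exact: (control_le cw).
have : (C + K) * S < e.
  apply: (@le_lt_trans _ _ ((C + K) * (e / 2 / (1 + (C + K))))).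
    by rewrite ler_wpM2l.
  rewrite mulrA ltr_pdivrMr ?ltr_pwDl//.
  have := mulr_ge0 (ltW e0) CK0; nra.
move: h h2; rewrite mulrDl !ler_norml ltr_norml.
set S1 := \sum_(_ <= _ < _) X (tau _) _; set S2 := \sum_(_ <= _ < _) X (c _) _.
lra.
Qed.

End YoungExistence.

(** * Uniqueness of Young integrals *)

Section YoungUniqueness.
Context {R : realType} {V W : normedModType R}.

Lemma fine_partition (a b d : R) : a <= b -> 0 < d ->
  exists2 s, itv_partition a b s &
    forall i, (i < size s)%N -> nth b s i - nth b (a :: s) i < d.
Proof.
move=> ab d0; have [n nP] : exists n : nat, b - a < n%:R * (d / 2).
  exists (Num.bound ((b - a) / (d / 2))).
  rewrite -ltr_pdivrMr ?divr_gt0//; apply: archi_boundP.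
  by rewrite divr_ge0 ?subr_ge0// divr_ge0// ltW.
elim: n a ab nP => [|n IH] a ab nP; first by move: nP; rewrite mul0r; lra.
move: ab; rewrite le_eqVlt => /predU1P[<-|ab]; first by exists [::].
have [bad|abd] := ltP (b - a) d.
  by exists [:: b]; [exact: itv_partition1|case].
have [|  |s ps sd] := IH (a + d / 2); first lra.
  by move: nP; rewrite -natr1 mulrDl mul1r; set z := n%:R * _; lra.
exists (a + d / 2 :: s).
  by case: ps => ps ls; split => //=; rewrite ps andbT; lra.
case=> [_|i si] /=; first lra.
exact: sd.
Qed.

(** Some dissection is finer than both thresholds, and its left-point sum is close to both
    values. *)
Lemma young_integral_unique (a b : R) (X : R -> 'L(V, W)) (y : R -> V) l l' :
  a <= b -> is_young_integral a b X y l -> is_young_integral a b X y l' ->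
  l = l'.
Proof.
move=> ab yl yl'; apply/eqP; rewrite -subr_eq0 -normr_le0; apply/ler_addgt0Pr.
move=> e e0; have e2 : 0 < e / 2 by rewrite divr_gt0.
have [d d0 dP] := yl _ e2; have [d' d'0 dP'] := yl' _ e2.
have dd'0 : 0 < Num.min d d' by rewrite lt_min d0.
have [s ps sd] := fine_partition ab dd'0.
have tau i : (i < size s)%N -> nth b (a :: s) i <= nth b s i.
  by case: ps => ps _ si; exact/ltW/(pathP b ps).
have h1 := dP s (fun i => nth b (a :: s) i) ps.
have h2 := dP' s (fun i => nth b (a :: s) i) ps.
set S := \sum_(i < _) _ in h1 h2.
have {}h1 : `|S - l| < e / 2.
  apply: h1 => i si; split; [|exact: lexx|exact: tau].
  by rewrite (lt_le_trans (sd i si))// ge_min lexx.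
have {}h2 : `|S - l'| < e / 2.
  apply: h2 => i si; split; [|exact: lexx|exact: tau].
  by rewrite (lt_le_trans (sd i si))// ge_min lexx orbT.
rewrite add0r (splitr e).
rewrite (_ : l - l' = (S - l') - (S - l)); last first.
  by rewrite opprB [RHS]addrC addrA subrK.
by rewrite (le_trans (ler_normB _ _))// lerD// ltW.
Qed.

Lemma young_integralE (a b : R) (X : R -> 'L(V, W)) (y : R -> V) l :
  a <= b -> is_young_integral a b X y l -> young_integral a b X y = l.
Proof.
move=> ab yl; apply: (young_integral_unique ab _ yl).
exact: getI yl.
Qed.

End YoungUniqueness.

(** * Continuity on subsets *)

Section WithinContinuity.
Context {R : realType}.

Lemma within_continuous_dist (V W : normedModType R) (A : set V) (h : V -> W) :
  {within A, continuous h} <->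
  (forall x e, A x -> 0 < e -> exists2 d, 0 < d &
    forall y, A y -> `|x - y| < d -> `|h x - h y| < e).
Proof.
split=> [/subspace_continuousP ch x e Ax e0|ch].
  have /cvgrPdist_lt/(_ _ e0) := ch x Ax.
  rewrite near_withinE => /nbhs_normP[d /= d0 dP]; exists d => // y Ay xy.
  exact: dP.
apply/subspace_continuousP => x Ax; apply/cvgrPdist_lt => e e0.
have [d d0 dP] := ch x e Ax e0; rewrite near_withinE; apply/nbhs_normP.
by exists d => // y /= xy Ay; exact: dP.
Qed.

Lemma within_comp (U V W : topologicalType) (A : set U) (B : set V)
    (h : V -> W) (k : U -> V) :
  {within A, continuous k} -> (forall x, A x -> B (k x)) ->
  {within B, continuous h} -> {within A, continuous (fun x => h (k x))}.
Proof.
move=> /subspace_continuousP ck AB /subspace_continuousP ch.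
apply/subspace_continuousP => x Ax.
apply: (@cvg_comp _ _ _ k h _ (within B (nbhs (k x)))); last exact/ch/AB.
move=> P kP; have := ck x Ax _ kP.
rewrite -[X in X -> _]/(nbhs x [set z | A z -> B (k z) -> P (k z)]).
rewrite -[X in _ -> X]/(nbhs x [set z | A z -> P (k z)]).
by apply: filterS => z h1 Az; apply: h1 => //; exact: AB.
Qed.

Lemma within_pair (U V W : topologicalType) (A : set U) (h : U -> V)
    (k : U -> W) : {within A, continuous h} -> {within A, continuous k} ->
  {within A, continuous (fun x => (h x, k x))}.
Proof.
move=> /subspace_continuousP ch /subspace_continuousP ck.
by apply/subspace_continuousP => x Ax; exact: (cvg_pair (ch x Ax) (ck x Ax)).
Qed.

(** Compactness in near-covering form: around each point one [d] serves a whole neighbourhood, and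
    near 0 from the right [d] serves the entire segment. *)
Lemma within_uniform (V : normedModType R) (a b : R) (y : R -> V) (e : R) :
  {within `[a, b], continuous y} -> 0 < e -> exists2 d, 0 < d &
    forall s t, a <= s <= b -> a <= t <= b -> `|s - t| < d -> `|y s - y t| < e.
Proof.
move=> /within_continuous_dist cy e0.
have e2 : 0 < e / 2 by rewrite divr_gt0.
have := @segment_compact R a b; rewrite compact_near_coveringP.
move=> /near_covering_withinP/(_ R (0^'+)%classic
  (fun d s => forall t, a <= t <= b -> `|s - t| < d -> `|y s - y t| < e) _) h.
have /h : forall x : R, `[a, b]%classic x -> \forall x' \near x & i \near 0^'+,
    `[a, b]%classic x' -> forall t, a <= t <= b -> `|x' - t| < i -> `|y x' - y t| < e.
  move=> x xab; have [d d0 dP] := cy x _ xab e2.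
  have d2 : 0 < d / 2 by rewrite divr_gt0.
  exists ([set x' : R | `|x - x'| < d / 2], [set i : R | i < d / 2]) => /=.
    split; first by apply/nbhs_normP; exists (d / 2).
    exact: nbhs_right_lt.
  move=> [x' i] /= [xx' id] x'ab t tab x't.
  have h1 : `|y x - y x'| < e / 2 by apply: dP => //; rewrite (lt_trans xx')//; lra.
  have h2 : `|y x - y t| < e / 2.
    apply: dP; first by rewrite /= in_itv.
    rewrite (_ : x - t = (x - x') + (x' - t)); last by rewrite addrA subrK.
    by rewrite (le_lt_trans (ler_normD _ _))// (splitr d) ltrD// (lt_trans x't).
  rewrite (_ : y x' - y t = (y x - y t) - (y x - y x')); last by rewrite opprB [RHS]addrC addrA subrK.
  by rewrite (le_lt_trans (ler_normB _ _))// (splitr e) ltrD.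
move=> {}h; near (0 : R)^'+ => d; exists d => // s t sab.
have : `[a, b]%classic `<=`
   (fun s => forall t, a <= t <= b -> `|s - t| < d -> `|y s - y t| < e).
  by near: d.
by apply; rewrite /= in_itv.
Unshelve. all: by end_near. Qed.

Lemma within_bounded (V : normedModType R) (a b : R) (y : R -> V) :
  {within `[a, b], continuous y} ->
  exists2 M, 0 < M & forall s, a <= s <= b -> `|y s| <= M.
Proof.
move=> cy; have := continuous_compact cy (@segment_compact R a b).
move=> /compact_bounded[M [_ MP]]; exists (1 + `|M|); first by rewrite ltr_pwDl.
move=> s sab; apply: (MP (1 + `|M|)); first by rewrite (le_lt_trans (ler_norm _))// ltrDr.
by exists s => //=; rewrite in_itv.
Qed.

End WithinContinuity.

(** * Controls, p-variation and absolute continuity *)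

Section Controls.
Context {R : realType} (T : R).
Implicit Types (s t e : R) (w : R -> R -> R).

Lemma control_add w1 w2 : control T w1 -> control T w2 ->
  control T (fun s t => w1 s t + w2 s t).
Proof.
move=> [p1 a1 s1] [p2 a2 s2]; split.
- by move=> s t s0 st tT; rewrite addr_ge0 ?p1 ?p2.
- move=> s r t s0 sr rt tT; have := a1 _ _ _ s0 sr rt tT.
  have := a2 _ _ _ s0 sr rt tT; lra.
- move=> e e0; have e2 : 0 < e / 2 by rewrite divr_gt0.
  have [d1 d10 h1] := s1 _ e2; have [d2 d20 h2] := s2 _ e2.
  exists (Num.min d1 d2); first by rewrite lt_min d10.
  move=> s t s0 st tT; rewrite lt_min => /andP[st1 st2].
  by rewrite (splitr e) ltrD ?h1 ?h2.
Qed.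

Lemma control_scale (k : R) w : 0 < k -> control T w ->
  control T (fun s t => k * w s t).
Proof.
move=> k0 [p1 a1 s1]; split.
- by move=> s t s0 st tT; rewrite mulr_ge0 ?p1// ltW.
- by move=> s r t s0 sr rt tT; rewrite -mulrDr ler_pM2l ?a1.
- move=> e e0; have [d d0 h] := s1 _ (divr_gt0 e0 k0); exists d => // s t s0 st tT std.
  by rewrite mulrC -ltr_pdivlMr// h.
Qed.

Lemma control_sum_ord n (w : 'I_n -> R -> R -> R) :
  (forall i, control T (w i)) -> control T (fun s t => \sum_i w i s t).
Proof.
move=> cw; suff : forall l : seq 'I_n, control T (fun s t => \sum_(i <- l) w i s t).
  exact.
elim=> [|i l IH].
  rewrite (_ : (fun s t => _) = (fun _ _ => 0)).
    by split; [move=> *|move=> *; rewrite addr0|move=> e e0; exists 1].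
  by apply/funext => s; apply/funext => t; rewrite big_nil.
rewrite (_ : (fun s t => _) = (fun s t => w i s t + \sum_(j <- l) w j s t)).
  exact: control_add.
by apply/funext => s; apply/funext => t; rewrite big_cons.
Qed.

Lemma control_increments (a : R -> R) : {within `[0, T], continuous a} ->
  (forall s t, 0 <= s -> s <= t -> t <= T -> a s <= a t) ->
  control T (fun s t => a t - a s).
Proof.
move=> ca ma; split.
- by move=> s t s0 st tT; rewrite subr_ge0 ma.
- by move=> s r t s0 sr rt tT; lra.
- move=> e e0; have [d d0 dP] := within_uniform ca e0; exists d => // s t s0 st tT std.
  rewrite (le_lt_trans (ler_norm _))//; apply: dP.
  + by rewrite (le_trans s0 st) tT.
  + by rewrite s0 (le_trans st tT).
  + by rewrite ger0_norm ?subr_ge0.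
Qed.

End Controls.

(** * The variation of a path as a control *)

Section PathVariation.
Context {R : realType} {V : normedModType R}.
Implicit Types (a b s t q : R) (y : R -> V) (l : seq R).

(** The sums of [p_variation] in recursive form, for which concatenating dissections is immediate;
    [vsumE] links the two. *)
Fixpoint vsum q y a l : R :=
  if l is b :: l' then `|y b - y a| `^ q + vsum q y b l' else 0.

Lemma vsumE q y a b l : vsum q y a l =
  \sum_(i < size l) `|y (nth b l i) - y (nth b (a :: l) i)| `^ q.
Proof.
elim: l a => [|c l IH] a; first by rewrite big_ord0.
by rewrite big_ord_recl /= IH.
Qed.

Lemma vsum_ge0 q y a l : 0 <= vsum q y a l.
Proof. by elim: l a => // b l IH a; rewrite addr_ge0// powR_ge0. Qed.

Lemma vsum_cat q y a l l' :
  vsum q y a (l ++ l') = vsum q y a l + vsum q y (last a l) l'.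
Proof. by elim: l a => [|b l IH] a /=; rewrite ?add0r// IH addrA. Qed.

Lemma vsum_exponent p q y a b D l : 0 < p -> p <= q -> itv_partition a b l ->
  (forall s t, a <= s <= b -> a <= t <= b -> `|y s - y t| <= D) ->
  vsum q y a l <= D `^ (q - p) * vsum p y a l.
Proof.
move=> p0 pq; elim: l a => [|c l IH] a pl D_; first by rewrite mulr0.
have cb : c <= b by apply: itv_partition_le (itv_partition_cons pl).
have ac : a < c by case: pl => /= /andP[].
rewrite /= mulrDr lerD//; last first.
  apply: IH; first exact: itv_partition_cons pl.
  move=> s t /andP[cs sb] /andP[ct tb]; apply: D_.
    by rewrite (le_trans (ltW ac) cs).
  by rewrite (le_trans (ltW ac) ct).
have D1 : `|y c - y a| <= D by apply: D_; rewrite ?lexx ?cb ?(ltW ac)//= (le_trans (ltW ac)).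
have [->|n0] := eqVneq `|y c - y a| 0.
  by rewrite powR0 ?mulr_ge0 ?powR_ge0// gt_eqF// (lt_le_trans p0).
have -> : `|y c - y a| `^ q = `|y c - y a| `^ (q - p) * `|y c - y a| `^ p.
  by rewrite -powRD ?subrK// n0 implybT.
have D0 : 0 <= D := le_trans (normr_ge0 _) D1.
by rewrite ler_wpM2r ?powR_ge0//; apply: ge0_ler_powR; rewrite ?subr_ge0 ?nnegrE.
Qed.

Definition pvar q y s t := sup [set vsum q y s l | l in itv_partition s t].

Lemma itv_partition_extend (T : R) s t l : 0 <= s -> t <= T ->
  itv_partition s t l -> exists l1 l2, itv_partition 0 T (l1 ++ l ++ l2) /\
  last 0 l1 = s.
Proof.
move=> s0 tT pl.
have [l1 [p1 ls]] : exists l1, itv_partition 0 s l1 /\ last 0 l1 = s.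
  move: s0; rewrite le_eqVlt => /predU1P[<-|s0]; first by exists [::].
  by exists [:: s]; split => //; exact: itv_partition1.
have [l2 p2] : exists l2, itv_partition t T l2.
  move: tT; rewrite le_eqVlt => /predU1P[->|tT]; first by exists [::].
  by exists [:: T]; exact: itv_partition1.
exists l1, l2; split => //.
exact: itv_partition_cat p1 (itv_partition_cat pl p2).
Qed.

(** Superadditivity comes from concatenating dissections. Smallness on short intervals is where
    [p < q] enters: the [q]-th power of an increment is at most its [p]-th power times the
    oscillation to the power [q - p], and the oscillation tends to 0 with the length by uniform
    continuity. *)
Lemma pvar_control (T p q : R) y : 0 < T -> 0 < p -> p < q ->
  {within `[0, T], continuous y} -> (p_variation p 0 T y < +oo)%E ->
  control T (pvar q y) /\ forall s t, 0 <= s -> s <= t -> t <= T ->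
    `|y t - y s| <= pvar q y s t `^ q^-1.
Proof.
move=> T0 p0 pq cy pfin.
have [M M0 MP] : exists2 M, 0 <= M &
    forall l, itv_partition 0 T l -> vsum p y 0 l <= M.
  pose S := ereal_sup [set (\sum_(i < size s)
       `|y (nth T s i) - y (nth T (0 :: s) i)| `^ p)%:E
     | s in [set s | itv_partition 0 T s]].
  have Sl l : itv_partition 0 T l -> ((vsum p y 0 l)%:E <= S)%E.
    by move=> pl; apply: ereal_sup_ubound; exists l => //; rewrite (vsumE _ _ _ T).
  have S0 : (0 <= S)%E.
    by apply: le_trans (Sl _ (itv_partition1 T0)); rewrite lee_fin vsum_ge0.
  have Sfin : (S < +oo)%E.
    rewrite ltNge leye_eq; apply/negP => /eqP Soo.
    by move: pfin; rewrite /p_variation -/S Soo poweRyr ?invr_eq0 ?gt_eqF// ltxx.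
  exists (fine S) => [|l /Sl]; first exact: fine_ge0.
  by rewrite -lee_fin fineK// ge0_fin_numE.
have MPst s t l : 0 <= s -> t <= T -> itv_partition s t l -> vsum p y s l <= M.
  move=> s0 tT /(itv_partition_extend s0 tT)[l1 [l2 [/MP + ls]]].
  rewrite !vsum_cat ls; have := vsum_ge0 p y 0 l1.
  have := vsum_ge0 p y (last s l) l2; lra.
have [B B0 BP] := within_bounded cy.
have bound D s t l : 0 <= s -> t <= T -> itv_partition s t l ->
    (forall r r', s <= r <= t -> s <= r' <= t -> `|y r - y r'| <= D) ->
    vsum q y s l <= D `^ (q - p) * M.
  move=> s0 tT pl Dst; apply: le_trans (vsum_exponent p0 (ltW pq) pl Dst) _.
  by rewrite ler_wpM2l ?powR_ge0// (MPst _ _ _ s0 tT pl).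
have hs s t : 0 <= s -> s <= t -> t <= T ->
    has_sup [set vsum q y s l | l in itv_partition s t].
  move=> s0 st tT; split.
    move: st; rewrite le_eqVlt => /predU1P[->|st].
      by exists (vsum q y t [::]), [::].
    by exists (vsum q y s [:: t]), [:: t] => //; exact: itv_partition1.
  exists ((B + B) `^ (q - p) * M) => _ [l pl <-]; apply: (bound _ _ _ _ s0 tT pl).
  move=> r r' /andP[sr rt] /andP[sr' rt'].
  rewrite (le_trans (ler_normB _ _))// lerD// BP//.
    by rewrite (le_trans s0 sr) (le_trans rt tT).
  by rewrite (le_trans s0 sr') (le_trans rt' tT).
have pvar_ub s t l : 0 <= s -> s <= t -> t <= T -> itv_partition s t l ->
    vsum q y s l <= pvar q y s t.
  by move=> s0 st tT pl; apply: ub_le_sup; [exact: (hs s t s0 st tT).2|exists l].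
have pvar_le s t N : 0 <= s -> s <= t -> t <= T ->
    (forall l, itv_partition s t l -> vsum q y s l <= N) -> pvar q y s t <= N.
  move=> s0 st tT h; apply: ge_sup; first exact: (hs s t s0 st tT).1.
  by move=> _ [l pl <-]; exact: h.
have q0 : 0 < q by exact: lt_trans pq.
split; last first.
  move=> s t s0; rewrite le_eqVlt => /predU1P[->|st] tT.
    by rewrite subrr normr0 powR_ge0.
  have := pvar_ub _ _ _ s0 (ltW st) tT (itv_partition1 st).
  rewrite /= addr0 => h; rewrite -[X in X <= _](@powRr1 _) // -(mulfV (lt0r_neq0 q0)) powRrM.
  have P0 := le_trans (powR_ge0 _ _) h.
  by apply: ge0_ler_powR; rewrite ?nnegrE ?powR_ge0 ?invr_ge0// ltW.
split.
- move=> s t s0 st tT; have [[_ [l pl _]] _] := hs s t s0 st tT.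
  exact: le_trans (vsum_ge0 _ _ _ _) (pvar_ub _ _ _ s0 st tT pl).
- move=> s r t s0 sr rt tT; have r0 := le_trans s0 sr; have rT := le_trans rt tT.
  rewrite -lerBrDr; apply: (pvar_le _ _ _) => // l pl.
  rewrite lerBrDr addrC -lerBrDr; apply: (pvar_le _ _ _) => // l' pl'.
  rewrite lerBrDr addrC.
  have -> : vsum q y s l + vsum q y r l' = vsum q y s (l ++ l').
    by rewrite vsum_cat; case: pl => _ /eqP ->.
  apply: (pvar_ub _ _ _) => //; first exact: le_trans rt.
  exact: itv_partition_cat pl pl'.
- move=> e e0; have qp : 0 < q - p by rewrite subr_gt0.
  have eM : 0 < e / (1 + M) by rewrite divr_gt0// ltr_pwDl.
  (* Chosen so that D^(q - p) M = e M / (1 + M) < e. *)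
  pose D := (e / (1 + M)) `^ (q - p)^-1.
  have D0 : 0 < D by exact: powR_gt0.
  have [d d0 dP] := within_uniform cy D0; exists d => // s t s0 st tT std.
  apply: (@le_lt_trans _ _ (D `^ (q - p) * M)).
    apply: (pvar_le _ _ _) => // l pl; apply: (bound _ _ _ _ s0 tT pl).
    move=> r r' /andP[sr rt] /andP[sr' rt']; apply/ltW/dP.
    + by rewrite (le_trans s0 sr) (le_trans rt tT).
    + by rewrite (le_trans s0 sr') (le_trans rt' tT).
    + by rewrite ltr_norml; apply/andP; split; lra.
  rewrite /D -powRrM mulVf ?gt_eqF// powRr1 ?(ltW eM)//.
  by rewrite mulrAC ltr_pdivrMr ?ltr_pwDl// ltr_pM2l// ltrDr.
Qed.

End PathVariation.

(** * Absolute continuity and total variation *)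

Section AbsoluteContinuity.
Context {R : realType}.
Implicit Types (a b s t e : R) (h : R -> R).

Lemma abs_continuous_within (V : normedModType R) (a b : R) (h : R -> V) :
  abs_continuous a b h -> {within `[a, b], continuous h}.
Proof.
move=> ah; apply/within_continuous_dist => x e xab e0.
have [d d0 dP] := ah e e0; exists d => // y yab xyd.
have tI (l r : R) : trivIset setT (fun i : 'I_1 => `]l, r[%classic).
  by move=> i j _ _ _; rewrite !ord1.
move: xab yab; rewrite /= !in_itv/= => /andP[ax xb] /andP[ay yb].
have [xy|yx] := leP x y.
  have := dP 1%N (fun=> x) (fun=> y); rewrite !big_ord_recl !big_ord0 !addr0 distrC.
  apply; [by move=> _; split|exact: tI|].
  by rewrite (le_lt_trans (ler_norm _))// distrC.
have := dP 1%N (fun=> y) (fun=> x); rewrite !big_ord_recl !big_ord0 !addr0.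
apply; [by move=> _; split => //; exact: ltW|exact: tI|].
by rewrite (le_lt_trans (ler_norm _)).
Qed.

Lemma abs_continuous_total_variation (T : R) h e :
  abs_continuous 0 T h -> 0 < e -> exists2 d, 0 < d &
    forall s t, 0 <= s -> s <= t -> t <= T -> t - s < d ->
      (total_variation s t h <= e%:E)%E.
Proof.
move=> ah e0; have [d d0 dP] := ah e e0; exists d => // s t s0 st tT std.
apply: ge_ereal_sup => _ [_ [l pl <-] <-]; rewrite lee_fin /variation.
have [pc cN] := partition_points s0 tT pl; have [c01 cm] := pc.
set c := fun k => nth t (s :: l) k in pc cN c01 cm.
rewrite big_mkord; apply/ltW.
apply: (dP (size l) (fun i => c i) (fun i => c i.+1)).
- move=> i; split; [by have /andP[] := c01 i|exact: cm|by have /andP[] := c01 i.+1].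
- apply/trivIsetP => i j _ _; rewrite -val_eqE /= neq_ltn => /orP[ij|ji].
    apply/seteqP; split => // z [] /=; rewrite !in_itv/= => /andP[_ zi] /andP[jz _].
    by have := lt_le_trans (lt_trans jz zi) (cm _ _ ij); rewrite ltxx.
  apply/seteqP; split => // z [] /=; rewrite !in_itv/= => /andP[iz _] /andP[_ zj].
  by have := lt_le_trans (lt_trans iz zj) (cm _ _ ji); rewrite ltxx.
- rewrite -(big_mkord xpredT (fun i => c i.+1 - c i)) telescope_sumr//.
  by rewrite (_ : c (size l) = t).
Qed.

(** On intervals shorter than [d] the variation is at most 1, and finitely many steps of length
    [d / 2] cover the rest. *)
Lemma abs_continuous_bounded_variation (T : R) h : 0 < T ->
  abs_continuous 0 T h -> forall s t, 0 <= s -> s <= t -> t <= T ->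
  total_variation s t h \is a fin_num.
Proof.
move=> T0 ah s t s0 st tT.
have [d d0 dP] := abs_continuous_total_variation ah (@ltr01 R).
have [n nP] : exists n : nat, t - s < n%:R * (d / 2).
  exists (Num.bound ((t - s) / (d / 2))).
  rewrite -ltr_pdivrMr ?divr_gt0//; apply: archi_boundP.
  by rewrite divr_ge0 ?subr_ge0// divr_ge0// ltW.
elim: n s s0 st nP => [|n IH] s s0 st nP; first by move: nP; rewrite mul0r; lra.
have [tsd|tsd] := ltP (t - s) d.
  rewrite ge0_fin_numE ?total_variation_ge0//.
  by rewrite (le_lt_trans (dP s t s0 st tT tsd))// ltry.
have sd : s <= s + d / 2 by lra.
have dt : s + d / 2 <= t by lra.
rewrite (total_variationD _ sd dt) fin_numD; apply/andP; split.
  rewrite ge0_fin_numE ?total_variation_ge0//.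
  rewrite (le_lt_trans (dP _ _ s0 sd _ _))// ?ltry//; lra.
apply: IH => //; first lra.
by move: nP; rewrite -natr1 mulrDl mul1r; set z := n%:R * _; lra.
Qed.

Lemma total_variation_control (T : R) h : 0 < T -> abs_continuous 0 T h ->
  control T (fun s t => fine (total_variation s t h)).
Proof.
move=> T0 ah; have fin := abs_continuous_bounded_variation T0 ah.
split.
- by move=> s t s0 st tT; rewrite fine_ge0// total_variation_ge0.
- move=> s r t s0 sr rt tT; rewrite -fineD ?fin//; last 2 first.
  + exact: le_trans rt tT.
  + exact: le_trans s0 sr.
  by rewrite -total_variationD.
- move=> e e0; have e2 : 0 < e / 2 by rewrite divr_gt0.
  have [d d0 dP] := abs_continuous_total_variation ah e2.
  exists d => // s t s0 st tT std; apply: (@le_lt_trans _ _ (e / 2)); last lra.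
  by rewrite -lee_fin fineK ?fin// dP.
Qed.

(** The total variation of each coordinate is a control; their sum, scaled by a bound [k] for the
    basis vectors, controls the path. *)
Lemma abs_continuous_control (E : normedVectType R) (T : R) (x : R -> E) :
  0 < T -> abs_continuous 0 T x -> exists2 w, control T w &
    forall s t, 0 <= s -> s <= t -> t <= T -> `|x t - x s| <= w s t.
Proof.
move=> T0 ax; have [c c0 cb] := @ecoord_bounded R E.
have ac i : abs_continuous 0 T (ecoord i \o x).
  move=> e e0; have [d d0 dP] := ax _ (divr_gt0 e0 c0); exists d => // n l r lr tI sd.
  apply: (@le_lt_trans _ _ (c * \sum_(j < n) `|x (r j) - x (l j)|)).
    by rewrite mulr_sumr; apply: ler_sum => j _; rewrite /= -ecoordB.
  by rewrite mulrC -ltr_pdivlMr// dP.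
pose k : R := 1 + \sum_i `|ebasis i : E|.
have kb i : `|ebasis i : E| <= k.
  rewrite /k (bigD1 i)//= addrCA lerDl addr_ge0//.
  by rewrite sumr_ge0.
have k0 : 0 < k by rewrite /k ltr_pwDl// sumr_ge0.
exists (fun s t => k * \sum_i fine (total_variation s t (ecoord i \o x))).
  apply: control_scale => //; apply: control_sum_ord => i.
  exact: total_variation_control.
move=> s t s0 st tT; apply: le_trans (norm_le_ecoord _) _.
rewrite mulr_sumr; apply: ler_sum => i _; rewrite mulrC.
apply: ler_pM => //; rewrite ecoordB -lee_fin fineK; last first.
  exact: (abs_continuous_bounded_variation T0 (ac i)).
exact: (@total_variation_ge _ _ _ (ecoord i \o x)).
Qed.

End AbsoluteContinuity.

(** * Lebesgue integrals *)

Notation lmeas D h := (measurable_fun (D : set (lebT _)) (h : lebT _ -> _)).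
Notation lintegrable D h :=
  (leb.-integrable (D : set (lebT _)) (fun t : lebT _ => (h t)%:E)).

Section AlmostEverywhere.
Context d (S : measurableType d) (R : realType) (mu : {measure set S -> \bar R}).
Implicit Types (D : set S) (h k : S -> R).

Lemma ae_le_integrable D h k : measurable D -> measurable_fun D h ->
  {ae mu, forall t, D t -> `|h t| <= k t} -> mu.-integrable D (EFin \o k) ->
  mu.-integrable D (EFin \o h).
Proof.
move=> mD mh hk ik; apply/integrableP; split; first exact/measurable_EFinP.
have /integrableP[mk ifin] := ik.
apply: le_lt_trans ifin; apply: ae_ge0_le_integral => //.
- by apply/measurable_EFinP; apply: measurableT_comp.
- exact: (measurableT_comp _ mk).
- apply: filterS hk => t hkt Dt; rewrite lee_fin (le_trans (hkt Dt))//.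
  exact: ler_norm.
Qed.

Lemma ae_eq_Rintegral D h k : measurable D -> measurable_fun D h ->
  measurable_fun D k -> {ae mu, forall t, D t -> h t = k t} ->
  \int[mu]_(t in D) h t = \int[mu]_(t in D) k t.
Proof.
move=> mD mh mk hk; congr fine; apply: ae_eq_integral => //.
- exact/measurable_EFinP.
- exact/measurable_EFinP.
- by apply: filterS hk => t e /e ->.
Qed.

End AlmostEverywhere.

Section LebesgueMeasure.
Context {R : realType}.
Implicit Types (a b s t e : R) (h k : R -> R) (D : set R).

Lemma leb_measurable_itv (i : interval R) :
  measurable ([set` i] : set (lebT R)).
Proof. by apply: sub_caratheodory; exact: measurable_itv. Qed.
Hint Resolve leb_measurable_itv : core.

Lemma leb_measurable_fun D h :
  measurable_fun (D : set (measurableTypeR R)) (h : measurableTypeR R -> R) ->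
  measurable (D : set (measurableTypeR R)) -> lmeas D h.
Proof. by move=> mh mD _ Y mY; apply: sub_caratheodory; exact: mh. Qed.

Lemma leb_continuous a b h : {within `[a, b], continuous h} -> lmeas `[a, b] h.
Proof.
move=> ch; apply: leb_measurable_fun; last exact: measurable_itv.
by apply: subspace_continuous_measurable_fun => //; exact: measurable_itv.
Qed.

Lemma leb_negligible_measurable (A : set R) :
  leb.-negligible (A : set (lebT R)) -> measurable (A : set (lebT R)).
Proof. by move=> nA; exact: completed_lebesgue_measure_is_complete. Qed.

Lemma leb_aeS (P Q : R -> Prop) : {ae leb, forall t : lebT R, P t} ->
  (forall t, P t -> Q t) -> {ae leb, forall t : lebT R, Q t}.
Proof.
move=> [N [mN N0 PN]] PQ; exists N; split => // t nQ.
by apply: PN => /PQ.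
Qed.

Lemma leb_aeI (P Q : R -> Prop) : {ae leb, forall t : lebT R, P t} ->
  {ae leb, forall t : lebT R, Q t} -> {ae leb, forall t : lebT R, P t /\ Q t}.
Proof.
move=> [N [mN N0 PN]] [M [mM M0 QM]].
have [A [mA A0 NMA]] : leb.-negligible ((N : set (lebT R)) `|` M).
  by apply: negligibleU; [exists N; split|exists M; split].
exists A; split => // t /= nPQ; apply: NMA.
by case/not_andP: nPQ => [nP|nQ]; [left; exact: PN|right; exact: QM].
Qed.

Lemma leb_aeT (P : R -> Prop) : (forall t, P t) -> {ae leb, forall t : lebT R, P t}.
Proof. by move=> h; exists set0; split => // t; apply; exact: h. Qed.

(** Completeness of the measure: preimages under [h] and [k] differ only inside a null set, all of
    whose subsets are measurable. *)
Lemma leb_ae_measurable d (Y : measurableType d) D (h k : R -> Y) :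
  measurable (D : set (lebT R)) ->
  {ae leb, forall t : lebT R, D t -> h t = k t} ->
  measurable_fun (D : set (lebT R)) (h : lebT R -> Y) ->
  measurable_fun (D : set (lebT R)) (k : lebT R -> Y).
Proof.
move=> mD [N [mN N0 hkN]] mh _ B mB.
have hk t : D t -> ~ N t -> h t = k t.
  by move=> Dt nN; apply: contrapT => ne; apply: nN; apply: hkN => /(_ Dt).
have -> : D `&` k @^-1` B =
    ((D `&` h @^-1` B) `\` N) `|` ((D `&` k @^-1` B) `&` N).
  apply/seteqP; split=> [t [Dt Bt]|t [[[Dt Bt] nN]|[]//]].
    have [Nt|nN] := pselect (N t); [right|left] => //.
    by split => //; split => //=; rewrite hk.
  by split => //=; rewrite -hk.
apply: (@measurableU _ (lebT R)).
  by apply: (@measurableD _ (lebT R)) => //; exact: mh.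
apply: leb_negligible_measurable; exists N; split => //.
Qed.

Lemma leb_le_integrable D h k : measurable (D : set (lebT R)) -> lmeas D h ->
  {ae leb, forall t : lebT R, D t -> `|h t| <= k t} -> lintegrable D k ->
  lintegrable D h.
Proof. by move=> mD mh hk ik; exact: ae_le_integrable mD mh hk ik. Qed.

Lemma leb_le_Rintegral D h k : measurable (D : set (lebT R)) ->
  lintegrable D h -> lintegrable D k ->
  {ae leb, forall t : lebT R, D t -> h t <= k t} ->
  \int[leb]_(t in D) h t <= \int[leb]_(t in D) k t.
Proof.
move=> mD ih ik hk.
(* [h'] lies below [k] everywhere and agrees with [h] almost everywhere. *)
pose h' t := Num.min (h t) (k t).
have hh' : {ae leb, forall t : lebT R, D t -> h t = h' t}.
  by apply: (leb_aeS hk) => t hkt' /hkt' hkt; rewrite /h' min_l.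
have mh : lmeas D h by apply/measurable_EFinP; exact: measurable_int ih.
have mh' : lmeas D h' by exact: leb_ae_measurable mh.
have ih' : lintegrable D h'.
  apply: (leb_le_integrable (k := fun t => `|h t|)) => //.
    by apply: filterS hh' => t e /e <-.
  exact: integrable_norm ih.
have -> : \int[leb]_(t in D) h t = \int[leb]_(t in D) h' t.
  exact: ae_eq_Rintegral mD mh mh' hh'.
by apply: le_Rintegral => // t _; rewrite /h' ge_min lexx orbT.
Qed.

Lemma leb_eq_Rintegral D h k : measurable (D : set (lebT R)) ->
  lintegrable D h -> {ae leb, forall t : lebT R, D t -> h t = k t} ->
  lintegrable D k /\ \int[leb]_(t in D) h t = \int[leb]_(t in D) k t.
Proof.
move=> mD ih hk.
have mh : lmeas D h by apply/measurable_EFinP; exact: measurable_int ih.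
have mk : lmeas D k by exact: leb_ae_measurable mh.
have ik : lintegrable D k.
  apply: (leb_le_integrable (k := fun t => `|h t|)) => //.
    by apply: (leb_aeS hk) => t e /e <-.
  exact: integrable_norm ih.
split => //; apply/eqP; rewrite eq_le; apply/andP; split;
  by apply: leb_le_Rintegral => //; apply: (leb_aeS hk) => t e /e ->.
Qed.

Lemma leb_norm_Rintegral_le D h k : measurable (D : set (lebT R)) ->
  lintegrable D h -> lintegrable D k ->
  {ae leb, forall t : lebT R, D t -> `|h t| <= k t} ->
  `|\int[leb]_(t in D) h t| <= \int[leb]_(t in D) k t.
Proof.
move=> mD ih ik hk; rewrite (le_trans (le_normr_Rintegral mD ih))//.
by apply: leb_le_Rintegral => //; exact: integrable_norm ih.
Qed.

End LebesgueMeasure.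

Section GeneralMeasure.
Context d (S : measurableType d) (R : realType) (mu : {measure set S -> \bar R}).

Lemma sum_Rintegral_le n (F : 'I_n -> set S) (D : set S) (h : S -> R) :
  measurable D -> (forall i, measurable (F i)) -> trivIset setT F ->
  (forall i, F i `<=` D) -> mu.-integrable D (EFin \o h) ->
  (forall t, D t -> 0 <= h t) ->
  \sum_i \int[mu]_(t in F i) h t <= \int[mu]_(t in D) h t.
Proof.
move=> mD mF tF FD ih h0.
have iF i : mu.-integrable (F i) (EFin \o h) by exact: integrableS (FD i) ih.
have subU : \big[setU/set0]_(i <- index_enum 'I_n) F i `<=` D.
  by rewrite -bigcup_seq => z [i _]; exact: FD.
have mh := measurable_int _ ih.
rewrite -lee_fin -sumEFin /Rintegral fineK ?integrable_fin_num//.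
under eq_bigr do rewrite fineK ?integrable_fin_num//.
rewrite -ge0_integral_bigsetU//.
- apply: ge0_subset_integral => //.
  by apply: bigsetU_measurable.
- exact: index_enum_uniq.
- exact: sub_trivIset tF.
- exact: (measurable_funS mD subU mh).
- by move=> z /subU/h0; rewrite lee_fin.
Qed.

Lemma null_Rintegral (D : set S) (h : S -> R) : measurable D ->
  measurable_fun D h -> mu D = 0%E -> \int[mu]_(t in D) h t = 0.
Proof.
move=> mD mh D0; rewrite /Rintegral null_set_integral//.
exact/measurable_EFinP.
Qed.

End GeneralMeasure.

(** * Primitives of integrable functions *)

Section Primitives.
Context {R : realType}.
Implicit Types (a b s t e T : R) (h k w : R -> R) (D : set R).

Hint Resolve leb_measurable_itv : core.

Lemma lintegrable_measurable D h : lintegrable D h -> lmeas D h.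
Proof. by move=> ih; apply/measurable_EFinP; exact: measurable_int ih. Qed.

Lemma lintegrableS (i j : interval R) h : [set` j] `<=` [set` i] ->
  lintegrable [set` i] h -> lintegrable [set` j] h.
Proof. by move=> ji; apply: integrableS. Qed.

Lemma lintegrableD D h k : measurable (D : set (lebT R)) -> lintegrable D h ->
  lintegrable D k -> lintegrable D (fun t => h t + k t).
Proof. by move=> mD ih ik; exact: integrableD ih ik. Qed.

Lemma lintegrableB D h k : measurable (D : set (lebT R)) -> lintegrable D h ->
  lintegrable D k -> lintegrable D (fun t => h t - k t).
Proof. by move=> mD ih ik; exact: integrableB ih ik. Qed.

Lemma lintegrableZ D c h : measurable (D : set (lebT R)) -> lintegrable D h ->
  lintegrable D (fun t => c * h t).
Proof. by move=> mD ih; exact: integrableZl ih. Qed.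

Lemma leb_itv_lty a b : (leb (`[a, b] : set (lebT R)) < +oo)%E.
Proof.
by rewrite [X in (X < _)%E](lebesgue_measure_itv `[a, b]); case: ifP => _; rewrite ?ltry// -EFinB ltry.
Qed.

Lemma leb_bounded_integrable a b h (M : R) : lmeas `[a, b] h ->
  (forall t, `[a, b]%classic t -> `|h t| <= M) -> lintegrable `[a, b] h.
Proof.
move=> mh hM; apply: measurable_bounded_integrable => //.
  exact: leb_itv_lty.
by exists M; split; [exact: num_real|move=> N MN t ab; exact: le_trans (hM t ab) (ltW MN)].
Qed.

Lemma primitive_split (w : R -> R) T s t : lintegrable `[0, T] w ->
  0 <= s -> s <= t -> t <= T ->
  \int[leb]_(r in `[0, t]) w r - \int[leb]_(r in `[0, s]) w r =
  \int[leb]_(r in `]s, t]) w r.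
Proof.
move=> iw s0 st tT.
have -> : `[0, t]%classic = `[0, s]%classic `|` `]s, t]%classic :> set R.
  by rewrite -itv_bndbnd_setU// bnd_simp.
rewrite (@Rintegral_setU _ _ _ leb `[0, s]%classic `]s, t]%classic)//.
- move: (\int[leb]_(r in `[0, s]) w r) (\int[leb]_(r in `]s, t]) w r) => I1 I2.
  by rewrite addrC addKr.
- rewrite -itv_bndbnd_setU ?bnd_simp//; apply: lintegrableS iw => z /=.
  by rewrite !in_itv/= => /andP[-> zt]/=; exact: le_trans tT.
- apply/disj_setPS => z [] /=; rewrite !in_itv/= => /andP[_ zs] /andP[sz _].
  by have := le_lt_trans zs sz; rewrite ltxx.
Qed.

Lemma primitive_rest (w : R -> R) T t : lintegrable `[0, T] w ->
  0 <= t -> t <= T ->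
  \int[leb]_(r in `[t, T]) w r =
  \int[leb]_(r in `[0, T]) w r - \int[leb]_(r in `[0, t]) w r.
Proof.
move=> iw t0 tT; rewrite (primitive_split iw)//.
have -> : `[t, T]%classic = `[t, t]%classic `|` `]t, T]%classic :> set R.
  by rewrite -itv_bndbnd_setU// bnd_simp.
rewrite Rintegral_setU//; last 2 first.
- rewrite -itv_bndbnd_setU ?bnd_simp//; apply: lintegrableS iw => z /=.
  by rewrite !in_itv/= => /andP[tz ->]; rewrite (le_trans t0 tz).
- apply/disj_setPS => z [] /=; rewrite !in_itv/= => /andP[_ zs] /andP[sz _].
  by have := le_lt_trans zs sz; rewrite ltxx.
have -> : \int[leb]_(r in `[t, t]) w r = 0; last by rewrite add0r.
apply: null_Rintegral => //.
  apply: (measurable_funS _ _ (lintegrable_measurable iw)) => // z /=.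
  by rewrite !in_itv/= => /andP[tz zt]; rewrite (le_trans t0 tz) (le_trans zt tT).
by rewrite [LHS](lebesgue_measure_itv `[t, t]) /= ltxx.
Qed.

Lemma primitive_increment (w a : R -> R) T s t : lintegrable `[0, T] w ->
  lintegrable `[0, T] a ->
  {ae leb, forall r : lebT R, `[0, T]%classic r -> `|w r| <= a r} ->
  0 <= s -> s <= t -> t <= T ->
  `|\int[leb]_(r in `[0, t]) w r - \int[leb]_(r in `[0, s]) w r| <=
  \int[leb]_(r in `[0, t]) a r - \int[leb]_(r in `[0, s]) a r.
Proof.
move=> iw ia wa s0 st tT; rewrite (primitive_split iw)// (primitive_split ia)//.
have sub : `]s, t]%classic `<=` `[0, T]%classic.
  move=> z /=; rewrite !in_itv/= => /andP[sz zt].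
  by rewrite (le_trans s0 (ltW sz)) (le_trans zt tT).
apply: leb_norm_Rintegral_le => //.
- exact: lintegrableS iw.
- exact: lintegrableS ia.
- by apply: (leb_aeS wa) => z h /sub.
Qed.

(** The truncation error vanishes at [t] once [N] exceeds [|w t|], and it is dominated by [|w|]. *)
Lemma lintegrable_tail (w : R -> R) T e : lintegrable `[0, T] w -> 0 < e ->
  exists N : nat, lintegrable `[0, T] (fun t => `|w t| - Num.min `|w t| N%:R) /\
   \int[leb]_(t in `[0, T]) (`|w t| - Num.min `|w t| N%:R) < e.
Proof.
move=> iw e0.
have mw := lintegrable_measurable iw.
have mnw : lmeas `[0, T] (fun t => `|w t|) by exact: measurableT_comp.
have mf (n : nat) : lmeas `[0, T] (fun t => `|w t| - Num.min `|w t| n%:R).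
  apply: measurable_funB; first exact: mnw.
  apply: measurable_minr; first exact: mnw.
  exact: measurable_cst.
have b0 (n : nat) t : 0 <= `|w t| - Num.min `|w t| n%:R <= `|w t|.
  rewrite subr_ge0 ge_min lexx/= lerBlDr lerDl le_min normr_ge0/=.
  exact: ler0n.
have ifn (n : nat) : lintegrable `[0, T] (fun t => `|w t| - Num.min `|w t| n%:R).
  apply: (leb_le_integrable (k := fun t => `|w t|)) => //; last exact: integrable_norm iw.
  apply: leb_aeT => t _; have /andP[h1 h2] := b0 n t.
  by rewrite ger0_norm.
have := @dominated_convergence _ _ _ leb (`[0, T] : set (lebT R))
  (leb_measurable_itv _) (fun n t => (`|w t| - Num.min `|w t| n%:R)%:E) (cst 0%E)
  (fun t => `|w t|%:E).
case.
- by move=> n; apply/measurable_EFinP.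
- exact: measurable_cst.
- apply: leb_aeT => t _; apply: cvg_near_cst; near=> n.
  rewrite min_l ?subrr//; near: n.
  exists (Num.bound `|w t|) => // n /= ln.
  rewrite (le_trans (ltW (archi_boundP (normr_ge0 (w t)))))// ler_nat//.
- exact: integrable_norm iw.
- apply: leb_aeT => t n _; have /andP[h1 h2] := b0 n t.
  by rewrite /= ger0_norm// lee_fin.
move=> _ _; rewrite integral_cst// mul0e => /fine_cvgP[_].
move=> /cvgrPdist_lt/(_ _ e0)[N _ /(_ N (leqnn N))] /=.
rewrite sub0r normrN => h; exists N; split => //.
exact: le_lt_trans (ler_norm _) h.
Unshelve. all: by end_near. Qed.

(** The truncated part of [|w|] contributes at most [N] times the total length, and the tail at most
    its full integral, below [e / 2], however many disjoint intervals there are. *)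
Lemma primitive_abs_continuous (w : R -> R) T : lintegrable `[0, T] w ->
  abs_continuous 0 T (fun t => \int[leb]_(r in `[0, t]) w r).
Proof.
move=> iw e e0; have e2 : 0 < e / 2 by rewrite divr_gt0.
have [N [iN Ne]] := lintegrable_tail iw e2.
have N1 : 0 < N%:R + 1 :> R by rewrite ltr_wpDl.
exists (e / 2 / (N%:R + 1)); first by rewrite divr_gt0.
move=> n l r lr tI sd.
set b := (fun t => `|w t| - Num.min `|w t| N%:R) in iN Ne.
have sub i : `]l i, r i]%classic `<=` `[0, T]%classic.
  move=> z /=; rewrite !in_itv/= => /andP[sz zt]; have [l0 _ rT] := lr i.
  by rewrite (le_trans l0 (ltW sz)) (le_trans zt rT).
have subo i : `]l i, r i[%classic `<=` `[0, T]%classic.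
  by move=> z zi; apply: (sub i); move: zi; rewrite /= !in_itv/= => /andP[-> /ltW].
(* Disjointness is given for the open intervals, while increments of the primitive are integrals
   over []l i, r i]]; the right end point is a null set. *)
have ioo i : \int[leb]_(t in `]l i, r i]) b t = \int[leb]_(t in `]l i, r i[) b t.
  have [_ + _] := lr i; rewrite le_eqVlt => /predU1P[->|lri].
    by rewrite (_ : `]r i, r i]%classic = `]r i, r i[%classic)// !set_itvoc0 set_itvoo0.
  have -> : `]l i, r i]%classic = `]l i, r i[%classic `|` `[r i, r i]%classic :> set R.
    by rewrite -itv_bndbnd_setU// bnd_simp.
  rewrite Rintegral_setU//; last 2 first.
  - by rewrite -itv_bndbnd_setU ?bnd_simp//; apply: lintegrableS iN; exact: sub.
  - apply/disj_setPS => z [] /=; rewrite !in_itv/= => /andP[_ zs] /andP[sz _].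
    by have := le_lt_trans sz zs; rewrite ltxx.
  have -> : \int[leb]_(t in `[r i, r i]) b t = 0; last by rewrite addr0.
  apply: null_Rintegral => //.
    apply: (measurable_funS _ _ (lintegrable_measurable iN)) => // z zi; apply: (sub i).
    by move: zi; rewrite /= !in_itv/= => /andP[rz zr]; rewrite (lt_le_trans lri rz).
  by rewrite [LHS](lebesgue_measure_itv `[r i, r i]) /= ltxx.
have b0 t : 0 <= b t by rewrite subr_ge0 ge_min lexx.
have bE : \sum_i \int[leb]_(t in `]l i, r i]) b t <= \int[leb]_(t in `[0, T]) b t.
  under eq_bigr do rewrite ioo.
  by apply: sum_Rintegral_le => // i; exact: subo.
apply: (@le_lt_trans _ _ (\sum_i (N%:R * (r i - l i) + \int[leb]_(t in `]l i, r i]) b t))).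
  apply: ler_sum => i _; have [l0 lri rT] := lr i.
  rewrite (primitive_split iw)//.
  have iw' : lintegrable `]l i, r i] w by exact: lintegrableS iw.
  have ib : lintegrable `]l i, r i] b by exact: lintegrableS iN.
  rewrite (le_trans (le_normr_Rintegral _ iw'))//.
  have inw := integrable_norm iw'.
  rewrite -lerBlDr -RintegralB//.
  have mlr : (leb (`]l i, r i]%classic : set (lebT R)) = (r i - l i)%:E)%E.
    rewrite [LHS](lebesgue_measure_itv `]l i, r i]) /=; case: ltP => //.
    rewrite lee_fin => rl; rewrite (_ : r i = l i) ?subrr//.
    by apply/eqP; rewrite eq_le rl.
  apply: (@le_trans _ _ (\int[leb]_(t in `]l i, r i]) cst (N%:R : R) t)).
    apply: leb_le_Rintegral => //.
    - exact: lintegrableB.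
    - apply: (lintegrableS (sub i)).
      by apply: (leb_bounded_integrable (M := N%:R)) => // t _; rewrite ger0_norm.
    - apply: leb_aeT => t _; rewrite /b opprB addrC subrK.
      by rewrite ge_min lexx orbT.
  by rewrite Rintegral_cst// [X in fine X]mlr.
rewrite big_split/= -mulr_sumr (splitr e); apply: ltr_leD; last first.
  exact: le_trans bE (ltW Ne).
apply: (@le_lt_trans _ _ ((N%:R + 1) * \sum_i (r i - l i))).
  rewrite ler_wpM2r ?lerDl// sumr_ge0// => i _; have [_ lri _] := lr i.
  by rewrite subr_ge0.
by rewrite mulrC -ltr_pdivlMr.
Qed.

End Primitives.

(** * Lebesgue differentiation for the completed measure *)

Section LebesgueDifferentiation.
Context {R : realType}.
Implicit Types (a b s t e T : R) (h k w : R -> R) (D : set R).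

Hint Resolve leb_measurable_itv : core.

(** The differentiation theorem is applied to this Borel version of [k]. A superlevel set at a
    rational level is a Borel set up to a subset of a Borel null set; off the union [N] of these
    countably many null sets, the rational levels determine [k]. *)
Lemma lebesgue_borel_ae (k : R -> R) : lmeas setT k ->
  exists N : set (measurableTypeR R), [/\ measurable N, lebesgue_measure N = 0%E &
    measurable_fun (setT : set (measurableTypeR R))
      ((k : measurableTypeR R -> R) \_ (~` N))].
Proof.
move=> mk.
pose P (q : rat) (BM : set (measurableTypeR R) * set (measurableTypeR R)) :=
  [/\ measurable BM.1, measurable BM.2, lebesgue_measure BM.2 = 0%E &
    forall t, ~ BM.2 t -> ratr q < k t <-> BM.1 t].
have ex q : exists BM, P q BM.
  have mA : measurable ([set t | ratr q < k t] : set (lebT R)).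
    have := mk measurableT `]ratr q, +oo[%classic (measurable_itv _).
    rewrite setTI; congr measurable; apply/seteqP.
    by split=> t /=; rewrite in_itv/= andbT.
  move: mA; rewrite -[X in X _ -> _](@completed_caratheodory_measurable R).
  rewrite g_sigma_completed_algebra_genE => -[B mB [N [M [mM M0 NM]]] BN].
  exists (B, M); split => //= t nM; split => [h|Bt].
    have : (B `|` N) t by rewrite BN.
    by case=> // /NM.
  by have : (B `|` N) t; [left|rewrite BN].
have [BM BMP] := choice ex.
pose N := \bigcup_n (if unpickle n is Some q then (BM q).2 else set0).
have mN : measurable N.
  apply: bigcupT_measurable => n; case: unpickle => [q|//].
  by have [] := BMP q.
have N0 : lebesgue_measure N = 0%E.
  have : lebesgue_measure.-negligible N.
    apply: negligible_bigcup => n; case: unpickle => [q|]; last exact: negligible_set0.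
    by have [_ mM M0 _] := BMP q; exists (BM q).2; split.
  by move=> [M [mM M0 NM]]; apply: (subset_measure0 mN mM NM).
exists N; split => //.
apply/measurable_restrict => //; first exact: measurableC.
rewrite setTI => mCN; apply: (measurability _ (RGenOInfty.measurableE R)) => //.
move=> _ [_ [y ->] <-].
rewrite (_ : _ `&` _ = \bigcup_q (if y <= ratr q then ~` N `&` (BM q).1 else set0)).
  apply: bigcupT_measurable_rat => q; case: ifP => // _.
  by apply: measurableI => //; have [] := BMP q.
have nN t q : ~ N t -> ~ (BM q).2 t.
  move=> nNt Mt; apply: nNt; move: (pickleK q); move: (pickle q) => n qn.
  by exists n => //; rewrite qn.
apply/seteqP; split => [t [nNt]|t [q _]].
  rewrite /= in_itv/= andbT => ykt.
  have [q] : exists q : rat, ratr q \in `]y, k t[ by exact: rat_in_itvoo.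
  rewrite in_itv/= => /andP[yq qk]; exists q => //; rewrite (ltW yq).
  by split => //; have [_ _ _ /(_ t (nN t q nNt))[+ _]] := BMP q; apply.
case: ifP => // yq [nNt Bt]; split => //; rewrite /= in_itv/= andbT.
apply: le_lt_trans yq _.
by have [_ _ _ /(_ t (nN t q nNt))[_ +]] := BMP q; apply.
Qed.

(** On Borel sets, the completed measure pushed forward along the identity is the Lebesgue measure,
    so integrals transfer by change of variables. *)
Lemma leb_lebesgue_Rintegral (D : set (measurableTypeR R)) (k : R -> R) :
  measurable D -> measurable_fun (setT : set (measurableTypeR R)) k ->
  lintegrable D k ->
  lebesgue_measure.-integrable D (EFin \o k) /\
  \int[lebesgue_measure]_(t in D) k t = \int[leb]_(t in D) k t.
Proof.
move=> mD mk ik.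
pose id' : lebT R -> measurableTypeR R := id.
have mid : measurable_fun setT id'.
  by move=> _ B mB; rewrite setTI; apply: sub_caratheodory.
have eqm (h : measurableTypeR R -> \bar R) :
    (\int[lebesgue_measure]_(t in D) h t = \int[pushforward leb id']_(t in D) h t)%E.
  exact: eq_measure_integral.
have mEk : measurable_fun (setT : set (measurableTypeR R)) (EFin \o k).
  exact/measurable_EFinP.
have ifin : lebesgue_measure.-integrable D (EFin \o k).
  apply/integrableP; split; first exact: measurable_funTS.
  rewrite eqm ge0_integral_pushforward//.
  - by have /integrableP[] := ik.
  - by apply: measurable_funTS; exact: measurableT_comp.
split => //; rewrite /Rintegral eqm integral_pushforward//.
Qed.

(** Restricting [w] to [[0, T]] makes it integrable on the whole line, the setting of the
    differentiation theorem, and keeps the primitive on [[0, T]]. *)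
Lemma leb_FTC (T : R) (w : R -> R) : lintegrable `[0, T] w ->
  {ae leb, forall t : lebT R, 0 < t -> t < T ->
    is_derive (t : R) (1 : R) (fun s => \int[leb]_(r in `[0, s]) (w \_ `[0, T]) r) (w t)}.
Proof.
move=> iw; set k := w \_ `[0, T].
have ik : lintegrable setT k.
  by have := iw; rewrite (integrable_mkcond _ (leb_measurable_itv `[0, T])) restrict_EFin.
have [N [mN N0 mk0]] := lebesgue_borel_ae (lintegrable_measurable ik).
set k0 := (k : measurableTypeR R -> R) \_ (~` N) in mk0.
have kk0 : {ae leb, forall t : lebT R, k t = k0 t}.
  exists (N : set (lebT R)); split => //; first exact: sub_caratheodory.
  move=> t /= kt; apply: contrapT => nN; apply: kt.
  by rewrite /k0 patchE mem_set.
have ik0 : lintegrable setT k0.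
  apply: (leb_eq_Rintegral _ ik _).1 => //.
  by apply: (leb_aeS kk0) => t.
have mS D : measurable (D : set (measurableTypeR R)) -> measurable (D : set (lebT R)).
  by move=> mD; exact: sub_caratheodory.
have ik0S D : measurable (D : set (measurableTypeR R)) -> lintegrable D k0.
  by move=> mD; apply: (integrableS _ _ _ ik0) => //; exact: mS.
have Ik0 D : measurable (D : set (measurableTypeR R)) ->
    lebesgue_measure.-integrable (D : set (measurableTypeR R)) (EFin \o k0).
  by move=> mD; exact: (leb_lebesgue_Rintegral mD mk0 (ik0S D mD)).1.
have loc : locally_integrable [set: R] k0.
  split => //; first exact: openT.
  move=> K _ cK; have mK := compact_measurable cK.
  by have /integrableP[] := Ik0 K mK.
have := @FTC1 R k0 (BLeft 0) (fun y => Ik0 _ (measurable_itv _)) loc.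
have FE : (fun s => \int[leb]_(r in `[0, s]) k r) =
    (fun x => \int[lebesgue_measure]_(t in `[0, x]) k0 t).
  apply/funext => s.
  rewrite (leb_lebesgue_Rintegral (measurable_itv `[0, s]) mk0 (ik0S _ (measurable_itv _))).2.
  apply: (leb_eq_Rintegral _ _ _).2 => //.
    by apply: (integrableS _ _ _ ik).
  by apply: (leb_aeS kk0) => t.
move=> [M [mM M0 FM]].
have aeF : {ae leb, forall t : lebT R, 0 < t ->
    derivable (fun s => \int[leb]_(r in `[0, s]) k r) t 1 /\
    derive1 (fun s => \int[leb]_(r in `[0, s]) k r) t = k0 t}.
  exists (M : set (lebT R)); split => //; first exact: mS.
  move=> t nt; apply: FM => /= h; apply: nt => t0; rewrite FE; apply: h.
  by rewrite lte_fin.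
apply: (leb_aeS (leb_aeI aeF kk0)) => t [h kt] t0 tT.
have [d1 d2] := h t0; apply: DeriveDef => //.
rewrite -derive1E d2 -kt /k patchE mem_set//=.
by rewrite in_itv/= (ltW t0) (ltW tT).
Qed.

End LebesgueDifferentiation.

(** * Measurability along a control *)

Section Measurability.
Context {R : realType} {E : normedVectType R}.
Implicit Types (T : R) (U : set E) (u v w : R -> E) (F : R -> E -> R).

Hint Resolve leb_measurable_itv : core.

Notation borelE := (g_sigma_algebraType (@open E)).

Lemma measurable_open (A : set E) : open A -> measurable (A : set borelE).
Proof. by move=> oA; apply: sub_sigma_algebra. Qed.

Lemma open_ball_norm (x : E) (e : R) : open [set z : E | `|z - x| < e].
Proof.
rewrite (_ : [set z | _] = (fun z : E => `|z - x|) @^-1` [set r | r < e])//.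
apply: open_comp; last exact: open_lt.
move=> z _; apply: (@continuous_comp _ _ _ (fun z : E => z - x)).
  by move=> ?; apply: cvgB; [exact: cvg_id|exact: cvg_cst].
exact: norm_continuous.
Qed.

(** [u] is approximated by sending [t] to the first point [v k] of a dense sequence within 1/(m+1)
    of [u t]. For fixed [k], [F t (v k)] is continuous in [t], so the approximations are measurable
    on each of countably many pieces. The points [v k] are taken in [U], since [F] is continuous
    only there. *)
Lemma caratheodory_measurable_in T U F u :
  {within [set p : R * E | p.1 \in `[0, T] /\ U p.2],
    continuous (fun p => F p.1 p.2)} ->
  lmeasurable 0 T u -> (forall t, `[0, T]%classic t -> U (u t)) ->
  lmeas `[0, T] (fun t => F t (u t)).
Proof.
move=> cF mu Uu.
have [->|/set0P[t0 t0T]] := eqVneq `[0, T]%classic set0; first exact: measurable_fun_set0.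
have [v Uv vd] := dense_sequence (ex_intro _ _ (Uu _ t0T)).
pose B m k := [set z : E | `|z - v k| < m.+1%:R^-1].
pose C m k := B m k `\` \bigcup_(j in [set j | (j < k)%N]) B m j.
have mB m k : measurable (B m k : set borelE).
  by apply: measurable_open; exact: open_ball_norm.
have mC m k : measurable (C m k : set borelE).
  apply: measurableD => //; apply: bigcup_measurable => j _; exact: mB.
have ex m t : exists k, `[0, T]%classic t -> C m k (u t).
  have [tT|nt] := pselect (`[0, T]%classic t); last by exists 0%N.
  have m0 : 0 < m.+1%:R^-1 :> R by rewrite invr_gt0 ltr0n.
  have exk : exists k, `|u t - v k| < m.+1%:R^-1 by exact: vd (Uu _ tT) m0.
  case: (ex_minnP exk) => k uk kmin; exists k => _; split => //.
  by move=> [j /= jk Bj]; have := kmin j Bj; rewrite leqNgt jk.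
have [kap kapP] := choice (fun mt : nat * R => ex mt.1 mt.2).
pose h m t := F t (v (kap (m, t))).
have mh m : lmeas `[0, T] (h m).
  have DE : `[0, T]%classic = \bigcup_k (`[0, T]%classic `&` u @^-1` (C m k)).
    apply/seteqP; split=> [t tT|t [k _ []]//].
    by exists (kap (m, t)) => //; split => //; exact: (kapP (m, t)).
  have mP k : measurable ((`[0, T]%classic `&` u @^-1` (C m k)) : set (lebT R)).
    exact: mu.
  rewrite DE; apply/measurable_fun_bigcup => // k.
  apply: (eq_measurable_fun (fun t : lebT R => F t (v k))).
    move=> t; rewrite inE => -[tT Ct].
    rewrite /h; congr (F _ (v _)).
    have Ck := kapP (m, t) tT.
    (* Membership in the cell [C m k] determines [k], because each cell excludes the balls of
       smaller index. *)
    have [kl|lk|//] := ltngtP k (kap (m, t)).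
      by case: Ck => _; apply: contra_notP => _; exists k => //; case: Ct.
    by case: Ct => _; apply: contra_notP => _; exists (kap (m, t)) => //; case: Ck.
  have mFk : lmeas `[0, T] (fun t => F t (v k)).
    apply: leb_continuous.
    refine (@within_comp _ _ _ `[0, T]%classic
      [set p : R * E | p.1 \in `[0, T] /\ U p.2] (fun p => F p.1 p.2)
      (fun t => (t, v k)) _ _ cF).
      apply: continuous_subspaceT => t.
      exact: (cvg_pair cvg_id (cvg_cst _)).
    by move=> t /= tT; split.
  by apply: (measurable_funS _ _ mFk) => // ? [].
apply: (measurable_fun_cvg mh) => t tT.
apply/cvgrPdist_lt => e e0.
have tuD : [set p : R * E | p.1 \in `[0, T] /\ U p.2] (t, u t).
  by split; [exact: tT|exact: Uu].
have [d d0 dP] := (within_continuous_dist _ _).1 cF _ _ tuD e0.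
near=> m; apply: (dP (t, v (kap (m, t)))).
  by split; [exact: tT|exact: Uv].
have [kd _] := kapP (m, t) tT.
rewrite prod_normE /= subrr normr0 gt_max d0 /= (lt_trans kd)//.
near: m; exact: near_infty_natSinv_lt (PosNum d0).
Unshelve. all: by end_near. Qed.

Lemma caratheodory_measurable_ae T U F u :
  {within [set p : R * E | p.1 \in `[0, T] /\ U p.2],
    continuous (fun p => F p.1 p.2)} ->
  lmeasurable 0 T u ->
  {ae leb, forall t : lebT R, `[0, T]%classic t -> U (u t)} ->
  lmeas `[0, T] (fun t => F t (u t)).
Proof.
move=> cF mu Uu.
have [[u0 Uu0]|nU] := pselect (U !=set0); last first.
  (* If [U] is empty, almost no point lies in [[0, T]], so every function agrees with 0 there almost
     everywhere. *)
  have m0 : lmeas `[0, T] (fun _ : R => 0 : R) by exact: measurable_cst.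
  apply: (leb_ae_measurable (leb_measurable_itv _) _ m0).
  apply: (leb_aeS Uu) => t h /h Uut; exfalso.
  by apply: nU; exists (u t).
pose u' t := if pselect (U (u t)) then u t else u0.
have Uu' t : U (u' t) by rewrite /u'; case: pselect.
have uu' : {ae leb, forall t : lebT R, `[0, T]%classic t -> u t = u' t}.
  by apply: (leb_aeS Uu) => t h /h Uut; rewrite /u'; case: pselect.
have mu' : lmeasurable 0 T u'.
  exact: (leb_ae_measurable (Y := borelE) _ uu').
have mF := caratheodory_measurable_in cF mu' (fun t _ => Uu' t).
apply: (leb_ae_measurable (leb_measurable_itv _) _ mF).
by apply: (leb_aeS uu') => t h /h ->.
Qed.

End Measurability.

(** * Vector-valued integrals *)

Lemma eq_lintegrable (R : realType) (D : set R) (h k : R -> R) : h =1 k ->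
  lintegrable D h -> lintegrable D k.
Proof. by move=> /funext ->. Qed.

Lemma leb_Rintegral_ge0 (R : realType) (D : set R) (a : R -> R) :
  measurable (D : set (lebT R)) -> lintegrable D a ->
  {ae leb, forall t : lebT R, D t -> 0 <= a t} ->
  0 <= \int[leb]_(t in D) a t.
Proof.
move=> mD ia a0.
have -> : \int[leb]_(t in D) a t = \int[leb]_(t in D) `|a t|.
  apply: (leb_eq_Rintegral mD ia _).2.
  by apply: (leb_aeS a0) => t h /h at0; rewrite ger0_norm.
by apply: Rintegral_ge0.
Qed.

Lemma is_derive_cvgP (R : realType) (V W : normedModType R) (h : V -> W)
    (x v : V) (l : W) : is_derive x v h l <->
  (t^-1 *: ((h \o shift x) (t *: v) - h x) @[t --> 0^'] --> l).
Proof.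
split=> [[dh <-]|hl]; first exact: dh.
by apply: DeriveDef; [apply: cvgP hl|exact: cvg_lim hl].
Qed.

Section VectorIntegral.
Context {R : realType} {E : normedVectType R}.
Implicit Types (T s t : R) (D : set R) (w : R -> E) (a : R -> R).

Hint Resolve leb_measurable_itv : core.

(** Integration by coordinates in the chosen basis; that it commutes with every linear functional is
    [vintegrable_linear]. *)
Definition vint D w : E :=
  \sum_i (\int[leb]_(t in D) ecoord i (w t)) *: ebasis i.

Definition vmeas D w := forall i, lmeas D (fun t => ecoord i (w t)).

Definition vintegrable D w := forall i, lintegrable D (fun t => ecoord i (w t)).

Lemma ecoord_sumE (b : 'I_(\dim {:E}) -> R) i :
  ecoord i (\sum_j b j *: ebasis j) = b i.
Proof.
have -> : \sum_j b j *: ebasis j = ecomb (\row_j b j).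
  by apply: eq_bigr => j _; rewrite mxE.
by rewrite ecombK mxE.
Qed.

Lemma ecoord_vint i D w :
  ecoord i (vint D w) = \int[leb]_(t in D) ecoord i (w t).
Proof. exact: ecoord_sumE. Qed.

Lemma linear_ecoord (A : {linear E -> R^o}) z :
  A z = \sum_i ecoord i z * A (ebasis i).
Proof.
rewrite {1}[z]ecoord_sum linear_sum; apply: eq_bigr => i _.
by rewrite linearZ.
Qed.

Lemma vintegrable_linear (A : {linear E -> R^o}) D w :
  measurable (D : set (lebT R)) -> vintegrable D w ->
  lintegrable D (fun t => A (w t)) /\ \int[leb]_(t in D) A (w t) = A (vint D w).
Proof.
move=> mD iw.
suff h (l : seq 'I_(\dim {:E})) :
    lintegrable D (fun t => \sum_(i <- l) ecoord i (w t) * A (ebasis i)) /\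
    \int[leb]_(t in D) (\sum_(i <- l) ecoord i (w t) * A (ebasis i)) =
    \sum_(i <- l) (\int[leb]_(t in D) ecoord i (w t)) * A (ebasis i).
  have [h1 h2] := h (index_enum _).
  split; first by apply: eq_lintegrable h1 => t; rewrite -linear_ecoord.
  under eq_Rintegral do rewrite linear_ecoord.
  rewrite h2 linear_ecoord; apply: eq_bigr => i _.
  by rewrite ecoord_vint.
elim: l => [|i l [IH1 IH2]].
  split.
    apply: (@eq_lintegrable _ _ (fun _ => 0)); last exact: integrable0.
    by move=> t; rewrite big_nil.
  under eq_Rintegral do rewrite big_nil.
  by rewrite big_nil Rintegral_cst// mul0r.
have e t : \sum_(j <- i :: l) ecoord j (w t) * A (ebasis j) =
    A (ebasis i) * ecoord i (w t) + \sum_(j <- l) ecoord j (w t) * A (ebasis j).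
  by rewrite big_cons mulrC.
have i1 : lintegrable D (fun t => A (ebasis i) * ecoord i (w t)).
  exact: lintegrableZ.
split; first by apply: (eq_lintegrable (fun t => esym (e t))); exact: lintegrableD.
under eq_Rintegral do rewrite e.
rewrite RintegralD// IH2 big_cons RintegralZl//; last exact: iw.
by rewrite mulrC.
Qed.

Lemma ecoord_bound : exists2 K : R, 0 < K &
  (forall i (x : E), `|ecoord i x| <= K * `|x|) /\
  (forall (x : E) b, 0 <= b -> (forall i, `|ecoord i x| <= b) -> `|x| <= K * b).
Proof.
have [c c0 cb] := @ecoord_bounded R E.
pose S := \sum_i `|ebasis i : E|.
have S0 : 0 <= S by exact: sumr_ge0.
exists (c + S); first by rewrite ltr_pwDl.
split=> [i x|x b b0 xb].
  by apply: (le_trans (cb i x)); rewrite ler_wpM2r// lerDl.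
apply: (le_trans (norm_le_ecoord x)).
apply: (@le_trans _ _ (\sum_i b * `|ebasis i : E|)).
  by apply: ler_sum => i _; rewrite ler_wpM2r.
by rewrite -mulr_sumr mulrC ler_wpM2r// lerDr ltW.
Qed.

(** Through coordinates the triangle inequality holds up to a constant of the basis: one factor [K]
    from the norm to the coordinates and one for the way back. *)
Lemma vint_bound : exists2 K : R, 0 < K &
  (forall D w a, measurable (D : set (lebT R)) -> vintegrable D w ->
    lintegrable D a ->
    {ae leb, forall t : lebT R, D t -> `|w t| <= a t} ->
    `|vint D w| <= K * \int[leb]_(t in D) a t) /\
  (forall T w a s t, vintegrable `[0, T] w -> lintegrable `[0, T] a ->
    {ae leb, forall t : lebT R, `[0, T]%classic t -> `|w t| <= a t} ->
    0 <= s -> s <= t -> t <= T ->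
    `|vint `[0, t] w - vint `[0, s] w| <=
     K * (\int[leb]_(t in `[0, t]) a t - \int[leb]_(t in `[0, s]) a t)).
Proof.
have [K K0 [K1 K2]] := ecoord_bound.
have aK D a w i : {ae leb, forall t : lebT R, D t -> `|w t| <= a t} ->
    {ae leb, forall t : lebT R, D t -> `|ecoord i (w t)| <= K * a t}.
  move=> wa; apply: (leb_aeS wa) => t h /h wat.
  by rewrite (le_trans (K1 _ _))// ler_pM2l.
exists (K * K); first by rewrite mulr_gt0.
split.
  move=> D w a mD iw ia wa.
  have Ka i := leb_norm_Rintegral_le mD (iw i) (lintegrableZ K mD ia) (aK _ _ _ i wa).
  have ge0 : 0 <= K * \int[leb]_(t in D) a t.
    rewrite mulr_ge0 ?(ltW K0)//; apply: leb_Rintegral_ge0 => //.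
    by apply: (leb_aeS wa) => t h /h; exact: le_trans.
  rewrite -mulrA; apply: K2 => // i; rewrite ecoord_vint -(RintegralZl _ mD ia).
  exact: Ka.
move=> T w a s t iw ia wa s0 st tT.
have mT := leb_measurable_itv `[0, T].
have Ka i := primitive_increment (iw i) (lintegrableZ K mT ia) (aK _ _ _ i wa) s0 st tT.
have ZE r : 0 <= r -> r <= T -> \int[leb]_(t in `[0, r]) (K * a t) =
    K * \int[leb]_(t in `[0, r]) a t.
  move=> r0 rT; rewrite (RintegralZl _ (leb_measurable_itv _))//.
  apply: lintegrableS ia => z /=; rewrite !in_itv/= => /andP[-> zr].
  exact: le_trans zr rT.
rewrite -mulrA; apply: K2.
  rewrite mulr_ge0 ?(ltW K0)// (primitive_split ia)//.
  apply: leb_Rintegral_ge0 => //.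
    apply: lintegrableS ia => z /=; rewrite !in_itv/= => /andP[sz zt].
    by rewrite (le_trans s0 (ltW sz)) (le_trans zt tT).
  apply: (leb_aeS wa) => z h; rewrite /= in_itv/= => /andP[sz zt].
  apply: (le_trans (normr_ge0 (w z))); apply: h.
  by rewrite /= in_itv/= (le_trans s0 (ltW sz)) (le_trans zt tT).
move=> i; rewrite ecoordB !ecoord_vint mulrBr -!ZE//.
- exact: le_trans tT.
- exact: le_trans st.
Qed.

Lemma vint_abs_continuous T w a : vintegrable `[0, T] w ->
  lintegrable `[0, T] a ->
  {ae leb, forall t : lebT R, `[0, T]%classic t -> `|w t| <= a t} ->
  abs_continuous 0 T (fun t => vint `[0, t] w).
Proof.
move=> iw ia wa; have [K K0 [_ K2]] := vint_bound.
move=> e e0; have [d d0 dP] := primitive_abs_continuous ia (divr_gt0 e0 K0).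
exists d => // n l r lr tI sd.
apply: (@le_lt_trans _ _ (K * \sum_(i < n)
  `|\int[leb]_(t in `[0, r i]) a t - \int[leb]_(t in `[0, l i]) a t|)).
  rewrite mulr_sumr; apply: ler_sum => i _; have [l0 lri rT] := lr i.
  rewrite (le_trans (K2 _ _ _ _ _ iw ia wa l0 lri rT))// ler_pM2l//.
  exact: ler_norm.
by rewrite mulrC -ltr_pdivlMr// dP.
Qed.

Lemma leb_ae_nat (P : nat -> R -> Prop) :
  (forall k, {ae leb, forall t : lebT R, P k t}) ->
  {ae leb, forall t : lebT R, forall k, P k t}.
Proof.
move=> aeP.
have : leb.-negligible (\bigcup_k [set t : lebT R | ~ P k t]).
  by apply: negligible_bigcup => k; exact: aeP.
move=> [N [mN N0 PN]]; exists N; split => // t /= nP; apply: PN.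
by move/existsNP: nP => [k nPk]; exists k.
Qed.

Lemma leb_ae_ord n (P : 'I_n -> R -> Prop) :
  (forall i, {ae leb, forall t : lebT R, P i t}) ->
  {ae leb, forall t : lebT R, forall i, P i t}.
Proof.
move=> aeP.
have /leb_ae_nat h k : {ae leb, forall t : lebT R,
    if insub k is Some i then P i t else True}.
  by case: insub => [i|]; [exact: aeP|exact: leb_aeT].
by apply: (leb_aeS h) => t Pt i; have := Pt i; rewrite valK.
Qed.

Lemma vint_derive T w : vintegrable `[0, T] w ->
  {ae leb, forall t : lebT R, 0 < t -> t < T ->
    is_derive (t : R) (1 : R) (fun s => vint `[0, s] (fun r => if r \in `[0, T] then w r else 0))
      (w t)}.
Proof.
move=> iw; apply: (leb_aeS (leb_ae_ord (fun i => leb_FTC (iw i)))) => t h t0 tT.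
apply/is_derive_cvgP; rewrite [w t]ecoord_sum.
rewrite (_ : (fun r => _) = fun r => \sum_i (r^-1 *:
  (((fun s => \int[leb]_(z in `[0, s]) ((fun z => ecoord i (w z)) \_ `[0, T]) z)
     \o shift t) (r *: (1 : R)) -
   (\int[leb]_(z in `[0, t]) ((fun z => ecoord i (w z)) \_ `[0, T]) z)) : R)
  *: ebasis i).
  apply: cvg_sumr => i; apply: cvgZr_tmp.
  by have /is_derive_cvgP := h i t0 tT; apply.
apply/funext => r /=; rewrite /vint -sumrB scaler_sumr; apply: eq_bigr => i _.
rewrite -scalerBl scalerA; congr (_ *: _); congr (_ * (_ - _));
  apply: eq_Rintegral => z _; rewrite patchE.
  rewrite mem_setE.
  by case: ifP => // _; rewrite /ecoord linear0.
rewrite mem_setE.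
by case: ifP => // _; rewrite /ecoord linear0.
Qed.

End VectorIntegral.

(** * Fixed points of integral operators *)

Section Picard.
Context {R : realType} {E : normedVectType R}.
Variables (T B Wm : R) (W : R -> R) (F : (R -> E) -> R -> E).
Hypothesis T0 : 0 <= T.
Hypothesis B0 : 0 <= B.
Hypothesis W1 : forall t, 0 <= t <= T -> 1 <= W t <= Wm.

(** The ball of radius [B] for the norm sup |y t| / W t, in which [F] contracts by the factor
    1/2. *)
Definition tube (y : R -> E) := {within `[0, T], continuous y} /\
  forall t, 0 <= t <= T -> `|y t| <= B * W t.

Hypothesis F_tube : forall y, tube y -> tube (F y).
Hypothesis F_contract : forall y y' N, tube y -> tube y' -> 0 <= N ->
  (forall t, 0 <= t <= T -> `|y t - y' t| <= N * W t) ->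
  forall t, 0 <= t <= T -> `|F y t - F y' t| <= N / 2 * W t.

Let W_ge0 t : 0 <= t <= T -> 0 <= W t.
Proof. by move=> /W1/andP[h _]; exact: le_trans h. Qed.

Let half_small (c : R) : 0 <= c -> forall e, 0 < e -> exists n, c / 2 ^+ n < e.
Proof.
move=> c0 e e0; exists (Num.bound (c / e)).
rewrite ltr_pdivrMr ?exprn_gt0// mulrC -ltr_pdivrMr//.
apply: (lt_trans (archi_boundP _)); first by rewrite divr_ge0// ltW.
by rewrite -natrX ltr_nat ltn_expl.
Qed.

Lemma tube_dist y y' : tube y -> tube y' ->
  forall t, 0 <= t <= T -> `|y t - y' t| <= (2 * B) * W t.
Proof.
move=> [_ yB] [_ y'B] t tT; rewrite (le_trans (ler_normB _ _))//.
by have := yB t tT; have := y'B t tT; lra.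
Qed.

(** With D the weighted distance of [y] and [y'], contraction gives D <= D / 2 + k, using 1 <= W for
    the last term. The inequality is iterated from the initial bound [2 * B]. *)
Lemma picard_stability y y' k : tube y -> tube y' -> 0 <= k ->
  (forall t, 0 <= t <= T -> F y t = y t) ->
  (forall t, 0 <= t <= T -> `|F y' t - y' t| <= k) ->
  forall t, 0 <= t <= T -> `|y t - y' t| <= 2 * k * W t.
Proof.
move=> ty ty' k0 yF y'F.
have step n : forall t, 0 <= t <= T ->
    `|y t - y' t| <= (2 * B / 2 ^+ n + 2 * k) * W t.
  elim: n => [|n IH] t tT.
    rewrite expr0 divr1 (le_trans (tube_dist ty ty' tT))//.
    by rewrite ler_wpM2r ?W_ge0// lerDl mulr_ge0.
  have N0 : 0 <= 2 * B / 2 ^+ n + 2 * k by rewrite addr_ge0 ?divr_ge0 ?mulr_ge0 ?exprn_ge0.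
  have := F_contract ty ty' N0 IH tT; rewrite yF// => h.
  rewrite (_ : y t - y' t = (y t - F y' t) + (F y' t - y' t)); last by rewrite addrA subrK.
  rewrite (le_trans (ler_normD _ _))// (le_trans (lerD h (y'F t tT)))//.
  have : k <= k * W t by rewrite ler_peMr//; have /andP[] := W1 tT.
  rewrite exprS invfM; set z := (2 ^+ n)^-1; set v := W t; nra.
move=> t tT; apply/ler_addgt0Pr => e e0.
have Wt := W_ge0 tT.
have [n nP] := half_small (mulr_ge0 (mulr_ge0 (ler0n R 2) B0) Wt) e0.
apply: (le_trans (step n t tT)).
rewrite mulrDl addrC lerD2l mulrAC; exact: ltW.
Qed.

Lemma picard_unique y y' : tube y -> tube y' ->
  (forall t, 0 <= t <= T -> F y t = y t) ->
  (forall t, 0 <= t <= T -> F y' t = y' t) ->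
  forall t, 0 <= t <= T -> y t = y' t.
Proof.
move=> ty ty' yF y'F t tT; apply/eqP; rewrite -subr_eq0 -normr_le0.
have := picard_stability ty ty' (lexx 0) yF _ tT; rewrite mulr0 mul0r; apply.
by move=> s sT; rewrite y'F// subrr normr0.
Qed.

Lemma ecauchy_cvg (u : nat -> E) :
  (forall e, 0 < e -> exists N, forall n m, (N <= n)%N -> (N <= m)%N ->
     `|u n - u m| < e) -> exists l : E, u n @[n --> \oo] --> l.
Proof.
move=> cu; have [K K0 [K1 _]] := @ecoord_bound R E.
have ci i : exists l : R, ecoord i (u n) @[n --> \oo] --> l.
  suff : cvg ((fun n => ecoord i (u n) : R^o) @ \oo) by move=> /cvg_ex.
  apply/cauchy_cvgP/cauchy_ballP => e e0.
  have [N NP] := cu _ (divr_gt0 e0 K0).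
  pose A : set R^o := [set ecoord i (u n) | n in [set n | (N <= n)%N]].
  exists (A, A); first by split; exists N => // n Nn; exists n.
  move=> [a b] [/= [n Nn <-] [m Nm <-]]; rewrite /ball/= -ecoordB (le_lt_trans (K1 _ _))//.
  by rewrite mulrC -ltr_pdivlMr// NP.
have [l lP] := choice ci.
exists (\sum_i l i *: ebasis i).
rewrite (_ : (fun n => u n) = (fun n => \sum_i ecoord i (u n) *: ebasis i)).
  by apply: cvg_sumr => i; apply: cvgZr_tmp; exact: lP.
by apply/funext => n; rewrite -ecoord_sum.
Qed.

Lemma picard : exists y, tube y /\ forall t, 0 <= t <= T -> F y t = y t.
Proof.
pose Y n := iter n F (fun _ => 0).
have tY n : tube (Y n).
  elim: n => [|n IH]; last exact: F_tube.
  split; first by apply: continuous_subspaceT => t; exact: cvg_cst.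
  by move=> t tT; rewrite normr0 mulr_ge0 ?W_ge0.
have stepY n m t : (n <= m)%N -> 0 <= t <= T ->
    `|Y m t - Y n t| <= 2 * B / 2 ^+ n * W t.
  elim: n m t => [|n IH] m t; first by move=> _ tT; rewrite expr0 divr1; exact: tube_dist.
  case: m => // m nm tT; rewrite exprS invfM (mulrC 2^-1) mulrA.
  apply: F_contract => //; first by rewrite divr_ge0 ?mulr_ge0 ?exprn_ge0.
  by move=> s sT; exact: IH.
have unif e : 0 < e -> exists N, forall n m t, (N <= n)%N -> (N <= m)%N ->
    0 <= t <= T -> `|Y n t - Y m t| < e.
  move=> e0; have Wm0 : 0 <= Wm.
    have h00 : (0 : R) <= 0 <= T by rewrite lexx T0.
    have /andP[h1 h2] := W1 h00.
    exact: le_trans (le_trans ler01 h1) h2.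
  have [N NP] := half_small (mulr_ge0 (mulr_ge0 (ler0n R 4) B0) Wm0) e0.
  exists N => n m t Nn Nm tT; apply: le_lt_trans NP.
  rewrite (_ : Y n t - Y m t = (Y n t - Y N t) - (Y m t - Y N t)); last by rewrite opprB addrA subrK.
  rewrite (le_trans (ler_normB _ _))//.
  rewrite (le_trans (lerD (stepY _ _ _ Nn tT) (stepY _ _ _ Nm tT)))//.
  have /andP[_ WW] := W1 tT.
  have z0 : 0 <= 2 * B / 2 ^+ N by rewrite divr_ge0 ?mulr_ge0 ?exprn_ge0.
  have -> : 4 * B * Wm / 2 ^+ N = 2 * (2 * B / 2 ^+ N * Wm) by ring.
  have := ler_wpM2l z0 WW; lra.
have lim_t t : exists l : E, 0 <= t <= T -> Y n t @[n --> \oo] --> l.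
  have [tT|nT] := boolP (0 <= t <= T); last by exists 0.
  have [|l lP] := @ecauchy_cvg (fun n => Y n t); last by exists l.
  by move=> e /unif[N NP]; exists N => n m Nn Nm; exact: NP.
have [y yP] := choice lim_t.
have ylim e : 0 < e -> exists N, forall n t, (N <= n)%N -> 0 <= t <= T ->
    `|y t - Y n t| <= e.
  move=> /unif[N NP]; exists N => n t Nn tT.
  apply: (@cvgr_to_le _ \oo _ R (fun m => `|Y m t - Y n t|)).
    apply: cvg_norm; apply: cvgB; first exact: yP.
    exact: cvg_cst.
  by exists N => // m Nm; exact/ltW/NP.
have ty : tube y.
  split; last first.
    move=> t tT; apply: (@cvgr_to_le _ \oo _ R (fun m => `|Y m t|)).
      by apply: cvg_norm; exact: yP.
    by apply: nearW => m; have [_ h] := tY m; exact: h.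
  apply/within_continuous_dist => t e tT e0.
  have e3 : 0 < e / 4 by rewrite divr_gt0.
  have [N NP] := ylim _ e3.
  have [cN _] := tY N.
  have [d d0 dP] := (within_continuous_dist _ _).1 cN t _ tT e3.
  exists d => // s sT ts.
  have tT' : 0 <= t <= T by move: tT; rewrite /= in_itv.
  have sT' : 0 <= s <= T by move: sT; rewrite /= in_itv.
  have h1 := NP N t (leqnn N) tT'; have h2 := NP N s (leqnn N) sT'.
  have h3 := dP s sT ts.
  rewrite (_ : y t - y s = (y t - Y N t) + ((Y N t - Y N s) - (y s - Y N s))).
    rewrite (le_lt_trans (ler_normD _ _))//.
    have := ler_normB (Y N t - Y N s) (y s - Y N s); lra.
  by rewrite opprB [X in _ = _ + X]addrA subrK addrA subrK.
exists y; split => // t tT; apply/eqP; rewrite -subr_eq0 -normr_le0.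
apply/ler_addgt0Pr => e e0; rewrite add0r.
have Wm0 : 0 < Wm by have /andP[h1 h2] := W1 tT; exact: lt_le_trans (lt_le_trans ltr01 h1) h2.
have e2 : 0 < e / 2 / (1 + Wm) by rewrite !divr_gt0// addr_gt0.
have [N NP] := ylim _ e2.
have h1 := NP N.+1 t (leqnSn N) tT.
have h2 s : 0 <= s <= T -> `|y s - Y N s| <= (e / 2 / (1 + Wm)) * W s.
  move=> sT; apply: (le_trans (NP N s (leqnn N) sT)).
  by rewrite ler_peMr ?(ltW e2)//; have /andP[] := W1 sT.
have h3 := F_contract ty (tY N) (ltW e2) h2 tT.
rewrite (_ : F y t - y t = (F y t - F (Y N) t) - (y t - Y N.+1 t)); last first.
  by rewrite -[Y N.+1 t]/(F (Y N) t) opprB addrA subrK.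
rewrite (le_trans (ler_normB _ _))// (le_trans (lerD h3 h1))//.
have /andP[W1t Wmt] := W1 tT.
have q0 : e / 2 / (1 + Wm) * (1 + Wm) = e / 2 by rewrite divfK// gt_eqF// addr_gt0.
move: q0 e2; set q := e / 2 / (1 + Wm); nra.
Qed.

End Picard.

Lemma Rintegral_at0 (R : realType) (T : R) (w : R -> R) : 0 <= T ->
  lintegrable `[0, T] w -> \int[leb]_(r in `[0, 0]) w r = 0.
Proof.
move=> T0 iw; apply: (null_Rintegral (leb_measurable_itv `[0, 0])).
  apply: (measurable_funS (leb_measurable_itv `[0, T]) _ (lintegrable_measurable iw)).
  move=> z /=; rewrite !in_itv/= => /andP[-> z0].
  exact: le_trans z0 T0.
by rewrite [LHS](lebesgue_measure_itv `[0, 0]) /= ltxx.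
Qed.

Lemma ltr_dist_le (R : realType) (x y e : R) : `|x - y| < e -> x <= y + e.
Proof. by rewrite ltr_norml => /andP[_ h]; lra. Qed.

(** One small increment in the proofs of the two weight inequalities, forward and backward; the
    slack [e / (K + 1)] is at most [e] after multiplication by [K]. *)
Lemma weight_arith (R : realType) (K e x y Wx Wy Ix Iy IT : R) : 0 <= K ->
  0 < e -> 0 <= y - x -> Wx * (K * (y - x)) <= Wy - Wx ->
  Iy - Ix <= (Wx + e / (K + 1)) * (y - x) ->
  Wx - K * Ix - (Wy - K * Iy) <= e * (y - x) /\
  K * (IT - Ix) - Wy - (K * (IT - Iy) - Wx) <= e * (y - x).
Proof.
move=> K0 e0 yx h1 /(ler_wpM2l K0) h2.
have K1 : 0 < K + 1 by rewrite ltr_wpDl.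
have : K * (e / (K + 1)) * (y - x) <= e * (y - x).
  by rewrite ler_wpM2r// mulrCA ger_pMr// ler_pdivrMr// mul1r lerDl.
lra.
Qed.

(** * Exponential weights for integral equations *)

Section Weights.
Context {R : realType}.
Variables (T : R) (a : R -> R).
Hypothesis T0 : 0 < T.
Hypothesis ia : lintegrable `[0, T] a.
Hypothesis a0 : forall t, 0 <= t <= T -> 0 <= a t.

Hint Resolve leb_measurable_itv : core.

Definition primitive (t : R) := \int[leb]_(r in `[0, t]) a r.
Local Notation A := primitive.

Lemma primitive0 : A 0 = 0.
Proof.
exact: Rintegral_at0 (ltW T0) ia.
Qed.

Lemma primitive_le s t : 0 <= s -> s <= t -> t <= T -> A s <= A t.
Proof.
move=> s0 st tT; rewrite -subr_ge0 (primitive_split ia)//.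
apply: Rintegral_ge0 => r /=; rewrite in_itv/= => /andP[sr rt].
by apply: a0; rewrite (le_trans s0 (ltW sr)) (le_trans rt tT).
Qed.

Lemma primitive_continuous : {within `[0, T], continuous A}.
Proof. exact/abs_continuous_within/primitive_abs_continuous. Qed.

Lemma primitive_control : control T (fun s t => A t - A s).
Proof. by apply: control_increments primitive_continuous _; exact: primitive_le. Qed.

Lemma lintegrableM_bounded (h : R -> R) M : lmeas `[0, T] h ->
  (forall t, 0 <= t <= T -> `|h t| <= M) ->
  lintegrable `[0, T] (fun t => a t * h t).
Proof.
move=> mh hM; have ma := lintegrable_measurable ia.
apply: (leb_le_integrable (leb_measurable_itv _) _ _
  (lintegrableZ M (leb_measurable_itv _) ia)).
  by apply: measurable_funM; [exact: ma|exact: mh].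
apply: leb_aeT => t /=; rewrite in_itv/= => tT.
by rewrite normrM (ger0_norm (a0 tT)) mulrC ler_wpM2r ?a0 ?hM.
Qed.

Lemma primitiveM_le (h : R -> R) M s t : lintegrable `[0, T] (fun t => a t * h t) ->
  0 <= s -> s <= t -> t <= T ->
  (forall r, s <= r <= t -> h r <= M) ->
  \int[leb]_(r in `[0, t]) (a r * h r) - \int[leb]_(r in `[0, s]) (a r * h r)
    <= M * (A t - A s).
Proof.
move=> iah s0 st tT hM; rewrite (primitive_split iah)// (primitive_split ia)//.
have sub : `]s, t]%classic `<=` `[0, T]%classic.
  move=> z /=; rewrite !in_itv/= => /andP[sz zt].
  by rewrite (le_trans s0 (ltW sz)) (le_trans zt tT).
have ia' : lintegrable `]s, t] a by exact: lintegrableS ia.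
rewrite -(RintegralZl _ (leb_measurable_itv _) ia').
apply: leb_le_Rintegral => //; first exact: lintegrableS iah.
  exact: lintegrableZ.
apply: leb_aeT => r rst; rewrite mulrC ler_wpM2r//.
  by apply: a0; have := sub r rst; rewrite /= in_itv.
by apply: hM; move: rst; rewrite /= in_itv/= => /andP[/ltW -> ->].
Qed.

Variable K : R.
Hypothesis K0 : 0 <= K.

(** Formally the derivative of [fweight] is [K * a * fweight], so integrating [a] against the weight
    gains a factor 1/K; [bweight] is the same with time reversed. *)
Definition fweight t := expR (K * A t).
Definition bweight t := expR (K * (A T - A t)).

Lemma fweight_continuous : {within `[0, T], continuous fweight}.
Proof.
apply: (@within_comp _ _ _ _ setT expR (fun t => K * A t)) => //; last first.
  by apply: continuous_subspaceT; exact: continuous_expR.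
move=> x; apply: cvgM; first exact: cvg_cst.
exact: primitive_continuous.
Qed.

Lemma bweight_continuous : {within `[0, T], continuous bweight}.
Proof.
apply: (@within_comp _ _ _ _ setT expR (fun t => K * (A T - A t))) => //; last first.
  by apply: continuous_subspaceT; exact: continuous_expR.
move=> x; apply: cvgM; first exact: cvg_cst.
apply: cvgB; first exact: cvg_cst.
exact: primitive_continuous.
Qed.

Lemma fweight_bounds t : 0 <= t <= T -> 1 <= fweight t <= expR (K * A T).
Proof.
move=> /andP[t0 tT]; rewrite /fweight -{1}expR0 !ler_expR; apply/andP; split.
  by rewrite mulr_ge0// -primitive0 primitive_le.
by rewrite ler_wpM2l// primitive_le.
Qed.

Lemma bweight_bounds t : 0 <= t <= T -> 1 <= bweight t <= expR (K * A T).
Proof.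
move=> /andP[t0 tT]; rewrite /bweight -{1}expR0 !ler_expR; apply/andP; split.
  by rewrite mulr_ge0// subr_ge0 primitive_le.
by rewrite ler_wpM2l// lerBlDr lerDl -primitive0 primitive_le.
Qed.

Lemma fweight_integrable : lintegrable `[0, T] (fun t => a t * fweight t).
Proof.
apply: (lintegrableM_bounded (M := expR (K * A T))).
  exact/leb_continuous/fweight_continuous.
move=> t tT; have /andP[h1 h2] := fweight_bounds tT.
by rewrite (ger0_norm (le_trans ler01 h1)).
Qed.

Lemma bweight_integrable : lintegrable `[0, T] (fun t => a t * bweight t).
Proof.
apply: (lintegrableM_bounded (M := expR (K * A T))).
  exact/leb_continuous/bweight_continuous.
move=> t tT; have /andP[h1 h2] := bweight_bounds tT.
by rewrite (ger0_norm (le_trans ler01 h1)).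
Qed.

Let exp_tangent (x y : R) : expR x * (y - x) <= expR y - expR x.
Proof.
have := ler_wpM2l (expR_ge0 x) (expR_ge1Dx (y - x)).
rewrite -expRD (addrC x (y - x)) subrK; lra.
Qed.

(** Formally [fweight t - K * I t] is constantly 1. As [a] is merely integrable, this function is
    shown to be nondecreasing through increments relative to the primitive of [a], with the tangent
    inequality of the exponential in place of the chain rule. *)
Lemma fweight_ineq t : 0 <= t <= T ->
  K * \int[leb]_(r in `[0, t]) (a r * fweight r) <= fweight t.
Proof.
move=> /andP[t0 tT].
pose I s := \int[leb]_(r in `[0, s]) (a r * fweight r).
have I0 : I 0 = 0 := Rintegral_at0 (ltW T0) fweight_integrable.
rewrite -/(I t) -subr_ge0.
apply: (@le_trans _ _ (fweight 0 - K * I 0)).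
  by rewrite I0 mulr0 subr0 expR_ge0.
apply: (@le_small_increments _ _ _ T0 primitive_control
  (fun s => fweight s - K * I s) _ _ (lexx 0) t0 tT).
move=> e e0; have K1 : 0 < K + 1 by rewrite ltr_wpDl.
have [d d0 dP] := within_uniform fweight_continuous (divr_gt0 e0 K1).
exists d => // s r s0 sr rt srd.
have rT := le_trans rt tT; have r0 := le_trans s0 sr.
have dA : 0 <= A r - A s by rewrite subr_ge0 primitive_le.
have h1 := exp_tangent (K * A s) (K * A r).
have h2 : I r - I s <= (fweight s + e / (K + 1)) * (A r - A s).
  apply: (primitiveM_le fweight_integrable s0 sr rT) => q /andP[sq qr].
  have : `|fweight q - fweight s| < e / (K + 1).
    apply: dP; [by rewrite (le_trans s0 sq) (le_trans qr rT)| |].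
      by rewrite s0 (le_trans sr rT).
    by rewrite ger0_norm ?subr_ge0// (le_lt_trans _ srd)// lerB.
  exact: ltr_dist_le.
have h1' : fweight s * (K * (A r - A s)) <= fweight r - fweight s.
  by rewrite mulrBr.
exact: (weight_arith 0 K0 e0 dA h1' h2).1.
Qed.

Lemma bweight_ineq t : 0 <= t <= T ->
  K * \int[leb]_(r in `[t, T]) (a r * bweight r) <= bweight t.
Proof.
move=> /andP[t0 tT].
have sE (x y z : R) : (x - y) - (x - z) = z - y by ring.
pose I s := \int[leb]_(r in `[0, s]) (a r * bweight r).
rewrite (primitive_rest bweight_integrable t0 tT) -/(I T) -/(I t).
suff : K * (I T - I t) - bweight t <= K * (I T - I T) - bweight T.
  move=> h; have : K * (I T - I t) - bweight t <= 0.
    by apply: le_trans h _; rewrite subrr mulr0 sub0r oppr_le0 expR_ge0.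
  by rewrite subr_le0.
apply: (@le_small_increments _ _ _ T0 primitive_control
  (fun s => K * (I T - I s) - bweight s) _ _ t0 tT (lexx T)).
move=> e e0; have K1 : 0 < K + 1 by rewrite ltr_wpDl.
have [d d0 dP] := within_uniform bweight_continuous (divr_gt0 e0 K1).
exists d => // s r ts sr rT srd.
have s0 := le_trans t0 ts; have r0 := le_trans s0 sr.
have dA : 0 <= A r - A s by rewrite subr_ge0 primitive_le.
have h1 := exp_tangent (K * (A T - A r)) (K * (A T - A s)).
have h2 : I r - I s <= (bweight r + e / (K + 1)) * (A r - A s).
  apply: (primitiveM_le bweight_integrable s0 sr rT) => q /andP[sq qr].
  have : `|bweight q - bweight r| < e / (K + 1).
    apply: dP; [by rewrite (le_trans s0 sq) (le_trans qr rT)|by rewrite r0|].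
    by rewrite ler0_norm ?subr_le0// opprB (le_lt_trans _ srd)// lerB.
  exact: ltr_dist_le.
have h1' : bweight r * (K * (A r - A s)) <= bweight s - bweight r.
  by apply: le_trans h1; rewrite -mulrBr sE.
exact: (weight_arith (I T) K0 e0 dA h1' h2).2.
Qed.

End Weights.

(** * Mean value inequality along segments *)

Section MeanValue.
Context {R : realType}.

Lemma is_derive_line (V W : normedModType R) (F : V -> W) (x v : V) (t : R) :
  differentiable F (x + t *: v) ->
  is_derive t (1 : R) (fun s : R => F (x + s *: v)) ('d F (x + t *: v) v).
Proof.
move=> dF; apply/is_derive_cvgP.
have dd := @diff_derivable _ _ _ F (x + t *: v) v dF.
rewrite -(deriveE v dF); apply: cvg_trans dd; apply: near_eq_cvg.
apply: nearW => h /=; congr (_ *: (F _ - _)).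
by rewrite [h *: 1]mulr1 scalerDl addrCA.
Qed.

(** The target is the real line, as in the mean value theorem; vector-valued maps are reached by
    composing with functionals. *)
Lemma mean_value_le (V : normedModType R) (F : V -> R^o) (x y : V) (K : R) :
  (forall t : R, 0 <= t <= 1 -> differentiable F (x + t *: (y - x)) /\
     `|'d F (x + t *: (y - x)) (y - x)| <= K) ->
  `|F y - F x| <= K.
Proof.
move=> dF; pose h s : R := F (x + s *: (y - x)).
have dh (t : R) : 0 <= t <= 1 -> is_derive t (1 : R) h ('d F (x + t *: (y - x)) (y - x)).
  by move=> /dF[d _]; exact: is_derive_line.
have c1 : {within `[0, 1], continuous h}.
  apply: derivable_within_continuous => t; rewrite in_itv/= => t01.
  by have [] := dh t t01.
have dh' (t : R) : t \in `]0, 1[ ->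
    is_derive t (1 : R) h ('d F (x + t *: (y - x)) (y - x)).
  by rewrite in_itv/= => /andP[t0 t1]; apply: dh; rewrite !ltW.
have [c c01] := MVT ltr01 dh' c1.
rewrite subr0 mulr1 /h scale1r scale0r addr0 (addrC x (y - x)) subrK => ->.
by move: c01; rewrite in_itv/= => /andP[/ltW c0 /ltW c1']; apply: (dF c _).2; rewrite c0.
Qed.

End MeanValue.

(** * Differentials along curves *)

Section Differentials.
Context {R : realType}.

Lemma differentiable_approx (V W : normedModType R) (F : V -> W) (x : V) :
  differentiable F x -> forall e, 0 < e -> exists2 d, 0 < d &
    forall v, `|v| < d -> `|F (x + v) - F x - frechet F x v| <= e * `|v|.
Proof.
move=> dF e e0; have /eqaddoP/(_ _ e0) := diff_locally dF.
move=> /nbhs_normP[d /= d0 dP]; exists d => // v vd.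
have := dP v; rewrite /= sub0r normrN => /(_ vd).
by rewrite /= !fctE /= (addrC v) opprD addrA (frechetE dF).
Qed.

(** The direction [v_ n] moves with [n], as it does for quotients along perturbed trajectories; the
    uniformity of the Frechet remainder allows this. *)
Lemma differentiable_cvg (V W : normedModType R) (F : V -> W) (x : V)
    (e_ : nat -> R) (v_ : nat -> V) (v : V) :
  differentiable F x -> (forall n, 0 < e_ n) -> e_ n @[n --> \oo] --> 0 ->
  v_ n @[n --> \oo] --> v ->
  (e_ n)^-1 *: (F (x + e_ n *: v_ n) - F x) @[n --> \oo] --> frechet F x v.
Proof.
move=> dF e0 ecvg vcvg; apply/cvgrPdist_le => k k0.
pose M := `|v| + 1; have M0 : 0 < M by rewrite ltr_wpDl.
have N0 : 0 < `|frechet F x| + 1 by rewrite ltr_wpDl.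
have [d d0 dP] := differentiable_approx dF (divr_gt0 (divr_gt0 k0 (ltr0n R 2)) M0).
near=> n.
have vn : `|v - v_ n| <= k / 2 / (`|frechet F x| + 1).
  by near: n; move/cvgrPdist_le : vcvg; apply; rewrite !divr_gt0.
have vM : `|v_ n| <= M.
  have : `|v - v_ n| <= 1 by near: n; move/cvgrPdist_le : vcvg; apply.
  have := ler_normB v (v - v_ n); rewrite opprB addrC subrK /M; lra.
have en : `|e_ n| < d / M.
  near: n; move/cvgrPdist_lt : ecvg => /(_ _ (divr_gt0 d0 M0)).
  by apply: filterS => n; rewrite sub0r normrN.
have een := e0 n.
have evd : `|e_ n *: v_ n| < d.
  rewrite normrZ (le_lt_trans (ler_wpM2l (normr_ge0 _) vM))//.
  by rewrite -ltr_pdivlMr.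
have := dP _ evd; move: (F _ - F x) => Z h.
have -> : frechet F x v - (e_ n)^-1 *: Z =
    frechet F x (v - v_ n) - (e_ n)^-1 *: (Z - frechet F x (e_ n *: v_ n)).
  have -> : frechet F x (e_ n *: v_ n) = e_ n *: frechet F x (v_ n) by exact: linearZZ.
  have -> : frechet F x (v - v_ n) = frechet F x v - frechet F x (v_ n) by exact: linearB.
  rewrite scalerBr scalerA mulVf ?gt_eqF// scale1r.
  by rewrite opprB addrA subrK.
rewrite (le_trans (ler_normB _ _))// (splitr k) lerD//.
  rewrite (le_trans (opnormP _ _))// (le_trans (ler_wpM2l (normr_ge0 _) vn))//.
  rewrite mulrCA ger_pMr ?divr_gt0// ler_pdivrMr// mul1r lerDl//.
rewrite normrZ gtr0_norm ?invr_gt0// ler_pdivrMl// (le_trans h)//.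
rewrite normrZ (gtr0_norm een) mulrCA ler_pM2l//.
by rewrite mulrAC ler_pdivrMr// ler_wpM2l// divr_ge0// ltW.
Unshelve. all: by end_near. Qed.

Lemma lipschitz_functional (V W : normedModType R) (F : V -> W)
    (A : {linear W -> R^o}) (x y : V) (c L : R) : continuous A -> 0 <= c ->
  (forall z, `|A z| <= c * `|z|) ->
  (forall t : R, 0 <= t <= 1 -> differentiable F (x + t *: (y - x)) /\
     `|frechet F (x + t *: (y - x))| <= L) ->
  `|A (F y) - A (F x)| <= c * L * `|y - x|.
Proof.
move=> cA c0 Ac dF; apply: (@mean_value_le _ _ (A \o F)) => t t01.
have [dFt LF] := dF t t01.
have dA z : differentiable A z by exact: linear_differentiable.
split; first exact: differentiable_comp.
rewrite diff_comp// diff_lin//= -frechetE// -mulrA.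
rewrite (le_trans (Ac _))// ler_wpM2l// (le_trans (opnormP _ _))//.
by rewrite ler_wpM2r.
Qed.

Lemma clin_eval_cvg (V W : normedModType R) (I : Type) (G : set_system I)
    (FG : Filter G) (B : I -> 'L(V, W)) (v : I -> V) (B0 : 'L(V, W)) (v0 : V) :
  B i @[i --> G] --> B0 -> v i @[i --> G] --> v0 ->
  B i (v i) @[i --> G] --> B0 v0.
Proof.
move=> cB cv; apply/cvgrPdist_lt => e e0.
have M0 : 0 < `|v0| + 1 by rewrite ltr_wpDl.
have N0 : 0 < `|B0| + 1 by rewrite ltr_wpDl.
near=> i.
have vi : `|v0 - v i| < e / 2 / (`|B0| + 1).
  by near: i; move/cvgrPdist_lt : cv; apply; rewrite !divr_gt0.
have vM : `|v i| <= `|v0| + 1.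
  have : `|v0 - v i| <= 1 by near: i; move/cvgrPdist_le : cv; apply.
  have := ler_normB v0 (v0 - v i); rewrite opprB addrC subrK; lra.
have Bi : `|B0 - B i| < e / 2 / (`|v0| + 1).
  by near: i; move/cvgrPdist_lt : cB; apply; rewrite !divr_gt0.
have -> : B0 v0 - B i (v i) = B0 (v0 - v i) + (B0 - B i) (v i).
  by rewrite linearB -[(B0 - B i) _]/(B0 _ - B i _) addrA subrK.
rewrite (splitr e) (le_lt_trans (ler_normD _ _))// ltr_leD//.
  rewrite (le_lt_trans (opnormP _ _))//.
  rewrite (le_lt_trans (ler_wpM2l (normr_ge0 _) (ltW vi)))//.
  by rewrite mulrCA gtr_pMr ?divr_gt0// ltr_pdivrMr// mul1r ltrDl.
rewrite (le_trans (opnormP _ _))//.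
rewrite (le_trans (ler_pM _ _ (ltW Bi) vM))//.
by rewrite divfK// gt_eqF.
Unshelve. all: by end_near. Qed.

Lemma within_clin_eval (U : topologicalType) (V W : normedModType R) (A : set U)
    (B : U -> 'L(V, W)) (v : U -> V) :
  {within A, continuous B} -> {within A, continuous v} ->
  {within A, continuous (fun x => B x (v x))}.
Proof.
move=> /subspace_continuousP cB /subspace_continuousP cv.
apply/subspace_continuousP => x Ax.
exact: (@clin_eval_cvg V W U (within A (nbhs x)) _ B v (B x) (v x) (cB x Ax) (cv x Ax)).
Qed.

(** The tube [|z| <= M] around the trajectory is compact. Applied to derivatives, this is the source
    of the Lipschitz constants. *)
Lemma tube_bounded (E : normedVectType R) (W : normedModType R) (T : R)
    (x : R -> E) (F : R -> E -> W) (M : R) :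
  {within `[0, T], continuous x} ->
  {within [set p : R * E | p.1 \in `[0, T]], continuous (fun p => F p.1 p.2)} ->
  exists2 L, 0 < L & forall t z, 0 <= t <= T -> `|z| <= M -> `|F t (x t + z)| <= L.
Proof.
move=> cx cF.
pose D : set (R * E) := `[0, T]%classic `*` [set z : E | `|z| <= M].
have cD : compact D.
  by apply: compact_setX; [exact: segment_compact|exact: findim_ball_compact].
have cG : {within D, continuous (fun p => F p.1 (x p.1 + p.2))}.
  apply: (@within_comp _ _ _ D [set p : R * E | p.1 \in `[0, T]]
    (fun p => F p.1 p.2) (fun p => (p.1, x p.1 + p.2))) => //.
    apply: within_pair; first by apply: continuous_subspaceT => p; exact: cvg_fst.
    have cx1 : {within D, continuous (fun p : R * E => x p.1)}.
      apply: (@within_comp _ _ _ D `[0, T]%classic x fst) => //.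
        by apply: continuous_subspaceT => p; exact: cvg_fst.
      by move=> p [].
    have c2 : {within D, continuous (fun p : R * E => p.2)}.
      by apply: continuous_subspaceT => p; exact: cvg_snd.
    by move=> p; apply: cvgD; [exact: cx1|exact: c2].
  by move=> p [].
have := continuous_compact cG cD => /compact_bounded[N [_ NP]].
exists (1 + `|N|); first by rewrite ltr_pwDl.
move=> t z tT zM; apply: (NP (1 + `|N|)).
  by rewrite (le_lt_trans (ler_norm _))// ltrDr.
by exists (t, z) => //; split => //=; rewrite in_itv.
Qed.

Lemma abs_continuousD (V : normedModType R) (a b : R) (h k : R -> V) :
  abs_continuous a b h -> abs_continuous a b k ->
  abs_continuous a b (fun t => h t + k t).
Proof.
move=> ah ak e e0; have e2 : 0 < e / 2 by rewrite divr_gt0.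
have [d d0 dP] := ah _ e2; have [d' d'0 dP'] := ak _ e2.
exists (Num.min d d'); first by rewrite lt_min d0.
move=> n l r lr tI; rewrite lt_min => /andP[sd sd'].
rewrite (splitr e) (le_lt_trans _ (ltrD (dP _ _ _ lr tI sd) (dP' _ _ _ lr tI sd')))//.
rewrite -big_split/=; apply: ler_sum => i _.
by rewrite opprD addrACA ler_normD.
Qed.

Lemma abs_continuousZ (V : normedModType R) (a b c : R) (h : R -> V) :
  abs_continuous a b h -> abs_continuous a b (fun t => c *: h t).
Proof.
move=> ah e e0; have c0 : 0 < `|c| + 1 by rewrite ltr_wpDl.
have [d d0 dP] := ah _ (divr_gt0 e0 c0); exists d => // n l r lr tI sd.
have := dP _ _ _ lr tI sd; rewrite ltr_pdivlMr// mulrC => h1.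
apply: le_lt_trans h1; rewrite mulr_sumr; apply: ler_sum => i _.
by rewrite -scalerBr normrZ ler_wpM2r// lerDl.
Qed.

End Differentials.

Section Functionals.
Context {R : realType} {E : normedVectType R}.

Lemma ecoord_linear i : linear (ecoord i : E -> R^o).
Proof. by move=> a y z; rewrite ecoordD ecoordZ. Qed.

HB.instance Definition _ (i : 'I_(\dim {:E})) :=
  GRing.isLinear.Build R E R^o *:%R (ecoord i) (ecoord_linear i).

(** The functionals through which Lipschitz bounds for the operator-valued [g] are reduced to scalar
    ones. *)
Definition coord_eval (V : normedModType R) (i : 'I_(\dim {:E})) (v : V)
  (B : 'L(V, E)) : R^o := ecoord i (B v).

Lemma coord_eval_linear (V : normedModType R) i (v : V) : linear (@coord_eval V i v).
Proof. by move=> a B B'; rewrite /coord_eval -ecoord_linear. Qed.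

HB.instance Definition _ (V : normedModType R) (i : 'I_(\dim {:E})) (v : V) :=
  GRing.isLinear.Build R 'L(V, E) R^o *:%R (coord_eval i v)
    (@coord_eval_linear V i v).

Lemma bounded_functional_continuous (V : normedModType R) (A : {linear V -> R^o})
  (c : R) : (forall z, `|A z| <= c * `|z|) -> continuous A.
Proof.
move=> Ac z; apply/cvgrPdist_lt => e e0.
have c1 : 0 < `|c| + 1 by rewrite ltr_wpDl.
near=> y; rewrite -linearB (le_lt_trans (Ac _))//.
apply: (@le_lt_trans _ _ ((`|c| + 1) * `|z - y|)).
  by rewrite ler_wpM2r// (le_trans (ler_norm _))// lerDl.
rewrite mulrC -ltr_pdivlMr//.
near: y; apply/nbhs_normP; exists (e / (`|c| + 1)); first exact: divr_gt0.
by move=> y.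
Unshelve. all: by end_near. Qed.

End Functionals.

Section TubeLipschitz.
Context {R : realType} {E : normedVectType R}.

Lemma segment_ball (V : normedModType R) (z z' : V) (M t : R) :
  0 <= t <= 1 -> `|z| <= M -> `|z'| <= M -> `|z + t *: (z' - z)| <= M.
Proof.
move=> /andP[t0 t1] zM z'M.
have -> : z + t *: (z' - z) = (1 - t) *: z + t *: z'.
  by rewrite scalerBr scalerBl scale1r addrA addrAC.
rewrite (le_trans (ler_normD _ _))// !normrZ !ger0_norm ?subr_ge0//.
have := ler_wpM2l t0 z'M; have t1' : 0 <= 1 - t by rewrite subr_ge0.
have := ler_wpM2l t1' zM; lra.
Qed.

(** One [L] serves all functionals, so the bound can be used coordinate by coordinate. *)
Lemma tube_lipschitz_functional (W : normedModType R) (T : R) (x : R -> E)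
    (F : R -> E -> W) (M : R) :
  {within `[0, T], continuous x} ->
  (forall t y, t \in `[0, T] -> differentiable (F t) y) ->
  {within [set p : R * E | p.1 \in `[0, T]],
    continuous (fun p => frechet (F p.1) p.2)} ->
  exists2 L, 0 < L & forall (A : {linear W -> R^o}) (c : R), 0 <= c ->
    (forall w, `|A w| <= c * `|w|) ->
    forall t z z', 0 <= t <= T -> `|z| <= M -> `|z'| <= M ->
    `|A (F t (x t + z')) - A (F t (x t + z))| <= c * L * `|z' - z|.
Proof.
move=> cx dF cDF.
have [L L0 LP] := @tube_bounded R E _ T x (fun t y => frechet (F t) y) M cx cDF.
exists L => // A c c0 Ac t z z' tT zM z'M.
have zE : z' - z = (x t + z') - (x t + z) by rewrite opprD addrACA subrr add0r.
rewrite zE; apply: (lipschitz_functional _ c0 Ac).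
  exact: bounded_functional_continuous Ac.
move=> s s01; rewrite -zE -addrA; split.
  by apply: dF; rewrite in_itv.
exact/LP/segment_ball.
Qed.

Lemma tube_lipschitz (T : R) (x : R -> E) (F : R -> E -> E) (M : R) :
  {within `[0, T], continuous x} ->
  (forall t y, t \in `[0, T] -> differentiable (F t) y) ->
  {within [set p : R * E | p.1 \in `[0, T]],
    continuous (fun p => frechet (F p.1) p.2)} ->
  exists2 L, 0 < L & forall t z z', 0 <= t <= T -> `|z| <= M -> `|z'| <= M ->
    `|F t (x t + z') - F t (x t + z)| <= L * `|z' - z|.
Proof.
move=> cx dF cDF; have [L L0 LP] := tube_lipschitz_functional M cx dF cDF.
have [K K0 [K1 K2]] := @ecoord_bound R E.
exists (K * (K * L)) => [|t z z' tT zM z'M]; first by rewrite !mulr_gt0.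
rewrite -mulrA; apply: K2; first by rewrite !mulr_ge0// ltW.
move=> i; rewrite ecoordB.
exact: (LP (ecoord i) K (ltW K0) (K1 i) t z z' tT zM z'M).
Qed.

Lemma tube_lipschitz_clin (T : R) (x : R -> E) (F : R -> E -> 'L(E, E)) (M : R) :
  {within `[0, T], continuous x} ->
  (forall t y, t \in `[0, T] -> differentiable (F t) y) ->
  {within [set p : R * E | p.1 \in `[0, T]],
    continuous (fun p => frechet (F p.1) p.2)} ->
  exists2 L, 0 < L & forall t z z' v, 0 <= t <= T -> `|z| <= M -> `|z'| <= M ->
    `|F t (x t + z') v - F t (x t + z) v| <= L * `|v| * `|z' - z|.
Proof.
move=> cx dF cDF; have [L L0 LP] := tube_lipschitz_functional M cx dF cDF.
have [K K0 [K1 K2]] := @ecoord_bound R E.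
exists (K * (K * L)) => [|t z z' v tT zM z'M]; first by rewrite !mulr_gt0.
rewrite -!mulrA; apply: K2; first by rewrite !mulr_ge0// ltW.
move=> i; rewrite ecoordB.
have Av (B : 'L(E, E)) : `|coord_eval i v B| <= K * `|v| * `|B|.
  rewrite (le_trans (K1 _ _))// -mulrA ler_wpM2l ?(ltW K0)// mulrC.
  exact: opnormP.
have Kv : 0 <= K * `|v| by rewrite mulr_ge0// ltW.
have := LP (coord_eval i v) _ Kv Av t z z' tT zM z'M.
by rewrite -!mulrA (mulrCA `|v|).
Qed.

End TubeLipschitz.

(** * Volterra equations *)

Section Volterra.
Context {R : realType} {E : normedVectType R}.
Implicit Types (w y : R -> E) (G : R -> E -> E).

Hint Resolve leb_measurable_itv : core.

(* The notation [\_] extends by the default point of E, which need not be 0. *)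
Definition cutoff (T : R) w : R -> E := fun r => if r \in `[0, T] then w r else 0.

Lemma cutoff_in T w r : 0 <= r <= T -> cutoff T w r = w r.
Proof. by rewrite /cutoff in_itv/= => ->. Qed.

Lemma cutoff_vintegrable T w : vintegrable `[0, T] w -> vintegrable `[0, T] (cutoff T w).
Proof.
move=> iw i; apply: eq_integrable (iw i) => // r.
by rewrite inE /= in_itv/= => rT; rewrite cutoff_in.
Qed.

Lemma vintegrableB D w w' : measurable (D : set (lebT R)) -> vintegrable D w ->
  vintegrable D w' -> vintegrable D (fun t => w t - w' t).
Proof.
move=> mD iw iw' i; apply: (eq_lintegrable _ (lintegrableB mD (iw i) (iw' i))).
by move=> s; rewrite ecoordB.
Qed.

Lemma vintB D w w' : measurable (D : set (lebT R)) -> vintegrable D w ->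
  vintegrable D w' -> vint D (fun t => w t - w' t) = vint D w - vint D w'.
Proof.
move=> mD iw iw'; rewrite /vint -sumrB; apply: eq_bigr => i _.
rewrite -scalerBl -(RintegralB mD (iw i) (iw' i)); apply: (f_equal (fun z => z *: _)).
by apply: eq_Rintegral => s _; exact: ecoordB.
Qed.

(** The constant of [vint_bound], fixed by choice so that the weights can refer to it. *)
Definition vintK : R := projT1 (cid2 (@vint_bound R E)).

Lemma vintK_gt0 : 0 < vintK.
Proof. by rewrite /vintK; case: cid2. Qed.

Lemma vint_norm_le D w a : measurable (D : set (lebT R)) -> vintegrable D w ->
  lintegrable D a -> (forall t, D t -> `|w t| <= a t) ->
  `|vint D w| <= vintK * \int[leb]_(t in D) a t.
Proof.
move=> mD iw ia wa; rewrite /vintK; case: cid2 => /= K _ [h _].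
by apply: h => //; exact: leb_aeT.
Qed.

Lemma vint_increment_le T w a s t : vintegrable `[0, T] w ->
  lintegrable `[0, T] a -> (forall r, 0 <= r <= T -> `|w r| <= a r) ->
  0 <= s -> s <= t -> t <= T ->
  `|vint `[0, t] w - vint `[0, s] w| <= vintK * (primitive a t - primitive a s).
Proof.
move=> iw ia wa; rewrite /vintK; case: cid2 => /= K _ [_ h].
by apply: h => //; apply: leb_aeT => r; rewrite /= in_itv; exact: wa.
Qed.

Variables (T : R) (a : R -> R).
Hypothesis T0 : 0 < T.
Hypothesis ia : lintegrable `[0, T] a.
Hypothesis a0 : forall t, 0 <= t <= T -> 0 <= a t.

(** [vintK] absorbs the constant of the vector integral, and the factor 2 leaves the contraction
    ratio 1/2. *)
Let K := 2 * vintK.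
Let K0 : 0 <= K. Proof. by rewrite mulr_ge0// ltW// vintK_gt0. Qed.

Definition vweight := fweight a K.
Definition vweight_max := expR (K * primitive a T).

Lemma vweight_bounds t : 0 <= t <= T -> 1 <= vweight t <= vweight_max.
Proof. exact: fweight_bounds. Qed.

(** Lipschitz on a ball only, since the fields are quotients of maps with Lipschitz bounds in a
    tube. The same [a] in [field_zero] yields the growth a (1 + |y|). *)
Record volterra_field (M : R) G : Prop := VolterraField {
  field_lip : forall s z z', 0 <= s <= T -> `|z| <= M -> `|z'| <= M ->
    `|G s z - G s z'| <= a s * `|z - z'| ;
  field_zero : forall s, 0 <= s <= T -> `|G s 0| <= a s ;
  field_meas : forall y, {within `[0, T], continuous y} ->
    (forall s, 0 <= s <= T -> `|y s| <= M) ->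
    vmeas `[0, T] (fun s => G s (y s)) }.

Definition volterra G y t := vint `[0, t] (cutoff T (fun s => G s (y s))).

Section Field.
Variable (G : R -> E -> E).
Hypothesis fG : volterra_field vweight_max G.

Local Notation tubeG := (tube T 1 vweight).

Lemma tube_norm y : tubeG y -> forall s, 0 <= s <= T -> `|y s| <= vweight_max.
Proof.
move=> [_ yW] s sT; apply: (le_trans (yW s sT)); rewrite mul1r.
by have /andP[] := vweight_bounds sT.
Qed.

(** The field is bounded by a (1 + |y|), and both 1 and [|y s|] are at most the weight. For this
    reason the tube of radius 1 is mapped into itself and solutions exist on all of [[0, T]]. *)
Lemma field_norm y s : tubeG y -> 0 <= s <= T ->
  `|G s (y s)| <= 2 * (a s * vweight s).
Proof.
move=> ty sT; have /andP[W1 WM] := vweight_bounds sT.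
have M0 : 0 <= vweight_max := expR_ge0 _.
have h1 := field_lip fG sT (tube_norm ty sT) (_ : `|0| <= vweight_max).
have {}h1 : `|G s (y s) - G s 0| <= a s * `|y s|.
  by rewrite -[y s in X in _ <= X]subr0; apply: h1; rewrite normr0.
have h2 := field_zero fG sT.
have h3 : a s * `|y s| <= a s * vweight s.
  have h := (ty.2 s sT); rewrite mul1r in h.
  exact: (ler_wpM2l (a0 sT) h).
have h4 : a s <= a s * vweight s by rewrite (ler_peMr (a0 sT) W1).
have := ler_normD (G s (y s) - G s 0) (G s 0); rewrite subrK.
move: h1 h2 h3 h4; move: (a s * vweight s) (a s * `|y s|) => p q.
lra.
Qed.

Let iaW : lintegrable `[0, T] (fun s => a s * vweight s).
Proof. exact: fweight_integrable. Qed.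

Let sub t : 0 <= t <= T -> `[0, t]%classic `<=` `[0, T]%classic.
Proof.
move=> /andP[_ tT] z /=; rewrite !in_itv/= => /andP[-> zt].
exact: le_trans zt tT.
Qed.

Lemma field_vintegrable y : tubeG y -> vintegrable `[0, T] (fun s => G s (y s)).
Proof.
move=> ty i; have [Ke Ke0 [Ke1 _]] := @ecoord_bound R E.
apply: (leb_le_integrable (leb_measurable_itv _) _ _
  (lintegrableZ (Ke * 2) (leb_measurable_itv _) iaW)).
  by apply: (field_meas fG); [case: ty|exact: tube_norm].
apply: leb_aeT => s /=; rewrite in_itv/= => sT.
rewrite (le_trans (Ke1 _ _))// -mulrA ler_wpM2l ?(ltW Ke0)//.
exact: field_norm.
Qed.

Lemma volterra_abs_continuous y : tubeG y -> abs_continuous 0 T (volterra G y).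
Proof.
move=> ty; apply: (@vint_abs_continuous _ _ _ _ (fun r => 2 * (a r * vweight r))).
- exact/cutoff_vintegrable/field_vintegrable.
- exact: lintegrableZ.
- by apply: leb_aeT => r; rewrite /= in_itv/= => rT; rewrite cutoff_in//; exact: field_norm.
Qed.

Lemma volterra_tube y : tubeG y -> tubeG (volterra G y).
Proof.
move=> ty; split; first exact/abs_continuous_within/volterra_abs_continuous.
move=> t tT; rewrite mul1r.
have iaWt : lintegrable `[0, t] (fun s => a s * vweight s).
  by apply: lintegrableS iaW; exact: sub.
apply: (@le_trans _ _ (vintK * \int[leb]_(s in `[0, t]) (2 * (a s * vweight s)))).
  apply: vint_norm_le => //.
  - move=> i; apply: lintegrableS (cutoff_vintegrable (field_vintegrable ty) i).
    exact: sub.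
  - exact: lintegrableZ.
  - move=> s /(sub tT); rewrite /= in_itv/= => sT.
    by rewrite cutoff_in//; exact: field_norm.
rewrite (RintegralZl _ (leb_measurable_itv _) iaWt) mulrA (mulrC vintK).
exact: (fweight_ineq T0 ia a0 K0 tT).
Qed.

Lemma volterra_contract y y' N : tubeG y -> tubeG y' -> 0 <= N ->
  (forall t, 0 <= t <= T -> `|y t - y' t| <= N * vweight t) ->
  forall t, 0 <= t <= T ->
    `|volterra G y t - volterra G y' t| <= N / 2 * vweight t.
Proof.
move=> ty ty' N0 yy' t tT.
have iaWt : lintegrable `[0, t] (fun s => a s * vweight s).
  by apply: lintegrableS iaW; exact: sub.
pose w s := cutoff T (fun s => G s (y s)) s - cutoff T (fun s => G s (y' s)) s.
have ic y1 : tubeG y1 -> vintegrable `[0, t] (cutoff T (fun s => G s (y1 s))).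
  move=> ty1 i; apply: lintegrableS (cutoff_vintegrable (field_vintegrable ty1) i).
  exact: sub.
have iw : vintegrable `[0, t] w := vintegrableB (leb_measurable_itv _) (ic y ty) (ic y' ty').
have -> : volterra G y t - volterra G y' t = vint `[0, t] w.
  exact/esym/(vintB (leb_measurable_itv _) (ic y ty) (ic y' ty')).
apply: (@le_trans _ _ (vintK * \int[leb]_(s in `[0, t]) (N * (a s * vweight s)))).
  apply: vint_norm_le => //; first exact: lintegrableZ.
  move=> s /(sub tT); rewrite /= in_itv/= => sT; rewrite /w !cutoff_in//.
  rewrite (le_trans (field_lip fG sT (tube_norm ty sT) (tube_norm ty' sT)))//.
  by rewrite mulrCA ler_wpM2l ?a0// yy'.
rewrite (RintegralZl _ (leb_measurable_itv _) iaWt).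
have := fweight_ineq T0 ia a0 K0 tT; rewrite -/vweight /K.
move: (\int[leb]_(s in `[0, t]) (a s * vweight s)) => I h.
have := ler_wpM2l N0 h; lra.
Qed.

Lemma volterra_solution : exists y, tubeG y /\ y = volterra G y.
Proof.
have [y [ty yF]] := @picard R E T 1 vweight_max vweight (volterra G) (ltW T0) ler01
  vweight_bounds volterra_tube volterra_contract.
(* [y] is a fixed point on [[0, T]] only. One more application makes the equation hold at every [t],
   because [volterra] sees [y] through the cutoff alone. *)
exists (volterra G y); split; first exact: volterra_tube.
apply/funext => t; apply: (f_equal (vint `[0, t])); apply/funext => s.
by rewrite /cutoff; case: ifP => //; rewrite in_itv/= => sT; rewrite (yF s sT).
Qed.

End Field.

Lemma volterra_stability G G' y y' k : volterra_field vweight_max G ->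
  tube T 1 vweight y -> tube T 1 vweight y' -> y = volterra G y ->
  y' = volterra G' y' -> 0 <= k ->
  (forall t, 0 <= t <= T -> `|volterra G y' t - volterra G' y' t| <= k) ->
  forall t, 0 <= t <= T -> `|y t - y' t| <= 2 * k * vweight t.
Proof.
move=> fG ty ty' yE y'E k0 GG'.
apply: (@picard_stability R E T 1 vweight_max vweight (volterra G) ler01
  vweight_bounds (volterra_contract fG)) => //.
  by move=> t _; rewrite -yE.
by move=> t tT; rewrite {2}y'E; exact: GG'.
Qed.

End Volterra.

(** * The linearised state equation *)

Section DominatedConvergence.
Context d (S : measurableType d) (R : realType) (mu : {measure set S -> \bar R}).

Lemma dominated_Rintegral (D : set S) (h_ : nat -> S -> R) (h k : S -> R) :
  measurable D -> (forall n, measurable_fun D (h_ n)) -> measurable_fun D h ->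
  {ae mu, forall t, D t -> h_ n t @[n --> \oo] --> h t} ->
  mu.-integrable D (EFin \o k) ->
  {ae mu, forall t, D t -> forall n, `|h_ n t| <= k t} ->
  \int[mu]_(t in D) `|h_ n t - h t| @[n --> \oo] --> (0 : R) /\
  \int[mu]_(t in D) h_ n t @[n --> \oo] --> \int[mu]_(t in D) h t.
Proof.
move=> mD mh_ mh hh ik hk.
have e1 n : measurable_fun D (fun t => (h_ n t)%:E) by exact/measurable_EFinP.
have e2 : measurable_fun D (fun t => (h t)%:E) by exact/measurable_EFinP.
have e3 : {ae mu, forall t, D t -> (h_ n t)%:E @[n --> \oo] --> (h t)%:E}.
  by apply: filterS hh => t ht /ht c; apply: cvg_EFin c; exact: nearW.
have e4 : {ae mu, forall t n, D t -> (`|(h_ n t)%:E| <= (k t)%:E)%E}.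
  by apply: filterS hk => t ht n /ht; rewrite lee_fin.
have [ih c1 c2] := @dominated_convergence _ S R mu D mD _ _ _ e1 e2 e3 ik e4.
split; first exact: (fine_cvg c1).
apply: fine_cvg; rewrite fineK; first exact: c2.
exact: integrable_fin_num.
Qed.

End DominatedConvergence.

Section Perturbation.
Context {R : realType} {E : normedVectType R}.
Implicit Types (w y : R -> E).

Hint Resolve leb_measurable_itv : core.

Lemma clin_scaleB (V W : normedModType R) (c : R) (A B : 'L(V, W)) v :
  (c *: (A - B)) v = c *: (A v - B v).
Proof. by []. Qed.

(** The bound [k n] is built from integrals of absolute values over all of [[0, T]], hence is
    uniform in [t]. *)
Lemma vint_dominated (T : R) (w_ : nat -> R -> E) w (b : R -> R) : 0 <= T ->
  (forall n, vintegrable `[0, T] (w_ n)) -> vintegrable `[0, T] w ->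
  lintegrable `[0, T] b ->
  (forall s, 0 <= s <= T -> w_ n s @[n --> \oo] --> w s) ->
  (forall n s, 0 <= s <= T -> `|w_ n s| <= b s) ->
  exists2 k : nat -> R, (forall n, 0 <= k n) /\ k n @[n --> \oo] --> 0 &
    forall n t, 0 <= t <= T ->
      `|vint `[0, t] (w_ n) - vint `[0, t] w| <= k n.
Proof.
move=> T0 iw_ iw ib ww wb; have [K K0 [K1 K2]] := @ecoord_bound R E.
have mT := leb_measurable_itv `[0, T].
pose k i n := \int[leb]_(t in `[0, T]) `|ecoord i (w_ n t) - ecoord i (w t)|.
have k0 i n : 0 <= k i n by apply: Rintegral_ge0 => t _; exact: normr_ge0.
have kcvg i : k i n @[n --> \oo] --> 0.
  have e1 n : lmeas `[0, T] (fun t => ecoord i (w_ n t)).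
    exact: (lintegrable_measurable (iw_ n i)).
  have e2 : lmeas `[0, T] (fun t => ecoord i (w t)).
    exact: (lintegrable_measurable (iw i)).
  have e3 : {ae leb, forall t : lebT R, `[0, T]%classic t ->
      ecoord i (w_ n t) @[n --> \oo] --> ecoord i (w t)}.
    apply: leb_aeT => t; rewrite /= in_itv/= => tT.
    exact: (continuous_cvg _ (@ecoord_continuous R E i _) (ww t tT)).
  have e4 : lintegrable `[0, T] (fun t => K * b t) := lintegrableZ K mT ib.
  have e5 : {ae leb, forall t : lebT R, `[0, T]%classic t ->
      forall n, `|ecoord i (w_ n t)| <= K * b t}.
    apply: leb_aeT => t; rewrite /= in_itv/= => tT n.
    rewrite (le_trans (K1 _ _))// ler_pM2l//.
    exact: wb.
  exact: (dominated_Rintegral mT e1 e2 e3 e4 e5).1.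
exists (fun n => K * \sum_i k i n).
  split=> [n|]; first by rewrite mulr_ge0 ?(ltW K0)// sumr_ge0.
  rewrite -[X in _ --> X](mulr0 K); apply: cvgM; first exact: cvg_cst.
  have h := @cvg_sumr R R^o _ _ _ k (fun=> 0) _ kcvg.
  by rewrite big1 // in h; exact: h.
move=> n t /andP[t0 tT].
have sub : `[0, t]%classic `<=` `[0, T]%classic.
  move=> z /=; rewrite !in_itv/= => /andP[-> zt].
  exact: le_trans zt tT.
have mt := leb_measurable_itv `[0, t].
have i1 : vintegrable `[0, t] (w_ n) by move=> i; exact: lintegrableS (iw_ n i).
have i2 : vintegrable `[0, t] w by move=> i; exact: lintegrableS (iw i).
have kS : 0 <= \sum_i k i n by rewrite sumr_ge0.
apply: K2 => // i; rewrite ecoordB !ecoord_vint -(RintegralB mt (i1 i) (i2 i)).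
apply: (@le_trans _ _ (k i n)); last first.
  by rewrite (bigD1 i)//= lerDl sumr_ge0.
have i3 := lintegrableB mT (iw_ n i) (iw i).
have i4 : lintegrable `[0, t] (fun s => ecoord i (w_ n s) - ecoord i (w s)).
  exact: lintegrableS i3.
apply: (le_trans (le_normr_Rintegral mt i4)).
have i5 : lintegrable `[0, T] (fun s => `|ecoord i (w_ n s) - ecoord i (w s)|).
  exact: (integrable_norm i3).
exact: (primitive_le i5 (fun _ _ => normr_ge0 _) t0 tT (lexx T)).
Qed.

Variables (T : R) (f : R -> E -> E) (g : R -> E -> 'L(E, E)) (x u k : R -> E).
Variable (N : R).
Hypothesis T0 : 0 < T.
Hypothesis cf : {within [set p : R * E | p.1 \in `[0, T]],
  continuous (fun p => f p.1 p.2)}.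
Hypothesis cg : {within [set p : R * E | p.1 \in `[0, T]],
  continuous (fun p => g p.1 p.2)}.
Hypothesis df : forall (t : R) (y : E), t \in `[0, T] -> differentiable (f t) y.
Hypothesis dg : forall (t : R) (y : E), t \in `[0, T] -> differentiable (g t) y.
Hypothesis cDf : {within [set p : R * E | p.1 \in `[0, T]],
  continuous (fun p => Df f p.1 p.2)}.
Hypothesis cDg : {within [set p : R * E | p.1 \in `[0, T]],
  continuous (fun p => Dg g p.1 p.2)}.
Hypothesis cx : {within `[0, T], continuous x}.
Hypothesis mu : lmeasurable 0 T u.
Hypothesis mk : lmeasurable 0 T k.
Hypothesis N0 : 0 <= N.
Hypothesis kN : forall t, 0 <= t <= T -> `|k t| <= N * (1 + `|u t|).

(** If [x] is driven by [u] and [x + e y] by [u + e k], then [y] satisfies y' = pert e s y; [lin] is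
    the limit as [e] tends to 0. *)
Definition pert (e : R) s z : E :=
  e^-1 *: (f s (x s + e *: z) - f s (x s)) +
  e^-1 *: (g s (x s + e *: z) (u s) - g s (x s) (u s)) +
  g s (x s + e *: z) (k s).

Definition lin s z : E := Df f s (x s) z + Dg g s (x s) z (u s) + g s (x s) (k s).

(** The condition [setT p.2] gives the domain the shape that the measurability lemma expects, for an
    unrestricted control. *)
Let moved (y : R -> E) (e : R) : {within `[0, T], continuous y} ->
  {within [set p : R * E | p.1 \in `[0, T] /\ setT p.2],
    continuous (fun p => (p.1, x p.1 + e *: y p.1))}.
Proof.
move=> cy; have cfst : {within [set p : R * E | p.1 \in `[0, T] /\ setT p.2],
    continuous (fun p : R * E => p.1)}.
  by apply: continuous_subspaceT => p; exact: cvg_fst.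
apply: within_pair => //.
apply: (@within_comp _ _ _ _ `[0, T]%classic (fun t => x t + e *: y t) fst) => //.
  by move=> p [].
move=> p; apply: cvgD; [exact: cx|].
by apply: cvgZl_tmp; exact: cy.
Qed.

Let movedF (W : normedModType R) (F : R -> E -> W) (y : R -> E) (e : R) :
  {within [set p : R * E | p.1 \in `[0, T]], continuous (fun p => F p.1 p.2)} ->
  {within `[0, T], continuous y} ->
  {within [set p : R * E | p.1 \in `[0, T] /\ setT p.2],
    continuous (fun p => F p.1 (x p.1 + e *: y p.1))}.
Proof.
move=> cF cy; have h (p : R * E) : [set p : R * E | p.1 \in `[0, T] /\ setT p.2] p ->
    [set p : R * E | p.1 \in `[0, T]] (p.1, x p.1 + e *: y p.1) by case.
exact: (within_comp (@moved y e cy) h cF).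
Qed.

Let csnd : {within [set p : R * E | p.1 \in `[0, T] /\ setT p.2],
    continuous (fun p : R * E => p.2)}.
Proof. by apply: continuous_subspaceT => p; exact: cvg_snd. Qed.

Let fixedF (W : normedModType R) (F : R -> E -> W) :
  {within [set p : R * E | p.1 \in `[0, T]], continuous (fun p => F p.1 p.2)} ->
  {within [set p : R * E | p.1 \in `[0, T] /\ setT p.2],
    continuous (fun p => F p.1 (x p.1))}.
Proof.
move=> cF.
have h (p : R * E) : [set p : R * E | p.1 \in `[0, T] /\ setT p.2] p ->
    [set p : R * E | p.1 \in `[0, T]] (p.1, x p.1) by case.
have cfst : {within [set p : R * E | p.1 \in `[0, T] /\ setT p.2],
    continuous (fun p : R * E => p.1)}.
  by apply: continuous_subspaceT => p; exact: cvg_fst.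
have cx1 : {within [set p : R * E | p.1 \in `[0, T] /\ setT p.2],
    continuous (fun p : R * E => x p.1)}.
  by apply: (@within_comp _ _ _ _ `[0, T]%classic x fst) => // p [].
exact: (within_comp (within_pair cfst cx1) h cF).
Qed.

Let coordm (F : R -> E -> E) (w : R -> E) i : lmeasurable 0 T w ->
  {within [set p : R * E | p.1 \in `[0, T] /\ setT p.2],
    continuous (fun p => F p.1 p.2)} ->
  lmeas `[0, T] (fun t => ecoord i (F t (w t))).
Proof.
move=> mw cF.
have ce : {within setT, continuous (@ecoord R E i)}.
  by apply: continuous_subspaceT; exact: ecoord_continuous.
have c1 := within_comp cF (fun _ _ => I) ce.
exact: (@caratheodory_measurable_ae R E T setT (fun t v => ecoord i (F t v)) w c1 mw
  (leb_aeT (fun _ _ => I))).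
Qed.

Lemma pert_measurable e y : {within `[0, T], continuous y} ->
  vmeas `[0, T] (fun s => pert e s (y s)).
Proof.
move=> cy i.
(* The field is split so that each part depends on a single control, [u] or [k], as the
   measurability lemma requires. *)
pose F1 t v := e^-1 *: (f t (x t + e *: y t) - f t (x t)) +
  e^-1 *: (g t (x t + e *: y t) v - g t (x t) v).
pose F2 t v := g t (x t + e *: y t) v.
have c1 : {within [set p : R * E | p.1 \in `[0, T] /\ setT p.2],
    continuous (fun p => F1 p.1 p.2)}.
  have h1 := @movedF _ _ y e cf cy; have h2 := fixedF cf.
  have h3 := within_clin_eval (@movedF _ _ y e cg cy) csnd.
  have h4 := within_clin_eval (fixedF cg) csnd.
  move=> p; apply: cvgD; apply: cvgZl_tmp; apply: cvgB.
  - exact: h1.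
  - exact: h2.
  - exact: h3.
  - exact: h4.
have c2 : {within [set p : R * E | p.1 \in `[0, T] /\ setT p.2],
    continuous (fun p => F2 p.1 p.2)}.
  exact: within_clin_eval (@movedF _ _ y e cg cy) csnd.
have -> : (fun s => ecoord i (pert e s (y s))) =
    (fun s => ecoord i (F1 s (u s)) + ecoord i (F2 s (k s))).
  by apply/funext => s; rewrite -ecoordD.
by apply: measurable_funD; exact: coordm.
Qed.

Lemma lin_measurable y : {within `[0, T], continuous y} ->
  vmeas `[0, T] (fun s => lin s (y s)).
Proof.
move=> cy i.
pose F1 t v := Df f t (x t) (y t) + Dg g t (x t) (y t) v.
pose F2 t v := g t (x t) v.
have cy1 : {within [set p : R * E | p.1 \in `[0, T] /\ setT p.2],
    continuous (fun p => y p.1)}.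
  apply: (@within_comp _ _ _ _ `[0, T]%classic y fst) => //.
    by apply: continuous_subspaceT => p; exact: cvg_fst.
  by move=> p [].
have c1 : {within [set p : R * E | p.1 \in `[0, T] /\ setT p.2],
    continuous (fun p => F1 p.1 p.2)}.
  have h1 := within_clin_eval (fixedF cDf) cy1.
  have h2 := within_clin_eval (within_clin_eval (fixedF cDg) cy1) csnd.
  by move=> p; apply: cvgD; [exact: h1|exact: h2].
have c2 : {within [set p : R * E | p.1 \in `[0, T] /\ setT p.2],
    continuous (fun p => F2 p.1 p.2)}.
  exact: within_clin_eval (fixedF cg) csnd.
have -> : (fun s => ecoord i (lin s (y s))) =
    (fun s => ecoord i (F1 s (u s)) + ecoord i (F2 s (k s))).
  by apply/funext => s; rewrite -ecoordD.
by apply: measurable_funD; exact: coordm.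
Qed.

Lemma pert_cvg (e_ : nat -> R) s z : 0 <= s <= T -> (forall n, 0 < e_ n) ->
  e_ n @[n --> \oo] --> 0 -> pert (e_ n) s z @[n --> \oo] --> lin s z.
Proof.
move=> sT e0 ecvg; have sT' : s \in `[0, T] by rewrite in_itv.
have zc : (fun _ : nat => z) n @[n --> \oo] --> z by exact: cvg_cst.
have h1 := differentiable_cvg (df (x s) sT') e0 ecvg zc.
have h2 : (e_ n)^-1 *: (g s (x s + e_ n *: z) (u s) - g s (x s) (u s)) @[n --> \oo]
    --> Dg g s (x s) z (u s).
  have uc : (fun _ : nat => u s) n @[n --> \oo] --> u s by exact: cvg_cst.
  have h := clin_eval_cvg _ (differentiable_cvg (dg (x s) sT') e0 ecvg zc) uc.
  exact: h.
have h3 : g s (x s + e_ n *: z) (k s) @[n --> \oo] --> g s (x s) (k s).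
  have gc : g s (x s + e_ n *: z) @[n --> \oo] --> g s (x s).
    have xc : x s + e_ n *: z @[n --> \oo] --> x s.
      rewrite -[X in _ --> X]addr0 -(scale0r z).
      by apply: cvgD; [exact: cvg_cst|exact: cvgZr_tmp].
    exact: (cvg_comp _ _ xc (differentiable_continuous (dg (x s) sT'))).
  have kc : (fun _ : nat => k s) n @[n --> \oo] --> k s by exact: cvg_cst.
  exact: (clin_eval_cvg _ gc kc).
exact: (cvgD (cvgD h1 h2) h3).
Qed.

End Perturbation.

Section Fields.
Context {R : realType} {E : normedVectType R}.

Lemma ler_norm3B (V : normedModType R) (p q w p' q' w' : V) (b1 b2 b3 : R) :
  `|p - p'| <= b1 -> `|q - q'| <= b2 -> `|w - w'| <= b3 ->
  `|(p + q + w) - (p' + q' + w')| <= b1 + b2 + b3.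
Proof.
move=> h1 h2 h3; rewrite !opprD addrACA (addrACA p).
by rewrite (le_trans (ler_normD _ _))// lerD// (le_trans (ler_normD _ _))// lerD.
Qed.

Lemma difference_quotient_le (V W : normedModType R) (p p' q : W) (z z' : V) (e L : R) :
  0 < e -> `|p - p'| <= L * `|e *: z - e *: z'| ->
  `|e^-1 *: (p - q) - e^-1 *: (p' - q)| <= L * `|z - z'|.
Proof.
move=> e0; rewrite -!scalerBr !normrZ normfV gtr0_norm// => h.
have -> : p - q - (p' - q) = p - p' by rewrite opprB addrA subrK.
by rewrite mulrC ler_pdivrMr// -mulrA [X in L * X]mulrC.
Qed.

(** One constant [C] for the quotients of [f] and [g], for [g k] and for the linearised field. The
    bound on [w], the size of the control variation, is what reduces everything to multiples of
    [1 + v]. *)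
Lemma field_arith (L1 L2 L3 L4 L5 L6 N v w e d : R) : 0 <= L1 -> 0 <= L2 ->
  0 <= L3 -> 0 <= L4 -> 0 <= L5 -> 0 <= L6 -> 0 <= N ->
  0 <= v -> 0 <= w -> w <= N * (1 + v) -> 0 <= e -> e <= 1 -> 0 <= d ->
  let C := L1 + L2 + L2 * N + L3 * N + L4 + L5 + L6 in
  [/\ L1 * d + L2 * v * d + L2 * w * (e * d) <= C * (1 + v) * d,
      L3 * w <= C * (1 + v),
      L4 * d + L5 * d * v <= C * (1 + v) * d & 0 <= C].
Proof.
move=> h1 h2 h3 h4 h5 h6 N0 v0 w0 wN e0 e1 d0 C.
have v1 : 0 <= 1 + v by rewrite addr_ge0.
have LN2 : 0 <= L2 * N by rewrite mulr_ge0.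
have LN3 : 0 <= L3 * N by rewrite mulr_ge0.
have vd : 0 <= v * d by rewrite mulr_ge0.
have C0 : 0 <= C by rewrite !addr_ge0.
have sub (L : R) : 0 <= L -> 0 <= C - L -> L * (1 + v) <= C * (1 + v).
  by move=> _; rewrite subr_ge0 => h; rewrite ler_wpM2r.
split => //.
- have a1 : L2 * w * (e * d) <= L2 * (N * (1 + v)) * d.
    apply: ler_pM; rewrite ?mulr_ge0//; first by rewrite ler_wpM2l.
    by rewrite ler_piMl.
  have a2 : L1 * d <= L1 * (1 + v) * d.
    by rewrite ler_wpM2r// ler_peMr// lerDl.
  have a3 : L2 * v * d <= L2 * (1 + v) * d.
    by rewrite ler_wpM2r// ler_wpM2l// lerDr.
  have a4 : (L1 + L2 + L2 * N) * (1 + v) * d <= C * (1 + v) * d.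
    by rewrite !ler_wpM2r// /C; lra.
  lra.
- apply: (@le_trans _ _ (L3 * N * (1 + v))); first by rewrite -mulrA ler_wpM2l.
  apply: sub => //; rewrite /C; lra.
- have a1 : L4 * d <= L4 * (1 + v) * d.
    by rewrite ler_wpM2r// ler_peMr// lerDl.
  have a2 : L5 * d * v <= L5 * (1 + v) * d.
    by rewrite -!mulrA ler_wpM2l// mulrC ler_wpM2r// lerDr.
  have a3 : (L4 + L5) * (1 + v) * d <= C * (1 + v) * d.
    by rewrite !ler_wpM2r// /C; lra.
  lra.
Qed.

End Fields.

(** * Existence and convergence of the quotients of trajectories *)

Section Variation.
Context {R : realType} {E : normedVectType R}.

Hint Resolve leb_measurable_itv : core.

Variables (T : R) (f : R -> E -> E) (g : R -> E -> 'L(E, E)) (x u k : R -> E).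
Variable (N : R).
Hypothesis T0 : 0 < T.
Hypothesis cf : {within [set p : R * E | p.1 \in `[0, T]],
  continuous (fun p => f p.1 p.2)}.
Hypothesis cg : {within [set p : R * E | p.1 \in `[0, T]],
  continuous (fun p => g p.1 p.2)}.
Hypothesis df : forall (t : R) (y : E), t \in `[0, T] -> differentiable (f t) y.
Hypothesis dg : forall (t : R) (y : E), t \in `[0, T] -> differentiable (g t) y.
Hypothesis cDf : {within [set p : R * E | p.1 \in `[0, T]],
  continuous (fun p => Df f p.1 p.2)}.
Hypothesis cDg : {within [set p : R * E | p.1 \in `[0, T]],
  continuous (fun p => Dg g p.1 p.2)}.
Hypothesis cx : {within `[0, T], continuous x}.
Hypothesis mu : lmeasurable 0 T u.
Hypothesis mk : lmeasurable 0 T k.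
Hypothesis N0 : 0 <= N.
Hypothesis kN : forall t, 0 <= t <= T -> `|k t| <= N * (1 + `|u t|).


Local Notation pert_xu := (pert f g x u k).
Local Notation lin_xu := (lin f g x u k).

(** [C] depends neither on [e] nor on [M]: its ingredients are constants of the tube of radius 1,
    and [e * M <= 1] keeps [x + e z] inside. Hence there is no circularity when [M] is later the
    maximum of the weight built from [C]. *)
Lemma pert_field : exists2 C : R, 0 <= C &
  (forall e M, 0 < e -> e <= 1 -> e * M <= 1 ->
    volterra_field T (fun t => C * (1 + `|u t|)) M (pert_xu e)) /\
  (forall M, volterra_field T (fun t => C * (1 + `|u t|)) M lin_xu).
Proof.
have [L1 L10 L1P] := tube_lipschitz 1 cx df cDf.
have [L2 L20 L2P] := tube_lipschitz_clin 1 cx dg cDg.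
have [L3 L30 L3P] := tube_bounded 1 cx cg.
have [L4 L40 L4P] := tube_bounded 1 cx cDf.
have [L5 L50 L5P] := tube_bounded 1 cx cDg.
have z1 : `|0 : E| <= 1 by rewrite normr0.
have g0 s : 0 <= s <= T -> `|g s (x s) (k s)| <= L3 * `|k s|.
  move=> sT; apply: (le_trans (opnormP _ _)); rewrite ler_wpM2r//.
  by have := L3P s 0 sT z1; rewrite addr0.
have bnd s (e d : R) (sT : 0 <= s <= T) (e0 : 0 <= e) (e1 : e <= 1) (d0 : 0 <= d) :=
  field_arith (ltW L10) (ltW L20) (ltW L30) (ltW L40) (ltW L50) (lexx 0) N0
    (normr_ge0 (u s)) (normr_ge0 (k s)) (kN sT) e0 e1 d0.
exists (L1 + L2 + L2 * N + L3 * N + L4 + L5 + 0).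
  have T00 : (0 : R) <= 0 <= T by apply/andP; split; [exact: lexx|exact: ltW].
  by have [] := bnd 0 0 0 T00 (lexx 0) ler01 (lexx 0).
split=> [e M e0 e1 eM|M]; split=> [s z z' sT zM z'M|s sT|y cy yM].
- have small (w : E) : `|w| <= M -> `|e *: w| <= 1.
    move=> wM; rewrite normrZ gtr0_norm//.
    by apply: le_trans eM; rewrite ler_wpM2l// ltW.
  have [b1 _ _ _] := bnd s e `|z - z'| sT (ltW e0) e1 (normr_ge0 _).
  apply: le_trans b1; apply: ler_norm3B.
  + apply: difference_quotient_le => //; apply: L1P => //; exact: small.
  + apply: difference_quotient_le => //; apply: L2P => //; exact: small.
  + have := L2P s (e *: z') (e *: z) (k s) sT (small _ z'M) (small _ zM).
    by rewrite -scalerBr normrZ (gtr0_norm e0).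
- have [_ b2 _ _] := bnd s e 0 sT (ltW e0) e1 (lexx 0).
  apply: le_trans b2; rewrite /pert scaler0 addr0 !subrr !scaler0 !add0r.
  exact: g0.
- exact: pert_measurable.
- have [_ _ b3 _] := bnd s 0 `|z - z'| sT (lexx 0) ler01 (normr_ge0 _).
  apply: le_trans b3.
  rewrite /lin opprD addrACA subrr addr0 opprD addrACA -!linearB.
  rewrite (le_trans (ler_normD _ _))//; apply: lerD.
    rewrite (le_trans (opnormP _ _))// ler_wpM2r//.
    by have := L4P s 0 sT z1; rewrite addr0.
  have -> : Dg g s (x s) z (u s) - Dg g s (x s) z' (u s) = Dg g s (x s) (z - z') (u s).
    by rewrite linearB.
  rewrite (le_trans (opnormP _ _))// ler_wpM2r//.
  rewrite (le_trans (opnormP _ _))// ler_wpM2r//.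
  by have := L5P s 0 sT z1; rewrite addr0.
- have [_ b2 _ _] := bnd s 0 0 sT (lexx 0) ler01 (lexx 0).
  apply: le_trans b2; rewrite /lin !linear0.
  have -> : (0 : 'L(E, E)) (u s) = 0 by [].
  rewrite !add0r; exact: g0.
- exact: lin_measurable.
Qed.


Definition volterra_sol (M : R) (b : R -> R) (G : R -> E -> E) (y : R -> E) :=
  [/\ y = volterra T G y, vintegrable `[0, T] (fun s => G s (y s)),
    forall s, 0 <= s <= T -> `|G s (y s)| <= b s,
    forall s, 0 <= s <= T -> `|y s| <= M & {within `[0, T], continuous y}].

(** [h] solves the perturbed equation up to an error that compares [pert] and [lin] along the one
    curve [h]. Dominated convergence makes this error small uniformly in time, and stability of the
    fixed point turns it into uniform convergence of [y_ n]. *)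
Lemma state_variation (rho : R) : 0 < rho -> lintegrable `[0, T] (fun t => `|u t|) ->
  exists M b (e_ : nat -> R) y_ h k_,
    [/\ lintegrable `[0, T] b /\ (forall s, 0 <= s <= T -> 0 <= b s),
      (forall n, [/\ 0 < e_ n, e_ n <= 1 & e_ n * M <= rho]) /\
        e_ n @[n --> \oo] --> (0 : R),
      forall n, volterra_sol M b (pert_xu (e_ n)) (y_ n),
      volterra_sol M b lin_xu h &
      k_ n @[n --> \oo] --> (0 : R) /\
      forall n s, 0 <= s <= T -> `|y_ n s - h s| <= k_ n].
Proof.
move=> rho0 iu; have [C C0 [fp fl]] := pert_field.
pose a t := C * (1 + `|u t|).
have mT := leb_measurable_itv `[0, T].
have i1 : lintegrable `[0, T] (fun _ : R => 1 : R).
  have m1 : lmeas `[0, T] (fun _ : R => 1 : R) by exact: measurable_cst.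
  by apply: (leb_bounded_integrable m1 (M := 1)) => t _; rewrite normr1.
have ia : lintegrable `[0, T] a := lintegrableZ C mT (lintegrableD mT i1 iu).
have a0 t : 0 <= t <= T -> 0 <= a t by move=> _; rewrite mulr_ge0// addr_ge0.
pose M := vweight_max (E := E) T a.
have M1 : 1 <= M.
  have T00 : (0 : R) <= 0 <= T by apply/andP; split; [exact: lexx|exact: ltW].
  have /andP[h1 h2] := vweight_bounds (E := E) T0 ia a0 T00.
  exact: le_trans h1 h2.
have M0 : 0 < M := lt_le_trans ltr01 M1.
pose m := Num.min 1 rho.
have m0 : 0 < m by rewrite lt_min ltr01.
have [m1 mr] : m <= 1 /\ m <= rho by rewrite /m !ge_min !lexx orbT.
(* This keeps [e_ n * M] below 1, for the tube of the Lipschitz bounds, and below [rho], for that of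
   the growth condition. *)
pose e_ n := m * (M^-1 * n.+1%:R^-1).
have e0 n : 0 < e_ n by rewrite !mulr_gt0 ?invr_gt0.
have n1 n : n.+1%:R^-1 <= 1 :> R by rewrite invf_le1// ler1n.
have eM n : e_ n * M <= m.
  have -> : e_ n * M = m * n.+1%:R^-1 * (M^-1 * M) by rewrite /e_; ring.
  by rewrite mulVf ?gt_eqF// mulr1 ler_piMr// ltW.
have e1 n : e_ n <= 1.
  by apply: le_trans m1; apply: le_trans (eM n); rewrite ler_peMr// ltW.
have ecvg : e_ n @[n --> \oo] --> (0 : R).
  rewrite -[X in _ --> X](mulr0 m) -[X in _ * X](mulr0 M^-1).
  apply: cvgM; first exact: cvg_cst.
  apply: cvgM; first exact: cvg_cst.
  exact: cvg_harmonic.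
have fpn n : volterra_field T a (vweight_max (E := E) T a) (pert_xu (e_ n)).
  exact: (fp _ _ (e0 n) (e1 n) (le_trans (eM n) m1)).
have [y_ y_P] := choice (fun n => volterra_solution T0 ia a0 (fpn n)).
have [h [th hE]] := volterra_solution T0 ia a0 (fl (vweight_max (E := E) T a)).
(* A bound common to all the fields, so that its primitive governs the increments of every [y_ n]
   and of [h]. *)
pose b s := 2 * (a s * vweight (E := E) a s).
have b0 s : 0 <= s <= T -> 0 <= b s.
  by move=> sT; exact: (mulr_ge0 (ler0n _ 2) (mulr_ge0 (a0 s sT) (expR_ge0 _))).
have iaW : lintegrable `[0, T] (fun s => a s * vweight (E := E) a s).
  by apply: fweight_integrable => //; rewrite mulr_ge0// ltW// vintK_gt0.
have ib : lintegrable `[0, T] b := lintegrableZ 2 mT iaW.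
have sol G y : volterra_field T a (vweight_max (E := E) T a) G ->
    tube T 1 (vweight (E := E) a) y -> y = volterra T G y -> volterra_sol M b G y.
  move=> fG ty yE; split=> [//||s sT|s sT|].
  - exact: (field_vintegrable T0 ia a0 fG ty).
  - exact: (field_norm T0 ia a0 fG ty sT).
  - exact: (tube_norm T0 ia a0 ty sT).
  - by case: ty.
have fl' := fl (vweight_max (E := E) T a).
have ipn n : vintegrable `[0, T] (cutoff T (fun s => pert_xu (e_ n) s (h s))).
  exact: (cutoff_vintegrable (field_vintegrable T0 ia a0 (fpn n) th)).
have il : vintegrable `[0, T] (cutoff T (fun s => lin_xu s (h s))).
  exact: (cutoff_vintegrable (field_vintegrable T0 ia a0 fl' th)).
have pc s : 0 <= s <= T ->
    cutoff T (fun s => pert_xu (e_ n) s (h s)) s @[n --> \oo] --> cutoff T (fun s => lin_xu s (h s)) s.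
  move=> sT; rewrite cutoff_in//; under eq_cvg do rewrite cutoff_in//.
  exact: (pert_cvg df dg sT e0 ecvg).
have pb n s : 0 <= s <= T -> `|cutoff T (fun s => pert_xu (e_ n) s (h s)) s| <= b s.
  by move=> sT; rewrite cutoff_in//; exact: (field_norm T0 ia a0 (fpn n) th sT).
have ler0n2 : 0 <= 2 :> R by [].
have [k_ [k_0 k_cvg] k_P] := vint_dominated (ltW T0) ipn il ib pc pb.
exists M, b, e_, y_, h, (fun n => 2 * k_ n * M); split.
- by split.
- by split=> // n; split=> //; exact: le_trans (eM n) mr.
- by move=> n; have [ty yE] := y_P n; exact: sol (fpn n) ty yE.
- exact: sol fl' th hE.
split=> [|n s sT].
  rewrite -[X in _ --> X](mul0r M) -[X in X * _](mulr0 2).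
  by apply: cvgM; [apply: cvgM => //; exact: cvg_cst|exact: cvg_cst].
have [ty yE] := y_P n.
have h1 := volterra_stability T0 ia a0 (fpn n) ty th yE hE (k_0 n) (k_P n) sT.
apply: (le_trans h1); have k2 : 0 <= 2 * k_ n := mulr_ge0 ler0n2 (k_0 n).
have /andP[_ hW] := vweight_bounds (E := E) T0 ia a0 sT.
exact: (ler_wpM2l k2 hW).
Qed.

End Variation.

(** * Spike variations of the control *)

Section PerturbedControl.
Context {R : realType} {E : normedVectType R}.

Hint Resolve leb_measurable_itv : core.

Local Notation borelE := (g_sigma_algebraType (@open E)).

Lemma lmeasurable_comp (a b : R) (h : E -> E) (u : R -> E) : continuous h ->
  lmeasurable a b u -> lmeasurable a b (h \o u).
Proof.
move=> ch mu.
have mh : measurable_fun setT (h : borelE -> borelE).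
  apply: (@measurability _ _ borelE borelE setT h (@open E)) => //.
  move=> _ [A oA <-]; rewrite setTI; apply: measurable_open.
  by apply: open_comp => // z _; exact: ch.
exact: (measurableT_comp mh mu).
Qed.

Lemma leb_measurable_patch d (Y : measurableType d) (D S : set R) (v w : R -> Y) :
  measurable (S : set (lebT R)) -> measurable_fun (D : set (lebT R)) (v : lebT R -> Y) ->
  measurable_fun (D : set (lebT R)) (w : lebT R -> Y) ->
  measurable_fun (D : set (lebT R)) ((fun t => if t \in S then v t else w t) : lebT R -> Y).
Proof.
move=> mS mv mw mD B mB.
have mB1 := mv mD B mB; have mB2 := mw mD B mB.
rewrite (_ : _ `&` _ = ((D `&` v @^-1` B) `&` S) `|` ((D `&` w @^-1` B) `\` S)).
  apply: (@measurableU _ (lebT R)).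
    exact: (@measurableI _ (lebT R)).
  exact: (@measurableD _ (lebT R)).
apply/seteqP; split=> t /=.
  move=> [tT]; case: ifPn; first by rewrite inE; left.
  by rewrite notin_setE; right.
move=> [[[tT Bt] St]|[[tT Bt] nS]]; split=> //.
  by rewrite ifT// inE.
by rewrite ifF//; apply/negbTE; rewrite notin_setE.
Qed.

Definition spike (S : set R) (v0 : E) (u : R -> E) (t : R) : E :=
  if t \in S then v0 - u t else 0.

Lemma spike_lmeasurable T S v0 u : measurable (S : set (lebT R)) ->
  lmeasurable 0 T u -> lmeasurable 0 T (spike S v0 u).
Proof.
move=> mS mu; apply: (leb_measurable_patch mS); last exact: measurable_cst.
  apply: (@lmeasurable_comp _ _ (fun z => v0 - z)) => //.
  by move=> z; apply: cvgB; [exact: cvg_cst|exact: cvg_id].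
Qed.

Lemma spike_norm S v0 u t : `|spike S v0 u t| <= (1 + `|v0|) * (1 + `|u t|).
Proof.
rewrite /spike; case: ifP => _; last by rewrite normr0 mulr_ge0// addr_ge0.
rewrite (le_trans (ler_normB _ _))// mulrDl mul1r mulrDr mulr1 -addrA.
have : 0 <= `|v0| * `|u t| by rewrite mulr_ge0.
lra.
Qed.

Lemma spike_control T S v0 u e : measurable (S : set (lebT R)) ->
  lmeasurable 0 T u -> lmeasurable 0 T (fun t => u t + e *: spike S v0 u t).
Proof.
move=> mS mu.
rewrite (_ : (fun t => _) = fun t => if t \in S then u t + e *: (v0 - u t) else u t).
  apply: (leb_measurable_patch mS _ mu).
  apply: (@lmeasurable_comp _ _ (fun z => z + e *: (v0 - z))) => // z.
  apply: cvgD; first exact: cvg_id.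
  by apply: cvgZl_tmp; apply: cvgB; [exact: cvg_cst|exact: cvg_id].
apply/funext => t; rewrite /spike; case: ifP => //.
by rewrite scaler0 addr0.
Qed.

Lemma conv_segment (V : lmodType R) (v w : V) (t : {i01 R}) :
  conv t (w : convex_lmodType V) (v : convex_lmodType V) = v + t%:num *: (w - v).
Proof.
have -> : conv t (w : convex_lmodType V) (v : convex_lmodType V) =
  t%:num *: w + (1 - t%:num) *: v by [].
by rewrite scalerBl scale1r scalerBr addrCA.
Qed.

Lemma convex_set_segment (U : set E) (v w : E) e : convex_set U -> U v -> U w ->
  0 <= e -> e <= 1 -> U (v + e *: (w - v)).
Proof.
move=> cU Uv Uw e0 e1.
have Uv' : v \in U by rewrite inE.
have Uw' : w \in U by rewrite inE.
have := cU w v (Itv01 e0 e1) Uw' Uv'.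
by rewrite conv_segment inE.
Qed.

Lemma convex_function_segment (U : set E) (h : E -> R) (v w : E) e :
  convex_function U h -> U v -> U w -> 0 <= e -> e <= 1 ->
  h (v + e *: (w - v)) <= h v + e * (h w - h v).
Proof.
move=> ch Uv Uw e0 e1.
have Uv' : v \in U by rewrite inE.
have Uw' : w \in U by rewrite inE.
have := ch (Itv01 e0 e1) w v Uw' Uv'.
rewrite conv_segment => h1; apply: (le_trans h1).
have -> : h v + e * (h w - h v) = e * h w + (1 - e) * h v by ring.
exact: lexx.
Qed.

End PerturbedControl.

Section PerturbedProcess.
Context {R : realType} {E : normedVectType R}.

Hint Resolve leb_measurable_itv : core.

Lemma volterra_sol_abs_continuous T M b (G : R -> E -> E) y :
  lintegrable `[0, T] b -> volterra_sol T M b G y -> abs_continuous 0 T y.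
Proof.
move=> ib [yE iG Gb _ _]; rewrite yE.
apply: (@vint_abs_continuous _ _ _ _ b (cutoff_vintegrable iG) ib).
apply: leb_aeT => t; rewrite /= in_itv/= => tT; rewrite cutoff_in//.
exact: Gb.
Qed.

Lemma volterra_sol0 T M b (G : R -> E -> E) y : 0 <= T ->
  volterra_sol T M b G y -> y 0 = 0.
Proof.
move=> T0 [yE iG _ _ _]; rewrite yE /volterra /vint big1// => i _.
by rewrite (Rintegral_at0 T0 (cutoff_vintegrable iG i)) scale0r.
Qed.

Lemma volterra_sol_derive T M b (G : R -> E -> E) y : volterra_sol T M b G y ->
  {ae leb, forall t : lebT R, 0 < t -> t < T ->
    is_derive (t : R) (1 : R) y (G t (y t))}.
Proof.
move=> [yE iG _ _ _]; apply: (leb_aeS (vint_derive iG)) => t ht t0 tT.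
by have := ht t0 tT; rewrite -[X in is_derive _ _ X _]/(volterra T G y) -yE.
Qed.

Lemma leb_ae_neq (a : R) : {ae leb, forall t : lebT R, t != a}.
Proof.
exists [set a]; split.
- by rewrite -set_itv1; exact: leb_measurable_itv.
- by rewrite -set_itv1 [LHS](lebesgue_measure_itv `[a, a])/= ltxx.
- by move=> t /= /negP; rewrite negbK => /eqP.
Qed.

Lemma perturbed_process T xi f g (x u k : R -> E) e M b y :
  0 < T -> 0 < e -> lintegrable `[0, T] b ->
  volterra_sol T M b (pert f g x u k e) y ->
  solves_state_eq xi f g T x u ->
  solves_state_eq xi f g T (fun t => x t + e *: y t) (fun t => u t + e *: k t).
Proof.
move=> T0 e0 ib ysol [ax x0 dx]; split.
- apply: abs_continuousD => //; apply: abs_continuousZ.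
  exact: volterra_sol_abs_continuous ib ysol.
- by rewrite (volterra_sol0 (ltW T0) ysol) scaler0 addr0.
(* The derivative of [y] is known in the open interval; the two end points are discarded as null
   sets. *)
have hae := leb_aeI (leb_aeI dx (volterra_sol_derive ysol)) (leb_aeI (leb_ae_neq 0) (leb_ae_neq T)).
apply: (leb_aeS hae) => t [[dxt dyt] [t0 tT]]; rewrite in_itv/= => /andP[t0' tT'].
have t00 : 0 < t by rewrite lt_neqAle eq_sym t0.
have tTT : t < T by rewrite lt_neqAle tT.
have dxt' := dxt; rewrite in_itv/= t0' tT' in dxt'.
have hx := dxt' isT; have hy := dyt t00 tTT.
have h := is_deriveD hx (is_deriveZ e hy).
apply: (is_derive_eq h).
rewrite /pert !scalerDr !scalerA divff ?gt_eqF// !scale1r linearD linearZ.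
have id (a1 b1 c1 d1 m : E) : a1 + b1 + ((c1 - a1) + (d1 - b1) + m) = c1 + (d1 + m).
  by rewrite (addrACA c1) -opprD addrA (addrC (a1 + b1)) subrK addrA.
exact: id.
Qed.

End PerturbedProcess.

(** * Variation of the observation term *)

Section HolderOnTubes.
Context {R : realType}.

Lemma powR_exponent_le (a b W z : R) : 0 < a -> a <= b -> 0 <= z -> z <= W ->
  z `^ b <= W `^ (b - a) * z `^ a.
Proof.
move=> a0 ab z0 zW; have [->|zn0] := eqVneq z 0.
  by rewrite !powR0 ?mulr0// gt_eqF// (lt_le_trans a0).
have -> : z `^ b = z `^ (b - a) * z `^ a.
  by rewrite -powRD ?subrK//; rewrite zn0 implybT.
by rewrite ler_wpM2r ?powR_ge0// ge0_ler_powR ?nnegrE ?subr_ge0// (le_trans z0).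
Qed.

Lemma locally_holder_ball (E : normedVectType R) (F : normedModType R) (T kap M : R)
    (h : R -> E -> F) : 0 < kap ->
  locally_holder_on [set p : R * E | p.1 \in `[0, T]] kap h ->
  exists2 K, 0 <= K &
    (forall t y, 0 <= t <= T -> `|y| <= M -> `|h t y| <= K) /\
    holder_on [set p : R * E | p.1 \in `[0, T] /\ `|p.2| <= M] kap K h.
Proof.
move=> kap0 lh; pose D : set (R * E) := `[0, T]%classic `*` [set z : E | `|z| <= M].
have cD : compact D.
  by apply: compact_setX; [exact: segment_compact|exact: findim_ball_compact].
have DA p : D p -> [set p : R * E | p.1 \in `[0, T]] p by case.
(* Near each point one constant serves at all scales below some 1/(n+1); compactness
   makes n uniform, and pairs further apart are covered by the bound on |h|. *)
pose P n (p : R * E) := D p -> `|h p.1 p.2| <= n%:R /\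
  forall q, D q -> `|p - q| < n.+1%:R^-1 ->
    `|h p.1 p.2 - h q.1 q.2| <=
       n%:R * (`|p.1 - q.1| `^ kap + `|p.2 - q.2| `^ kap).
have nP : \forall n \near \oo, D `<=` P n.
  move/compact_near_coveringP : cD; apply.
  move=> p Dp; have [B /nbhs_normP[r /= r0 rB] [K hK]] := lh p (DA p Dp).
  have r2 : 0 < r / 2 by rewrite divr_gt0.
  pose N := Num.max K (`|h p.1 p.2| + `|K| * (r `^ kap + r `^ kap)).
  exists (ball p (r / 2), [set n | n.+1%:R^-1 < r / 2 /\ N <= n%:R]).
    split; first exact: nbhsx_ballx.
    apply: filterI; first exact: (near_infty_natSinv_lt (PosNum r2)).
    exact: nbhs_infty_ger.
  move=> [p' n] /= [pp' [nr Nn]] Dp'; rewrite -ball_normE /= in pp'.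
  have rr : r / 2 < r by rewrite ltr_pdivrMr// ltr_pMr// ltr1n.
  have pr : `|p - p'| < r := lt_trans pp' rr.
  have Bp' : B p' by apply: rB.
  have Bp : B p by apply: rB; rewrite /= subrr normr0.
  have h1 : `|p'.1 - p.1| <= r /\ `|p'.2 - p.2| <= r.
    have : `|p' - p| < r by rewrite distrC.
    by rewrite prod_normE /= gt_max => /andP[/ltW -> /ltW ->].
  split.
    apply: le_trans Nn; rewrite /N le_max; apply/orP; right.
    have := hK p' p (conj (DA _ Dp') Bp') (conj (DA _ Dp) Bp) => h2.
    rewrite -[h p'.1 p'.2](subrK (h p.1 p.2)) addrC (le_trans (ler_normD _ _))// lerD2l.
    apply: (le_trans h2); apply: (le_trans (ler_norm _)).
    rewrite normrM ler_wpM2l// ger0_norm ?addr_ge0 ?powR_ge0//.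
    by apply: lerD; apply: ge0_ler_powR; rewrite ?nnegrE ?(ltW kap0) ?(ltW r0)//; case: h1.
  move=> q Dq pq.
  have Bq : B q.
    apply: rB => /=; rewrite -(subrK p' p) -addrA (le_lt_trans (ler_normD _ _))//.
    by rewrite (splitr r) ltrD// (lt_trans pq).
  apply: (le_trans (hK p' q (conj (DA _ Dp') Bp') (conj (DA _ Dq) Bq))).
  rewrite ler_wpM2r ?addr_ge0 ?powR_ge0//.
  by apply: le_trans Nn; rewrite /N le_max lexx.
have [n _ /(_ n (leqnn n)) Pn] := nP.
pose dl : R := n.+1%:R^-1.
have dl0 : 0 < dl by rewrite invr_gt0.
have dlk : 0 < dl `^ kap by rewrite powR_gt0.
exists (n%:R + 2 * n%:R / dl `^ kap).
  by rewrite addr_ge0// divr_ge0 ?(ltW dlk)// mulr_ge0.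
have bnd p : D p -> `|h p.1 p.2| <= n%:R by move=> Dp; case: (Pn p Dp Dp).
have X0 : 0 <= 2 * n%:R / dl `^ kap by rewrite divr_ge0 ?(ltW dlk)// mulr_ge0.
split=> [t y tT yM|p q Dp Dq].
  have Dty : D (t, y) by split => //=; rewrite in_itv.
  by apply: (le_trans (bnd (t, y) Dty)); rewrite lerDl.
have S0 : 0 <= `|p.1 - q.1| `^ kap + `|p.2 - q.2| `^ kap by rewrite addr_ge0 ?powR_ge0.
have Dp' : D p by case: Dp.
have Dq' : D q by case: Dq.
have [pq|pq] := ltP `|p - q| dl.
  have [_ /(_ q Dq' pq) h1] := Pn p Dp' Dp'.
  by apply: (le_trans h1); rewrite ler_wpM2r// lerDl.
apply: (@le_trans _ _ (2 * n%:R)).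
  apply: (le_trans (ler_normB _ _)); have := bnd p Dp'; have := bnd q Dq'.
  by lra.
apply: (@le_trans _ _ (2 * n%:R / dl `^ kap *
  (`|p.1 - q.1| `^ kap + `|p.2 - q.2| `^ kap))); last first.
  by rewrite ler_wpM2r// lerDr.
rewrite -mulrA ler_peMr ?mulr_ge0// mulrC ler_pdivlMr// mul1r.
move: pq; rewrite prod_normE /= le_max => /orP[] h1.
  apply: (@le_trans _ _ (`|p.1 - q.1| `^ kap)); last by rewrite lerDl powR_ge0.
  by apply: ge0_ler_powR; rewrite ?nnegrE ?(ltW kap0) ?(ltW dl0).
apply: (@le_trans _ _ (`|p.2 - q.2| `^ kap)); last by rewrite lerDr powR_ge0.
by apply: ge0_ler_powR; rewrite ?nnegrE ?(ltW kap0) ?(ltW dl0).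
Qed.

End HolderOnTubes.

Section YoungLinearity.
Context {R : realType} {V W : normedModType R}.

Lemma is_young_integralZB (a b c : R) (X X' : R -> 'L(V, W)) (y : R -> V) l l' :
  is_young_integral a b X y l -> is_young_integral a b X' y l' ->
  is_young_integral a b (fun t => c *: (X t - X' t)) y (c *: (l - l')).
Proof.
move=> yl yl' e e0.
have c0 : 0 < `|c| + 1 by rewrite ltr_wpDl.
have e2 : 0 < e / 2 / (`|c| + 1) by rewrite !divr_gt0.
have [d d0 dP] := yl _ e2; have [d' d'0 dP'] := yl' _ e2.
exists (Num.min d d') => [|s tau ps st]; first by rewrite lt_min d0.
have h1 : `|\sum_(i < size s) X (tau i) (y (nth b s i) - y (nth b (a :: s) i)) - l|
    < e / 2 / (`|c| + 1).
  by apply: dP => // i si; have [] := st i si; rewrite lt_min => /andP[].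
have h2 : `|\sum_(i < size s) X' (tau i) (y (nth b s i) - y (nth b (a :: s) i)) - l'|
    < e / 2 / (`|c| + 1).
  by apply: dP' => // i si; have [] := st i si; rewrite lt_min => /andP[].
have -> : \sum_(i < size s) (c *: (X (tau i) - X' (tau i)))
      (y (nth b s i) - y (nth b (a :: s) i)) - c *: (l - l') =
    c *: ((\sum_(i < size s) X (tau i) (y (nth b s i) - y (nth b (a :: s) i)) - l) -
      (\sum_(i < size s) X' (tau i) (y (nth b s i) - y (nth b (a :: s) i)) - l')).
  under eq_bigr do rewrite clin_scaleB.
  rewrite -scaler_sumr sumrB -scalerBr; congr (_ *: _).
  by rewrite !opprD !opprK addrACA.
rewrite normrZ (@le_lt_trans _ _ (`|c| * (e / (`|c| + 1))))//.
  rewrite ler_wpM2l// (le_trans (ler_normB _ _))//.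
  move: h1 h2; rewrite -mulrA mulrC -mulrA (mulrC _ e).
  move: (e / _) (`|_ - l|) (`|_ - l'|) => z p q; lra.
by rewrite mulrCA gtr_pMr// ltr_pdivrMr// mul1r ltrDl.
Qed.

End YoungLinearity.

Section MeanValueCurve.
Context {R : realType}.

Lemma mean_value_curve (F D : R -> R^o) (K : R) :
  (forall t : R, 0 <= t <= 1 -> is_derive t (1 : R) F (D t) /\ `|D t| <= K) ->
  `|F 1 - F 0| <= K.
Proof.
move=> dF; have c1 : {within `[0, 1], continuous F}.
  apply: derivable_within_continuous => t; rewrite in_itv/= => t01.
  by have [[]] := dF t t01.
have dF' (t : R) : t \in `]0, 1[ -> is_derive t (1 : R) F (D t).
  by rewrite in_itv/= => /andP[t0 t1]; apply: (dF _ _).1; rewrite !ltW.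
have [c c01] := MVT ltr01 dF' c1.
rewrite subr0 mulr1 => ->.
by move: c01; rewrite in_itv/= => /andP[/ltW c0 /ltW c1']; apply: (dF c _).2; rewrite c0.
Qed.

Lemma is_derive_clin_eval (V W : normedModType R) (F : R -> 'L(V, W)) (t : R)
    (B : 'L(V, W)) (v : V) : is_derive t (1 : R) F B ->
  is_derive t (1 : R) (fun s => F s v) (B v).
Proof.
move=> /is_derive_cvgP h; apply/is_derive_cvgP.
have vc : (fun _ : R => v) r @[r --> (0 : R)^'] --> v by exact: cvg_cst.
exact: (clin_eval_cvg _ h vc).
Qed.

End MeanValueCurve.

Lemma young_integralP (R : realType) (V W : normedModType R) (a b : R)
    (X : R -> 'L(V, W)) (y : R -> V) : young_integrable a b X y ->
  is_young_integral a b X y (young_integral a b X y).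
Proof. by case=> l hl; exact: getI hl. Qed.

Lemma clin_pairB (R : realType) (V W : normedModType R) (A B : 'L(V, W)) v v' :
  A v - B v' = (A - B) v + B (v - v').
Proof. by rewrite linearB addrA -[(A - B) v]/(A v - B v) subrK. Qed.

(** * Difference quotients of the observation term *)

Section ObservationCalculus.
Context {R : realType} {E : normedVectType R} {d : nat}.
Variables (T kap iota : R) (w : R -> R -> R).
Variables (psi : R -> E -> 'L('rV[R]_d, R^o)) (eta : R -> 'rV[R]_d).
Hypothesis T0 : 0 < T.
Hypothesis cw : control T w.
Hypothesis kap0 : 0 < kap.
Hypothesis kap1 : kap <= 1.
Hypothesis iota0 : 0 < iota.
Hypothesis th1 : 1 < kap + iota.
Hypothesis tw : forall s t, 0 <= s -> s <= t -> t <= T -> t - s <= w s t.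
Hypothesis etaw : forall s t, 0 <= s -> s <= t -> t <= T ->
  `|eta t - eta s| <= w s t `^ iota.

Local Notation W := (w 0 T).

Let w_bounds s t : 0 <= s -> s <= t -> t <= T -> 0 <= w s t <= W.
Proof.
move=> s0 st tT; rewrite (control_ge0 cw s0 st tT) /=.
exact: (control_le cw (lexx 0) s0 st tT (lexx T)).
Qed.

Let w_exponent k z s t : 0 <= s -> s <= t -> t <= T -> kap <= k ->
  0 <= z -> z <= w s t -> z `^ k <= W `^ (k - kap) * w s t `^ kap.
Proof.
move=> s0 st tT kk z0 zw; have /andP[w0 wW] := w_bounds s0 st tT.
apply: (le_trans _ (powR_exponent_le kap0 kk w0 wW)).
by apply: ge0_ler_powR => //; rewrite (le_trans (ltW kap0)).
Qed.

(** Increments in time and in space are both at most [w s t]; the surplus exponent [k - kap] is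
    absorbed by the total control. *)
Lemma curve_holder (F : normedModType R) (h : R -> E -> F) (k K M : R) (c : R -> E) :
  kap <= k -> 0 <= K ->
  holder_on [set p : R * E | p.1 \in `[0, T] /\ `|p.2| <= M] k K h ->
  (forall t, 0 <= t <= T -> `|c t| <= M) ->
  (forall s t, 0 <= s -> s <= t -> t <= T -> `|c t - c s| <= w s t) ->
  forall s t, 0 <= s -> s <= t -> t <= T ->
    `|h t (c t) - h s (c s)| <= K * (2 * W `^ (k - kap)) * w s t `^ kap.
Proof.
move=> kk K0 hh cM cc s t s0 st tT.
have tI : 0 <= t <= T by rewrite (le_trans s0 st).
have sI : 0 <= s <= T by rewrite s0 (le_trans st tT).
apply: (le_trans (hh (t, c t) (s, c s) _ _)).
- by split; [rewrite in_itv|exact: cM].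
- by split; [rewrite in_itv|exact: cM].
rewrite -mulrA ler_wpM2l//= -mulrA mulr_natl mulr2n; apply: lerD.
  by apply: w_exponent => //; rewrite ger0_norm ?subr_ge0// tw.
by apply: w_exponent => //; exact: cc.
Qed.

Section Quotients.
Variables (k K M M1 : R) (x : R -> E).
Hypothesis kk : kap <= k.
Hypothesis K0 : 0 <= K.
Hypothesis M10 : 0 <= M1.
Hypothesis psi_diff : forall (t : R) (y : E), t \in `[0, T] -> differentiable (psi t) y.
Hypothesis DK : forall t y, 0 <= t <= T -> `|y| <= M -> `|Dpsi psi t y| <= K.
Hypothesis Dholder :
  holder_on [set p : R * E | p.1 \in `[0, T] /\ `|p.2| <= M] k K (Dpsi psi).
Hypothesis xM : forall t, 0 <= t <= T -> `|x t| <= M - M1.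

(** The first summand is the variation of [Dpsi] times [|y| <= M1], the second is [|Dpsi| <= K]
    times the variation of [y]. *)
Definition quotient_cst := K * (2 * W `^ (k - kap)) * M1 + K * W `^ (1 - kap).

Lemma quotient_cst_ge0 : 0 <= quotient_cst.
Proof. by rewrite addr_ge0 ?mulr_ge0 ?powR_ge0. Qed.

(** The increments of [x] and [y] are bounded in sum, so that those of [x + e y] are below [w] for
    every [e] in [[0, 1]]. *)
Definition small_curve (y : R -> E) :=
  (forall t, 0 <= t <= T -> `|y t| <= M1) /\
  forall s t, 0 <= s -> s <= t -> t <= T -> `|x t - x s| + `|y t - y s| <= w s t.

Lemma moved_curve y e : small_curve y -> 0 <= e -> e <= 1 ->
  (forall t, 0 <= t <= T -> `|x t + e *: y t| <= M) /\
  forall s t, 0 <= s -> s <= t -> t <= T ->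
    `|(x t + e *: y t) - (x s + e *: y s)| <= w s t.
Proof.
move=> [yM yw] e0 e1; split=> [t tT|s t s0 st tT].
  rewrite (le_trans (ler_normD _ _))// -(subrK M1 M) lerD ?xM// normrZ ger0_norm//.
  by rewrite (le_trans _ (yM t tT))// ler_piMl.
rewrite opprD addrACA -scalerBr (le_trans (ler_normD _ _))//.
rewrite (le_trans _ (yw s t s0 st tT))// lerD2l normrZ ger0_norm//.
by rewrite ler_piMl.
Qed.

Lemma derivative_holder y e s t : small_curve y -> 0 <= e -> e <= 1 ->
  0 <= s -> s <= t -> t <= T ->
  `|Dpsi psi t (x t + e *: y t) (y t) - Dpsi psi s (x s + e *: y s) (y s)|
    <= quotient_cst * w s t `^ kap.
Proof.
move=> sy e0 e1 s0 st tT; have [cM cw'] := moved_curve sy e0 e1.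
have tI : 0 <= t <= T by rewrite (le_trans s0 st).
have sI : 0 <= s <= T by rewrite s0 (le_trans st tT).
have h1 := curve_holder kk K0 Dholder cM cw' s0 st tT.
set A := Dpsi psi t _ in h1 *; set B := Dpsi psi s _ in h1 *.
rewrite clin_pairB.
rewrite /quotient_cst mulrDl (le_trans (ler_normD _ _))//; apply: lerD.
  rewrite (le_trans (opnormP _ _))// mulrAC.
  by apply: ler_pM => //; exact: sy.1.
rewrite (le_trans (opnormP _ _))// -mulrA; apply: ler_pM => //; first exact: DK (cM _ sI).
have dw : `|y t - y s| <= w s t.
  by apply: le_trans (sy.2 s t s0 st tT); rewrite lerDr.
have /andP[w0 wW] := w_bounds s0 st tT.
have := powR_exponent_le kap0 kap1 w0 wW; rewrite powRr1//.
exact: le_trans.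
Qed.

(** Estimating the increments of [psi] directly would leave a factor 1/e. Instead the difference of
    the quotients at [t] and [s] is [F 1 - F 0], where the derivative of [F] at [a] is the increment
    from [s] to [t] of [Dpsi] at [x + (a * e) *: y] applied to [y]; there [e] has cancelled. *)
Lemma quotient_holder y e s t : small_curve y -> 0 < e -> e <= 1 ->
  0 <= s -> s <= t -> t <= T ->
  `|e^-1 *: (psi t (x t + e *: y t) - psi t (x t)) -
    e^-1 *: (psi s (x s + e *: y s) - psi s (x s))|
    <= quotient_cst * w s t `^ kap.
Proof.
move=> sy e0 e1 s0 st tT.
have tI : t \in `[0, T] by rewrite in_itv/= (le_trans s0 st).
have sI : s \in `[0, T] by rewrite in_itv/= s0 (le_trans st tT).
(* Testing against vectors of the unit ball reduces the claim to real functions of [a]. *)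
apply: opnorm_lub => v v1.
pose D (a : R) : R^o :=
  (Dpsi psi t (x t + (a * e) *: y t) (y t) - Dpsi psi s (x s + (a * e) *: y s) (y s)) v.
pose F (a : R) : R^o :=
  (e^-1 *: (psi t (x t + a *: (e *: y t)) - psi s (x s + a *: (e *: y s)))) v.
have dF (a : R) : 0 <= a <= 1 ->
    is_derive a (1 : R) F (D a) /\ `|D a| <= quotient_cst * w s t `^ kap.
  move=> /andP[a0 a1]; split.
    have hd r (rI : r \in `[0, T]) : is_derive a (1 : R)
        (fun b : R => psi r (x r + b *: (e *: y r)))
        (e *: Dpsi psi r (x r + (a * e) *: y r) (y r)).
      have h := is_derive_line (psi_diff (x r + a *: (e *: y r)) rI).
      apply: (is_derive_eq h); rewrite -frechetE; last exact: psi_diff.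
      by rewrite scalerA; exact: linearZZ.
    apply: (is_derive_eq (is_derive_clin_eval v (is_deriveZ e^-1 (is_deriveB (hd t tI) (hd s sI))))).
    by rewrite -scalerBr scalerA mulVf ?scale1r// gt_eqF.
  have ae0 : 0 <= a * e by rewrite mulr_ge0// ltW.
  have ae1 : a * e <= 1 by rewrite mulr_ile1// ltW.
  apply: (le_trans (opnormP _ _)); apply: le_trans (derivative_holder sy ae0 ae1 s0 st tT).
  by rewrite ler_piMr.
have -> : (e^-1 *: (psi t (x t + e *: y t) - psi t (x t)) -
    e^-1 *: (psi s (x s + e *: y s) - psi s (x s))) v = F 1 - F 0.
  rewrite /F !scale1r !scale0r !addr0.
  rewrite -[LHS]/(e^-1 * (psi t (x t + e *: y t) v - psi t (x t) v) -
    e^-1 * (psi s (x s + e *: y s) v - psi s (x s) v)).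
  rewrite -[RHS]/(e^-1 * (psi t (x t + e *: y t) v - psi s (x s + e *: y s) v) -
    e^-1 * (psi t (x t) v - psi s (x s) v)).
  by ring.
exact: mean_value_curve dF.
Qed.

Lemma young_variation (k2 K2 : R) (e_ : nat -> R) (y_ : nat -> R -> E) (h : R -> E) :
  kap <= k2 -> 0 <= K2 ->
  holder_on [set p : R * E | p.1 \in `[0, T] /\ `|p.2| <= M] k2 K2 psi ->
  (forall n, small_curve (y_ n)) -> small_curve h ->
  (forall n, 0 < e_ n /\ e_ n <= 1) -> e_ n @[n --> \oo] --> (0 : R) ->
  (forall t, 0 <= t <= T -> y_ n t @[n --> \oo] --> h t) ->
  exists J, [/\ control_holder T w kap (fun t => Dpsi psi t (x t) (h t)) quotient_cst,
    young_primitive T w kap iota eta (fun t => Dpsi psi t (x t) (h t)) quotient_cst J,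
    forall n, young_integrable 0 T (fun t => psi t (x t + e_ n *: y_ n t)) eta &
    (e_ n)^-1 * (young_integral 0 T (fun t => psi t (x t + e_ n *: y_ n t)) eta -
      young_integral 0 T (fun t => psi t (x t)) eta) @[n --> \oo] --> J T - J 0].
Proof.
move=> kk2 K20 psiK sy sh e01 ecvg ycvg.
have C0 := quotient_cst_ge0.
have T00 := ltW T0.
have young y e : small_curve y -> 0 <= e -> e <= 1 ->
    young_integrable 0 T (fun t => psi t (x t + e *: y t)) eta.
  move=> sy1 e0 e1; have [cM cw'] := moved_curve sy1 e0 e1.
  have hX : control_holder T w kap (fun t => psi t (x t + e *: y t))
      (K2 * (2 * W `^ (k2 - kap))) := curve_holder kk2 K20 psiK cM cw'.
  have C20 : 0 <= K2 * (2 * W `^ (k2 - kap)) by rewrite !mulr_ge0 ?powR_ge0.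
  have [J JX] := young_primitive_exists T0 cw kap0 iota0 th1 etaw C20 hX.
  exists (J T - J 0).
  exact: (young_primitive_integral T0 cw kap0 iota0 th1 etaw C20 hX JX (lexx 0) T00 (lexx T)).
have young0 : young_integrable 0 T (fun t => psi t (x t)) eta.
  have [l hl] := young h 0 sh (lexx 0) ler01; exists l.
  have -> // : (fun t => psi t (x t)) = (fun t => psi t (x t + 0 *: h t)).
  by apply/funext => t; rewrite scale0r addr0.
pose X n t := (e_ n)^-1 *: (psi t (x t + e_ n *: y_ n t) - psi t (x t)).
have hX n : control_holder T w kap (X n) quotient_cst.
  move=> s t s0 st tT; have [e0 e1] := e01 n.
  exact: quotient_holder.
have hX0 : control_holder T w kap (fun t => Dpsi psi t (x t) (h t)) quotient_cst.
  move=> s t s0 st tT; have := derivative_holder sh (lexx 0) ler01 s0 st tT.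
  by rewrite !scale0r !addr0.
have [Jn JnX] := choice (fun n => young_primitive_exists T0 cw kap0 iota0 th1 etaw C0 (hX n)).
have [J JX] := young_primitive_exists T0 cw kap0 iota0 th1 etaw C0 hX0.
exists J; split=> // [n|].
  by have [e0 e1] := e01 n; exact: young (sy n) (ltW e0) e1.
have JE n : (e_ n)^-1 * (young_integral 0 T (fun t => psi t (x t + e_ n *: y_ n t)) eta -
      young_integral 0 T (fun t => psi t (x t)) eta) = Jn n T - Jn n 0.
  have [e0 e1] := e01 n.
  have i1 := young_integralP (young _ _ (sy n) (ltW e0) e1).
  have i2 := young_integralP young0.
  have i3 := is_young_integralZB (e_ n)^-1 i1 i2.
  have i4 := young_primitive_integral T0 cw kap0 iota0 th1 etaw C0 (hX n) (JnX n)
    (lexx 0) T00 (lexx T).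
  exact: (young_integral_unique T00 i3 i4).
under eq_cvg do rewrite JE.
apply: (sewing_cvg T0 cw th1 JnX JX) => s t s0 st tT.
have sI : 0 <= s <= T by rewrite s0 (le_trans st tT).
have sI' : s \in `[0, T] by rewrite in_itv.
have vc : (fun _ : nat => eta t - eta s) n @[n --> \oo] --> eta t - eta s by exact: cvg_cst.
have xc : X n s @[n --> \oo] --> Dpsi psi s (x s) (h s).
  exact: (differentiable_cvg (psi_diff (x s) sI') (fun n => (e01 n).1) ecvg (ycvg s sI)).
exact: (clin_eval_cvg _ xc vc).
Qed.

(** The case of a constant curve, with the same constant and control as along [h]: it supplies the
    Young integrals for [h] frozen at a point. *)
Lemma young_constant z : `|z| <= M1 ->
  (forall s t, 0 <= s -> s <= t -> t <= T -> `|x t - x s| <= w s t) ->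
  exists2 Z, young_primitive T w kap iota eta (fun s => Dpsi psi s (x s) z) quotient_cst Z &
    forall t, 0 <= t <= T ->
      is_young_integral t T (fun s => Dpsi psi s (x s) z) eta (Z T - Z t).
Proof.
move=> zM xw; have sz : small_curve (fun _ => z).
  split=> // s t s0 st tT; rewrite subrr normr0 addr0.
  exact: xw.
have hX : control_holder T w kap (fun s => Dpsi psi s (x s) z) quotient_cst.
  move=> s t s0 st tT; have := derivative_holder sz (lexx 0) ler01 s0 st tT.
  by rewrite !scale0r !addr0.
have C0 := quotient_cst_ge0.
have [Z ZX] := young_primitive_exists T0 cw kap0 iota0 th1 etaw C0 hX.
exists Z => // t /andP[t0 tT].
exact: (young_primitive_integral T0 cw kap0 iota0 th1 etaw C0 hX ZX t0 tT (lexx T)).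
Qed.

End Quotients.
End ObservationCalculus.

(** * The costate *)

(** As [iota < 1/2], there is room for [p] strictly between 2 and 1/iota. Finite [p]-variation of
    [eta] makes its variation of order 1/iota a control. *)
Lemma observation_control (R : realType) (d : nat) (T iota : R)
    (eta : R -> 'rV[R]_d) (w0 : R -> R -> R) : 0 < T -> observation_path T eta ->
  control T w0 -> 0 < iota -> iota < 2^-1 ->
  exists2 w, control T w & forall s t, 0 <= s -> s <= t -> t <= T ->
    w0 s t <= w s t /\ `|eta t - eta s| <= w s t `^ iota.
Proof.
move=> T0 [ceta veta] cw0 iota0 iota2.
have q2 : 2 < iota^-1 by rewrite -[X in X < _]invrK ltf_pV2 ?posrE ?invr_gt0.
pose p := (2 + iota^-1) / 2.
have p2 : 2 < p by rewrite /p; lra.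
have pq : p < iota^-1 by rewrite /p; lra.
have p0 : 0 < p by lra.
have [cv veta'] := pvar_control T0 p0 pq ceta (veta p p2).
exists (fun s t => w0 s t + pvar iota^-1 eta s t); first exact: control_add.
move=> s t s0 st tT; have v0 := control_ge0 cv s0 st tT.
have w00 := control_ge0 cw0 s0 st tT.
split; first by rewrite lerDl.
apply: (le_trans (veta' s t s0 st tT)); rewrite invrK.
by apply: ge0_ler_powR; rewrite ?nnegrE ?addr_ge0 ?(ltW iota0)// lerDr.
Qed.

(** * Backward Volterra equations *)

Section BackwardVolterra.
Context {R : realType} {E : normedVectType R}.

Hint Resolve leb_measurable_itv : core.

Variables (T : R) (a : R -> R) (G : R -> E -> E) (r : R -> E).
Hypothesis T0 : 0 < T.
Hypothesis ia : lintegrable `[0, T] a.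
Hypothesis a0 : forall t, 0 <= t <= T -> 0 <= a t.
Hypothesis Glip : forall s z z', 0 <= s <= T ->
  `|G s z - G s z'| <= a s * `|z - z'|.
Hypothesis Gzero : forall s, G s 0 = 0.
Hypothesis Gmeas : forall y, {within `[0, T], continuous y} ->
  vmeas `[0, T] (fun s => G s (y s)).
Hypothesis cr : {within `[0, T], continuous r}.

Definition bvolterra y t := vint `[t, T] (fun s => G s (y s)) + r t.

Let K : R := 2 * @vintK R E.
Let K0 : 0 <= K. Proof. by rewrite mulr_ge0// ltW// (vintK_gt0 (E := E)). Qed.
Local Notation W := (bweight T a K).

Lemma bfield_vintegrable y : {within `[0, T], continuous y} ->
  vintegrable `[0, T] (fun s => G s (y s)).
Proof.
move=> cy i; have [Ke Ke0 [Ke1 _]] := @ecoord_bound R E.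
have [M M0 yM] := within_bounded cy.
apply: (leb_le_integrable (leb_measurable_itv _) (Gmeas cy i) _
  (lintegrableZ (Ke * M) (leb_measurable_itv _) ia)).
apply: leb_aeT => s /=; rewrite in_itv/= => sT.
rewrite (le_trans (Ke1 _ _))// -mulrA ler_wpM2l ?(ltW Ke0)//.
have := Glip (y s) 0 sT; rewrite Gzero !subr0 => h.
by rewrite (le_trans h)// mulrC ler_wpM2r ?a0// yM.
Qed.

Lemma vint_rest (w : R -> E) t : vintegrable `[0, T] w -> 0 <= t -> t <= T ->
  vint `[t, T] w = vint `[0, T] w - vint `[0, t] w.
Proof.
move=> iw t0 tT; rewrite /vint -sumrB; apply: eq_bigr => i _.
by rewrite -scalerBl; congr (_ *: _); exact: primitive_rest (iw i) t0 tT.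
Qed.

Lemma bvolterra_continuous y : {within `[0, T], continuous y} ->
  {within `[0, T], continuous (bvolterra y)}.
Proof.
move=> cy; have iy := bfield_vintegrable cy.
have [M M0 yM] := within_bounded cy.
have ab : abs_continuous 0 T (fun t => vint `[0, t] (fun s => G s (y s))).
  apply: (@vint_abs_continuous _ _ _ _ (fun s => M * a s) iy).
    exact: (lintegrableZ M (leb_measurable_itv _) ia).
  apply: leb_aeT => s; rewrite /= in_itv/= => sT.
  have := Glip (y s) 0 sT; rewrite Gzero !subr0 => h.
  by rewrite (le_trans h)// mulrC ler_wpM2r ?a0// yM.
have c1 := abs_continuous_within ab.
have c2 : {within `[0, T], continuous (fun t =>
    vint `[0, T] (fun s => G s (y s)) - vint `[0, t] (fun s => G s (y s)) + r t)}.
  by move=> t; apply: cvgD; [apply: cvgB; [exact: cvg_cst|exact: c1]|exact: cr].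
apply: subspace_eq_continuous c2 => t; rewrite inE /= in_itv/= => /andP[t0 tT].
by rewrite /from_subspace /bvolterra (vint_rest iy t0 tT).
Qed.

Let iaW : lintegrable `[0, T] (fun s => a s * W s).
Proof. exact: bweight_integrable. Qed.

Let sub t : 0 <= t <= T -> `[t, T]%classic `<=` `[0, T]%classic.
Proof.
move=> /andP[t0 _] z /=; rewrite !in_itv/= => /andP[tz ->].
by rewrite (le_trans t0 tz).
Qed.

Lemma bvolterra_contract y y' N : {within `[0, T], continuous y} ->
  {within `[0, T], continuous y'} -> 0 <= N ->
  (forall t, 0 <= t <= T -> `|y t - y' t| <= N * W t) ->
  forall t, 0 <= t <= T -> `|bvolterra y t - bvolterra y' t| <= N / 2 * W t.
Proof.
move=> cy cy' N0 yy' t tT.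
have mt := leb_measurable_itv `[t, T].
have iaWt : lintegrable `[t, T] (fun s => a s * W s).
  by apply: lintegrableS iaW; exact: sub.
have ic y1 : {within `[0, T], continuous y1} ->
    vintegrable `[t, T] (fun s => G s (y1 s)).
  move=> cy1 i; apply: lintegrableS (bfield_vintegrable cy1 i).
  exact: sub.
have -> : bvolterra y t - bvolterra y' t =
    vint `[t, T] (fun s => G s (y s) - G s (y' s)).
  rewrite (vintB mt (ic y cy) (ic y' cy')) /bvolterra opprD addrACA subrr addr0.
  by [].
apply: (@le_trans _ _ (vintK (E := E) * \int[leb]_(s in `[t, T]) (N * (a s * W s)))).
  apply: (vint_norm_le mt (vintegrableB mt (ic y cy) (ic y' cy'))).
    exact: (lintegrableZ N mt iaWt).
  move=> s /(sub tT); rewrite /= in_itv/= => sT.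
  apply: (le_trans (Glip (y s) (y' s) sT)).
  by rewrite mulrCA; apply: ler_wpM2l (a0 sT) _ _ (yy' s sT).
rewrite (RintegralZl _ mt iaWt).
have := bweight_ineq T0 ia a0 K0 tT; rewrite /K.
move: (\int[leb]_(s in `[t, T]) (a s * W s)) => I h.
have := ler_wpM2l N0 h; move: (W t) => Wt; lra.
Qed.

Let Wm := expR (K * primitive a T).

Let W1 t : 0 <= t <= T -> 1 <= W t <= Wm.
Proof. exact: bweight_bounds. Qed.

(** The operator maps 0 to [r], of norm at most [B / 2], and by contraction the rest adds at most
    [B / 2] times the weight. *)
Lemma bvolterra_tube B y : 0 <= B -> (forall t, 0 <= t <= T -> `|r t| <= B / 2) ->
  tube T B W y -> tube T B W (bvolterra y).
Proof.
move=> B0 rB [cy yB]; split; first exact: bvolterra_continuous.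
move=> t tT; have c0 : {within `[0, T], continuous (fun _ : R => 0 : E)}.
  by move=> ?; exact: cvg_cst.
have y0B s : 0 <= s <= T -> `|y s - 0| <= B * W s by rewrite subr0; exact: yB.
have h := bvolterra_contract cy c0 B0 y0B tT.
have z0 : bvolterra (fun _ => 0) t = r t.
  rewrite /bvolterra /vint big1 ?add0r// => i _.
  have -> : (fun s => ecoord i (G s (0 : E))) = (fun _ => 0).
    by apply/funext => s; rewrite Gzero; exact: linear0.
  by rewrite Rintegral_cst// mul0r scale0r.
rewrite z0 in h; have /andP[W1t _] := W1 tT.
have := ler_normD (bvolterra y t - r t) (r t); rewrite subrK => h1.
apply: (le_trans h1); apply: (le_trans (lerD h (rB t tT))).
have B2 : 0 <= B / 2 by rewrite divr_ge0.
have := ler_wpM2l B2 W1t; move: (W t) => Wt; lra.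
Qed.

Lemma bvolterra_solution : exists2 y, {within `[0, T], continuous y} &
  forall t, 0 <= t <= T -> bvolterra y t = y t.
Proof.
have [B B0 rB] := within_bounded cr.
have B20 : 0 <= 2 * B by rewrite mulr_ge0// ltW.
have rB' t : 0 <= t <= T -> `|r t| <= 2 * B / 2.
  by move=> tT; rewrite mulrAC divff// mul1r rB.
have [y [[cy _] yE]] := @picard R E T (2 * B) Wm W bvolterra (ltW T0) B20 W1
  (fun y ty => bvolterra_tube B20 rB' ty)
  (fun y y' N ty ty' => bvolterra_contract ty.1 ty'.1).
by exists y.
Qed.

Lemma bvolterra_unique y y' : {within `[0, T], continuous y} ->
  {within `[0, T], continuous y'} ->
  (forall t, 0 <= t <= T -> bvolterra y t = y t) ->
  (forall t, 0 <= t <= T -> bvolterra y' t = y' t) ->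
  forall t, 0 <= t <= T -> y t = y' t.
Proof.
move=> cy cy' yE y'E.
have [B B0 rB] := within_bounded cr.
have [B1 B10 yB] := within_bounded cy; have [B2 B20 yB'] := within_bounded cy'.
(* Large enough for the tube to contain both solutions and for [r] to stay below [C / 2]. *)
pose C := 2 * B + B1 + B2.
have C0 : 0 <= C by rewrite /C; lra.
have tb z : {within `[0, T], continuous z} ->
    (forall t, 0 <= t <= T -> `|z t| <= C) -> tube T C W z.
  move=> cz zC; split=> // t tT; apply: (le_trans (zC t tT)).
  by rewrite ler_peMr//; have /andP[] := W1 tT.
have rB' t : 0 <= t <= T -> `|r t| <= C / 2.
  by move=> tT; apply: (le_trans (rB t tT)); rewrite /C; lra.
apply: (@picard_unique R E T C Wm W bvolterra C0 W1
  (fun y y' N ty ty' => bvolterra_contract ty.1 ty'.1)) => //.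
- by apply: tb => // t tT; apply: (le_trans (yB t tT)); rewrite /C; lra.
- by apply: tb => // t tT; apply: (le_trans (yB' t tT)); rewrite /C; lra.
Qed.

End BackwardVolterra.

(** * Identification of covectors with vectors *)

Section Covectors.
Context {R : realType} {E : normedVectType R}.

Lemma covector_subproof (z : E) :
  (fun v => \sum_j ecoord j z * ecoord j v : R^o) \in @clin_pred R E R^o.
Proof.
have lz : linear (fun v => \sum_j ecoord j z * ecoord j v : R^o).
  move=> k v v'; rewrite scaler_sumr -big_split/=; apply: eq_bigr => j _.
  by rewrite ecoordD ecoordZ mulrDr mulrCA.
by rewrite inE; split => //; exact: findim_linear_continuous.
Qed.

(** [E] is identified with its dual as if the basis were orthonormal, which turns the equation for
    [lambda] into one in [E]. The inverse map is [representative]. *)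
Definition covector (z : E) : 'L(E, R^o) := CLin (covector_subproof z).

Lemma covectorE z v : covector z v = \sum_j ecoord j z * ecoord j v.
Proof. by []. Qed.

Lemma covector_sym z v : covector z v = covector v z.
Proof. by rewrite !covectorE; apply: eq_bigr => j _; rewrite mulrC. Qed.

Definition representative (A : 'L(E, R^o)) : E := \sum_i A (ebasis i) *: ebasis i.

Lemma ecoord_representative A i : ecoord i (representative A) = A (ebasis i).
Proof. exact: ecoord_sumE. Qed.

Lemma representativeK A v : covector (representative A) v = A v.
Proof.
rewrite covectorE linear_ecoord; apply: eq_bigr => j _.
by rewrite ecoord_representative mulrC.
Qed.

Lemma covector_bounded : exists2 L : R, 0 < L & forall z v : E,
  `|covector z v| <= L * `|z| * `|v|.
Proof.
have [K K0 [K1 _]] := @ecoord_bound R E.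
exists (1 + (\dim {:E})%:R * (K * K)) => [|z v].
  by rewrite ltr_pwDl// mulr_ge0// mulr_ge0 ?(ltW K0).
apply: (@le_trans _ _ (\sum_(j < \dim {:E}) (K * `|z|) * (K * `|v|))).
  rewrite covectorE (le_trans (ler_norm_sum _ _ _))//; apply: ler_sum => j _.
  by rewrite normrM; apply: ler_pM.
rewrite sumr_const card_ord -[leLHS]mulr_natl.
have ring_id (n p q : R) :
  (1 + n * (K * K)) * p * q = n * (K * p * (K * q)) + p * q by ring.
by rewrite ring_id lerDl mulr_ge0.
Qed.

Lemma covector_continuous : continuous covector.
Proof.
have [L L0 LP] := covector_bounded.
move=> z; apply/cvgrPdist_lt => e e0; apply/nbhs_normP; exists (e / L).
  exact: divr_gt0.
move=> y /= zy; apply: (@le_lt_trans _ _ (L * `|z - y|)); last first.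
  by rewrite mulrC -ltr_pdivlMr.
apply: opnorm_lub => v v1.
have -> : (covector z - covector y) v = covector (z - y) v.
  rewrite covector_sym linearB -[LHS]/(covector z v - covector y v).
  by rewrite (covector_sym z) (covector_sym y).
by rewrite (le_trans (LP _ _))// ler_piMr// mulr_ge0// ltW.
Qed.

Lemma clin_eqP (V W : normedModType R) (A A' : 'L(V, W)) : (forall v, A v = A' v) -> A = A'.
Proof. by move=> h; apply/val_inj/funext. Qed.

End Covectors.

Lemma vint_rest_continuous (R : realType) (E : normedVectType R) (T : R) (w : R -> E) :
  vintegrable `[0, T] w -> {within `[0, T], continuous (fun t => vint `[t, T] w)}.
Proof.
move=> iw.
have c1 : {within `[0, T], continuous (fun t =>
    \sum_i (\int[leb]_(s in `[0, T]) ecoord i (w s) -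
      \int[leb]_(s in `[0, t]) ecoord i (w s)) *: (ebasis i : E))}.
  move=> t; apply: cvg_sumr => i; apply: cvgZr_tmp.
  apply: cvgB; first exact: cvg_cst.
  exact: (abs_continuous_within (primitive_abs_continuous (iw i))).
apply: subspace_eq_continuous c1 => t; rewrite inE /= in_itv/= => /andP[t0 tT].
rewrite /from_subspace /vint; apply: eq_bigr => i _.
by rewrite (primitive_rest (iw i) t0 tT).
Qed.

Section YoungSums.
Context {R : realType} {V : normedModType R}.

Lemma is_young_integral_sum (I : finType) (a b : R) (c : I -> R)
    (X : I -> R -> 'L(V, R^o)) (y : R -> V) (l : I -> R^o) :
  (forall i, is_young_integral a b (X i) y (l i)) ->
  is_young_integral a b (fun t => \sum_i c i *: X i t) y (\sum_i c i * l i).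
Proof.
move=> yl; suff h (r : seq I) :
    is_young_integral a b (fun t => \sum_(i <- r) c i *: X i t) y
      (\sum_(i <- r) c i * l i : R^o) by exact: h.
elim: r => [|i r IH].
  have -> : (fun t => \sum_(i <- [::]) c i *: X i t) = fun _ => 0.
    by apply/funext => t; rewrite big_nil.
  rewrite big_nil => e e0; exists 1 => // s tau _ _.
  by rewrite big1 ?subrr ?normr0.
have zero : is_young_integral a b (fun _ => 0 : 'L(V, R^o)) y (0 : R^o).
  by move=> e e0; exists 1 => // s tau _ _; rewrite big1 ?subrr ?normr0.
(* The sum is written through differences, to fit the combination [c *: (X - X')] of
   [is_young_integralZB]. *)
have h := is_young_integralZB 1 IH (is_young_integralZB (- c i) (yl i) zero).
have -> : (fun t => \sum_(j <- i :: r) c j *: X j t) =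
    (fun t => 1 *: (\sum_(j <- r) c j *: X j t - (- c i) *: (X i t - 0))).
  by apply/funext => t; rewrite big_cons scale1r subr0 scaleNr opprK addrC.
have -> : \sum_(j <- i :: r) c j * l j =
    1 *: ((\sum_(j <- r) c j * l j : R^o) - (- c i) *: (l i - 0)).
  by rewrite big_cons scale1r subr0 scaleNr opprK addrC.
exact: h.
Qed.

End YoungSums.

(** Uniform continuity of [eta] makes the germ small, and smallness of the control does the same for
    the remainder. *)
Lemma young_primitive_continuous (R : realType) (V : normedModType R) (T th K C : R)
    (w : R -> R -> R) (X : R -> 'L(V, R^o)) (eta : R -> V) (J : R -> R) :
  0 < T -> control T w -> 1 < th -> 0 <= K ->
  {within `[0, T], continuous eta} -> (forall s, 0 <= s <= T -> `|X s| <= C) ->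
  (forall s t, 0 <= s -> s <= t -> t <= T ->
    `|J t - J s - X s (eta t - eta s)| <= K * w s t `^ th) ->
  {within `[0, T], continuous J}.
Proof.
move=> T0 cw th1 K0 ceta XC JX.
have C0 : 0 <= C.
  apply: (le_trans (normr_ge0 (X 0))); apply: XC; apply/andP; split => //.
  exact: ltW.
have W0 : 0 <= w 0 T by apply: (control_ge0 cw) => //; exact: ltW.
have step e : 0 < e -> exists2 d, 0 < d & forall s t, 0 <= s -> s <= t -> t <= T ->
    t - s < d -> `|J t - J s| < e.
  move=> e0; have e2 : 0 < e / 2 by rewrite divr_gt0.
  have [d d0 dP] := within_uniform ceta (divr_gt0 e2 (ltr_pwDl ltr01 C0)).
  have KW : 0 < 1 + K * w 0 T by rewrite ltr_pwDl// mulr_ge0.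
  have [d' d'0 dP'] := control_small_powR cw th1 (divr_gt0 e2 KW).
  exists (Num.min d d') => [|s t s0 st tT]; first by rewrite lt_min d0.
  rewrite lt_min => /andP[h1 h2].
  have tI : 0 <= t <= T by rewrite (le_trans s0 st).
  have sI : 0 <= s <= T by rewrite s0 (le_trans st tT).
  have h3 : `|X s (eta t - eta s)| < e / 2.
    have : `|eta t - eta s| < e / 2 / (1 + C).
      by apply: dP => //; rewrite ger0_norm// subr_ge0.
    rewrite ltr_pdivlMr ?ltr_pwDl// => h; apply: le_lt_trans h.
    rewrite (le_trans (opnormP _ _))// mulrC ler_wpM2l// (le_trans (XC s sI))//.
    by rewrite lerDr.
  have h4 : K * w s t `^ th <= e / 2.
    have := ler_wpM2l K0 (dP' s t s0 st tT h2) => h; apply: (le_trans h).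
    have h5 : w s t <= w 0 T := control_le cw (lexx 0) s0 st tT (lexx T).
    apply: (@le_trans _ _ (e / 2 / (1 + K * w 0 T) * (K * w 0 T))).
      rewrite mulrCA; apply: ler_wpM2l; first by rewrite ltW// divr_gt0.
      by rewrite ler_wpM2l.
    rewrite mulrAC ler_pdivrMr// ler_wpM2l ?(ltW e2)// lerDr//.
  have := JX s t s0 st tT => h5; rewrite (splitr e) -(subrK (X s (eta t - eta s)) (J t - J s)).
  by rewrite (le_lt_trans (ler_normD _ _))// ler_ltD// (le_trans h5).
apply/within_continuous_dist => s e; rewrite /= in_itv/= => /andP[s0 sT] e0.
have [d d0 dP] := step e e0; exists d => // t; rewrite /= in_itv/= => /andP[t0 tT] std.
have [st|ts] := leP s t.
  by rewrite distrC dP// (le_lt_trans _ std)// distrC ler_norm.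
by apply: dP => //; [exact: ltW|exact: le_lt_trans (ler_norm _) std].
Qed.

Lemma covectorB (R : realType) (E : normedVectType R) (z z' v : E) :
  covector (z - z') v = covector z v - covector z' v.
Proof. by rewrite !(covector_sym _ v) linearB. Qed.

(** * Existence and uniqueness of the costate *)

Section Costate.
Context {R : realType} {E : normedVectType R} {d : nat}.

Hint Resolve leb_measurable_itv : core.

Variables (T : R) (eta : R -> 'rV[R]_d) (a : R -> R).
Variables (A : R -> E -> E) (B : R -> 'L(E, R^o)) (D : R -> 'L(E, 'L('rV[R]_d, R^o))).
Hypothesis T0 : 0 < T.
Hypothesis ia : lintegrable `[0, T] a.
Hypothesis a0 : forall t, 0 <= t <= T -> 0 <= a t.
Hypothesis Alin : forall s, linear (A s).
Hypothesis Aa : forall s v, 0 <= s <= T -> `|A s v| <= a s * `|v|.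
Hypothesis Ameas : forall v, vmeas `[0, T] (fun s => A s v).
Hypothesis iB : forall z, lintegrable `[0, T] (fun s => B s z).
Hypothesis young : forall z, exists2 J : R -> R, {within `[0, T], continuous J} &
  forall t, 0 <= t <= T -> is_young_integral t T (fun s => D s z) eta (J T - J t).

(** The equation of [costate_eq], with the linearised dynamics and the derivatives of the running
    cost and of the observation term abstracted as [A], [B] and [D]. *)
Definition costate (lam : R -> 'L(E, R^o)) := forall z, [/\
  lintegrable `[0, T] (fun s => lam s (A s z)),
  lintegrable `[0, T] (fun s => B s z) &
  forall t : R, t \in `[0, T] -> young_integrable t T (fun s => D s z) eta /\
    lam t z = \int[leb]_(s in `[t, T]) lam s (A s z) +
      \int[leb]_(s in `[t, T]) B s z + young_integral t T (fun s => D s z) eta].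

(** The transpose of [A s] under the identification by [covector]. *)
Definition adjoint s (z : E) : E := \sum_i covector z (A s (ebasis i)) *: ebasis i.

Lemma ecoord_adjoint s z i : ecoord i (adjoint s z) = covector z (A s (ebasis i)).
Proof. exact: ecoord_sumE. Qed.

Lemma covector_adjoint s z v : covector (adjoint s z) v = covector z (A s v).
Proof.
have -> : A s v = \sum_i ecoord i v *: A s (ebasis i).
  rewrite [v in LHS]ecoord_sum.
  pose As := GRing.isLinear.Build R E E *:%R (A s) (@Alin s).
  pose L : {linear E -> E} := HB.pack (A s) As.
  rewrite -[LHS]/(L _) linear_sum; apply: eq_bigr => i _.
  by rewrite linearZ.
rewrite linear_sum covectorE; apply: eq_bigr => i _.
by rewrite linearZ ecoord_adjoint mulrC.
Qed.

Lemma adjoint_field : exists2 b, lintegrable `[0, T] b &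
  (forall t, 0 <= t <= T -> 0 <= b t) /\
  forall s z z', 0 <= s <= T -> `|adjoint s z - adjoint s z'| <= b s * `|z - z'|.
Proof.
have [L L0 LP] := @covector_bounded R E.
have [K K0 [K1 K2]] := @ecoord_bound R E.
pose S := \sum_i `|ebasis i : E|.
have S0 : 0 <= S by exact: sumr_ge0.
have c0 : 0 <= K * (L * S) by rewrite !mulr_ge0// ltW.
exists (fun s => K * (L * S) * a s); first exact: lintegrableZ.
split=> [t tT|s z z' sT]; first by rewrite mulr_ge0 ?a0.
have -> : K * (L * S) * a s * `|z - z'| = K * (L * `|z - z'| * (a s * S)) by ring.
apply: K2; first by rewrite !mulr_ge0 ?a0// ltW.
move=> i; rewrite ecoordB !ecoord_adjoint -covectorB.
apply: (le_trans (LP _ _)); rewrite ler_wpM2l ?mulr_ge0 ?(ltW L0)//.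
apply: (le_trans (Aa _ sT)); rewrite ler_wpM2l ?a0//.
by rewrite /S (bigD1 i)//= lerDl sumr_ge0.
Qed.

Lemma adjoint_zero s : adjoint s 0 = 0.
Proof.
rewrite /adjoint big1// => i _; rewrite covector_sym linear0.
exact: scale0r.
Qed.

Lemma adjoint_measurable (y : R -> E) : {within `[0, T], continuous y} ->
  vmeas `[0, T] (fun s => adjoint s (y s)).
Proof.
move=> cy i.
have -> : (fun s => ecoord i (adjoint s (y s))) =
    (fun s => \sum_j ecoord j (y s) * ecoord j (A s (ebasis i))).
  by apply/funext => s; rewrite ecoord_adjoint.
apply: measurable_sum => j; apply: measurable_funM; last exact: Ameas.
apply: leb_continuous.
have ce : {within setT, continuous (@ecoord R E j)}.
  by apply: continuous_subspaceT; exact: ecoord_continuous.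
exact: (within_comp cy (fun _ _ => I) ce).
Qed.

(** By linearity in [z], Young integrals along basis vectors suffice. Together with the integral of
    [B] they form the inhomogeneity [r] of a backward Volterra equation with field [adjoint]. *)
Lemma costate_exists_unique : exists lam, [/\ costate lam,
  {within `[0, T], continuous lam} &
  forall mu, costate mu -> forall t, t \in `[0, T] -> mu t = lam t].
Proof.
have [b ib [b0 bP]] := adjoint_field.
pose cJ i := cid2 (young (ebasis i)); pose J_ i := projT1 (cJ i).
have J_c i : {within `[0, T], continuous (J_ i)} by rewrite /J_; case: (cJ i).
have J_i i t : 0 <= t <= T ->
    is_young_integral t T (fun s => D s (ebasis i)) eta (J_ i T - J_ i t).
  by rewrite /J_; case: (cJ i) => /= J _; apply.
pose bv s := representative (B s).
have ibv : vintegrable `[0, T] bv.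
  move=> i; apply: (eq_lintegrable _ (iB (ebasis i))) => s.
  by rewrite ecoord_representative.
pose r t : E := vint `[t, T] bv + \sum_i (J_ i T - J_ i t) *: ebasis i.
have cr : {within `[0, T], continuous r}.
  move=> t; apply: cvgD; first exact: (vint_rest_continuous ibv).
  apply: cvg_sumr => i; apply: cvgZr_tmp.
  by apply: cvgB; [exact: cvg_cst|exact: J_c].
have [y cy yE] := bvolterra_solution T0 ib b0 bP adjoint_zero adjoint_measurable cr.
have sub t : 0 <= t <= T -> `[t, T]%classic `<=` `[0, T]%classic.
  move=> /andP[t0 _] z /=; rewrite !in_itv/= => /andP[tz ->].
  by rewrite (le_trans t0 tz).
have young_z t z : 0 <= t <= T -> is_young_integral t T (fun s => D s z) eta
    (\sum_i ecoord i z * (J_ i T - J_ i t)).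
  move=> tT.
  have -> : (fun s => D s z) = fun s => \sum_i ecoord i z *: D s (ebasis i).
    apply/funext => s; rewrite {1}[z]ecoord_sum linear_sum.
    by apply: eq_bigr => i _; rewrite linearZ.
  exact: (is_young_integral_sum _ (fun i => J_i i t tT)).
have iy := bfield_vintegrable ib b0 bP adjoint_zero adjoint_measurable cy.
exists (fun t => covector (y t)); split.
- move=> z; split; last first.
  + move=> t; rewrite in_itv/= => tT; have tT' := tT; case/andP: tT' => t0 tT'.
    split; first by eexists; exact: young_z.
    have mt := leb_measurable_itv `[t, T].
    have it : vintegrable `[t, T] (fun s => adjoint s (y s)).
      by move=> i; apply: lintegrableS (iy i); exact: sub.
    have ibt : vintegrable `[t, T] bv.
      by move=> i; apply: lintegrableS (ibv i); exact: sub.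
    rewrite (young_integralE tT' (young_z t z tT)).
    have -> : \int[leb]_(s in `[t, T]) covector (y s) (A s z) =
        covector z (vint `[t, T] (fun s => adjoint s (y s))).
      rewrite -(vintegrable_linear (covector z) mt it).2.
      apply: eq_Rintegral => s _.
      exact: etrans (esym (covector_adjoint _ _ _)) (covector_sym _ _).
    have -> : \int[leb]_(s in `[t, T]) B s z = covector z (vint `[t, T] bv).
      rewrite -(vintegrable_linear (covector z) mt ibt).2.
      apply: eq_Rintegral => s _.
      exact: etrans (esym (representativeK _ _)) (covector_sym _ _).
    rewrite -[LHS]/(covector (y t) z).
    have -> : covector (y t) z = covector z (vint `[t, T] (fun s => adjoint s (y s))) +
        (covector z (vint `[t, T] bv) +
         covector z (\sum_i (J_ i T - J_ i t) *: ebasis i)).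
      rewrite covector_sym -{1}(yE t tT).
      exact: etrans (linearD _ _ _) (f_equal _ (linearD _ _ _)).
    rewrite addrA; congr (_ + _).
    rewrite covectorE; apply: eq_bigr => i _; congr (_ * _).
    exact: ecoord_sumE.
  + exact: iB.
  have := (vintegrable_linear (covector z) (leb_measurable_itv _) iy).1.
  apply: eq_lintegrable => s.
  exact: etrans (covector_sym _ _) (covector_adjoint _ _ _).
- have cc : {within setT, continuous (@covector R E)}.
    by apply: continuous_subspaceT; exact: covector_continuous.
  exact: (within_comp cy (fun _ _ => I) cc).
move=> mu cmu.
pose ym t := representative (mu t).
have muE s v : covector (ym s) v = mu s v := representativeK (mu s) v.
have iym : vintegrable `[0, T] (fun s => adjoint s (ym s)).
  move=> i; have [h _ _] := cmu (ebasis i); apply: eq_lintegrable h => s.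
  by rewrite ecoord_adjoint muE.
have ymE t : 0 <= t <= T -> bvolterra T adjoint r ym t = ym t.
  move=> tT; have /andP[_ tT'] := tT; have tI : t \in `[0, T] by rewrite in_itv.
  rewrite /bvolterra /r addrA.
  rewrite [ym t](_ : _ = vint `[t, T] (fun s => adjoint s (ym s)) + vint `[t, T] bv +
    \sum_i (J_ i T - J_ i t) *: ebasis i)//.
  rewrite /vint -!big_split/=; apply: eq_bigr => i _; rewrite -!scalerDl; congr (_ *: _).
  have [_ _ /(_ t tI)[_ ->]] := cmu (ebasis i).
  rewrite (young_integralE tT' (J_i i t tT)); congr (_ + _ + _).
    by apply: eq_Rintegral => s _; rewrite ecoord_adjoint muE.
  by apply: eq_Rintegral => s _; rewrite ecoord_representative.
(* Continuity is not part of being a solution, but a solution equals the right-hand side of its own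
   equation, which is continuous; this opens the way to uniqueness among continuous solutions. *)
have cym : {within `[0, T], continuous ym}.
  have c1 : {within `[0, T], continuous (bvolterra T adjoint r ym)}.
    by move=> t; apply: cvgD; [exact: (vint_rest_continuous iym)|exact: cr].
  apply: subspace_eq_continuous c1 => t; rewrite inE /= in_itv/= => tT.
  exact: ymE.
have yy := bvolterra_unique T0 ib b0 bP adjoint_zero adjoint_measurable cr cy cym yE ymE.
move=> t; rewrite in_itv/= => tT; apply: clin_eqP => v.
by rewrite -muE (yy t tT).
Qed.

End Costate.

(** * Duality *)

Lemma double_le (R : realFieldType) (a b m : R) : a <= b -> b * 2 <= m -> a + a <= m.
Proof. lra. Qed.

Lemma duality_arith (R : realType) (lt ls ltz I I1 I2 I3 Iq Jt Js Jzt Jzs Qt Qs e1 e2 x : R) :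
  lt = ltz + I3 -> ltz = ls - I1 - I2 - (Jzt - Jzs) -> I = I3 - I1 - I2 + Iq ->
  Qt - Qs = Iq -> `|I| <= e1 -> `|Jt - Js - x| <= e2 -> `|Jzt - Jzs - x| <= e2 ->
  `|lt + Jt + Qt - (ls + Js + Qs)| <= e1 + (e2 + e2).
Proof.
move=> -> -> IE QE h1 h2 h3.
have -> : ls - I1 - I2 - (Jzt - Jzs) + I3 + Jt + Qt - (ls + Js + Qs) =
    I + ((Jt - Js - x) - (Jzt - Jzs - x)) by rewrite IE -QE; ring.
rewrite (le_trans (ler_normD _ _))// lerD// (le_trans (ler_normB _ _))//.
exact: lerD.
Qed.

Section Duality.
Context {R : realType} {E : normedVectType R} {d : nat}.

Hint Resolve leb_measurable_itv : core.

Variables (T : R) (eta : R -> 'rV[R]_d) (a : R -> R).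
Variables (A : R -> E -> E) (B : R -> 'L(E, R^o)) (D : R -> 'L(E, 'L('rV[R]_d, R^o))).
Hypothesis T0 : 0 < T.
Hypothesis ia : lintegrable `[0, T] a.
Hypothesis a0 : forall t, 0 <= t <= T -> 0 <= a t.
Hypothesis Alin : forall s, linear (A s).
Hypothesis Aa : forall s v, 0 <= s <= T -> `|A s v| <= a s * `|v|.
Hypothesis Ba : {ae leb, forall s : lebT R, `[0, T]%classic s -> `|B s| <= a s}.

Variables (lam : R -> 'L(E, R^o)) (k h : R -> E) (M : R) (b : R -> R).
Hypothesis lamC : costate T eta A B D lam.
Hypothesis clam : {within `[0, T], continuous lam}.
Hypothesis mk : vmeas `[0, T] k.
Hypothesis ka : forall s, 0 <= s <= T -> `|k s| <= a s.
Hypothesis hsol : volterra_sol T M b (fun s z => A s z + k s) h.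

Variables (th K : R) (w : R -> R -> R) (J : R -> R).
Hypothesis cw : control T w.
Hypothesis th1 : 1 < th.
Hypothesis K0 : 0 <= K.
Hypothesis Jh : forall s t, 0 <= s -> s <= t -> t <= T ->
  `|J t - J s - D s (h s) (eta t - eta s)| <= K * w s t `^ th.
Hypothesis Jz : forall z, `|z| <= M -> exists2 Z : R -> R,
  forall s t, 0 <= s -> s <= t -> t <= T ->
    `|Z t - Z s - D s z (eta t - eta s)| <= K * w s t `^ th &
  forall t, 0 <= t <= T -> is_young_integral t T (fun s => D s z) eta (Z T - Z t).

Let ch : {within `[0, T], continuous h}. Proof. by case: hsol. Qed.
Let hM s : 0 <= s <= T -> `|h s| <= M. Proof. by case: hsol => _ _ _ /(_ s). Qed.

Lemma lintegrable_B (y : R -> E) : {within `[0, T], continuous y} ->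
  lintegrable `[0, T] (fun s => B s (y s)).
Proof.
move=> cy; have [C C0 yC] := within_bounded cy.
have mB : lmeas `[0, T] (fun s => B s (y s)).
  have -> : (fun s => B s (y s)) = (fun s => \sum_i ecoord i (y s) * B s (ebasis i)).
    by apply/funext => s; exact: linear_ecoord.
  apply: measurable_sum => i; apply: measurable_funM.
    apply: leb_continuous.
    have ce : {within setT, continuous (@ecoord R E i)}.
      by apply: continuous_subspaceT; exact: ecoord_continuous.
    exact: (within_comp cy (fun _ _ => I) ce).
  by have [_ h1 _] := lamC (ebasis i); exact: lintegrable_measurable h1.
apply: (leb_le_integrable (leb_measurable_itv _) mB _
  (lintegrableZ C (leb_measurable_itv _) ia)).
apply: (leb_aeS Ba) => s hs sT; have := hs sT => Bs.
have sI : 0 <= s <= T by move: sT; rewrite /= in_itv.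
apply: (le_trans (opnormP _ _)); rewrite mulrC.
by apply: ler_pM => //; exact: yC.
Qed.

Lemma lintegrable_lam_k : lintegrable `[0, T] (fun s => lam s (k s)).
Proof.
have [C C0 lC] := within_bounded clam.
have ml : lmeas `[0, T] (fun s => lam s (k s)).
  have -> : (fun s => lam s (k s)) = (fun s => \sum_i ecoord i (k s) * lam s (ebasis i)).
    by apply/funext => s; exact: linear_ecoord.
  apply: measurable_sum => i; apply: measurable_funM; first exact: mk.
  apply: leb_continuous.
  have cb : {within `[0, T], continuous (fun _ : R => ebasis i : E)}.
    by move=> ?; exact: cvg_cst.
  exact: (within_clin_eval clam cb).
apply: (leb_le_integrable (leb_measurable_itv _) ml _
  (lintegrableZ C (leb_measurable_itv _) ia)).
apply: leb_aeT => s; rewrite /= in_itv/= => sT.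
apply: (le_trans (opnormP _ _)).
by apply: ler_pM => //; [exact: lC|exact: ka].
Qed.

Let q s := B s (h s) - lam s (k s).
Let iq : lintegrable `[0, T] q.
Proof. exact: (lintegrableB (leb_measurable_itv _) (lintegrable_B ch) lintegrable_lam_k). Qed.

Let Phi t := lam t (h t) + J t + \int[leb]_(s in `[0, t]) q s.

(** After cancellation four terms remain. Each contains an increment of [lam] or of [h], and its
    other factors are bounded by a multiple of [a]. *)
Let total_bound L e1 (s t r : R) : 0 <= r <= T -> `|B r| <= a r ->
  0 <= s <= T -> `|lam t| <= L -> `|lam t - lam r| <= e1 -> `|h r - h s| <= e1 ->
  `|lam t (A r (h r) + k r) - lam r (A r (h s)) - B r (h s) + q r|
    <= e1 * (L + M + 2) * a r.
Proof.
move=> rI Br sI lL ll hh; have ar := a0 rI.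
have M0 : 0 <= M := le_trans (normr_ge0 _) (hM sI).
have e10 : 0 <= e1 := le_trans (normr_ge0 _) ll.
have L0 : 0 <= L := le_trans (normr_ge0 _) lL.
pose As := GRing.isLinear.Build R E E *:%R (A r) (@Alin r).
pose Ar : {linear E -> E} := HB.pack (A r) As.
have AB z z' : A r (z - z') = A r z - A r z' := linearB Ar z z'.
have -> : lam t (A r (h r) + k r) - lam r (A r (h s)) - B r (h s) + q r =
    lam t (A r (h r - h s)) + (lam t - lam r) (A r (h s)) + (lam t - lam r) (k r) +
    B r (h r - h s).
  rewrite AB !linearB linearD /q.
  rewrite -[(lam t - lam r) (A r (h s))]/(lam t (A r (h s)) - lam r (A r (h s))).
  rewrite -[(lam t - lam r) (k r)]/(lam t (k r) - lam r (k r)).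
  ring.
have h1 : `|lam t (A r (h r - h s))| <= L * (a r * e1).
  apply: (le_trans (opnormP _ _)); apply: ler_pM => //.
  by apply: (le_trans (Aa _ rI)); apply: ler_wpM2l.
have h2 : `|(lam t - lam r) (A r (h s))| <= e1 * (a r * M).
  apply: (le_trans (opnormP _ _)); apply: ler_pM => //.
  by apply: (le_trans (Aa _ rI)); apply: ler_wpM2l => //; exact: hM.
have h3 : `|(lam t - lam r) (k r)| <= e1 * a r.
  by apply: (le_trans (opnormP _ _)); apply: ler_pM => //; exact: ka.
have h4 : `|B r (h r - h s)| <= a r * e1.
  by apply: (le_trans (opnormP _ _)); apply: ler_pM.
have -> : e1 * (L + M + 2) * a r =
  L * (a r * e1) + e1 * (a r * M) + e1 * a r + a r * e1 by ring.
by do 3 (apply: (le_trans (ler_normD _ _)); apply: lerD => //).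
Qed.

(** The function [Phi] is constant, while [h] vanishes at 0 and [lam] at [T]. An increment of
    [lam t (h t)] is split at [lam t (h s)]: one part uses the equation of [h] under the fixed
    functional [lam t], the other that of [lam] at the fixed vector [h s]. The Young term of the
    latter cancels the increment of [J] up to two sewing remainders, since both have the germ
    [D s (h s) (eta t - eta s)]. *)
Theorem costate_duality : J T - J 0 + \int[leb]_(s in `[0, T]) B s (h s) =
  \int[leb]_(s in `[0, T]) lam s (k s).
Proof.
have mT := leb_measurable_itv `[0, T].
have T00 := ltW T0.
(* The primitive of [a] is added to measure the Lebesgue part of the increments. *)
pose W s t := w s t + (primitive a t - primitive a s).
have cW : control T W := control_add cw (primitive_control ia a0).
have [L L0 lamL] := within_bounded clam.
have zI : (0 : R) <= 0 <= T by apply/andP; split.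
have tI : 0 <= T <= T by apply/andP; split.
have M0 : 0 <= M := le_trans (normr_ge0 _) (hM zI).
have [hE iG Gb _ _] := hsol.
have icut := cutoff_vintegrable iG.
suff PhiE : Phi 0 = Phi T.
  have h00 := volterra_sol0 T00 hsol.
  (* Over [[T, T]] the Lebesgue integrals vanish and the only dissection is the empty list. *)
  have lamT z : lam T z = 0.
    have [i1 i2 /(_ T)] := lamC z; rewrite in_itv/= T00 lexx => /(_ isT)[_ ->].
    rewrite (primitive_rest i1 T00 (lexx T)) (primitive_rest i2 T00 (lexx T)) !subrr.
    have zz : is_young_integral T T (fun s => D s z) eta (0 : R^o).
      move=> e e0; exists 1 => // s tau [ps ls] _.
      have s0 : size s = 0%N.
        case: s ps ls {tau} => // y s ps ls; have : T < T.
          have := order_path_min lt_trans ps => /allP hall.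
          have : last T (y :: s) \in y :: s by exact: (mem_last y s).
          by move=> /hall; rewrite (eqP ls).
        by rewrite ltxx.
      rewrite big1 ?subrr ?normr0// => j _; exfalso.
      by case: j => j; rewrite s0.
    by rewrite (young_integralE (lexx T) zz) !addr0.
  have := PhiE; rewrite /Phi h00 linear0 lamT (Rintegral_at0 T00 iq) add0r addr0 add0r.
  have -> : \int[leb]_(s in `[0, T]) q s = \int[leb]_(s in `[0, T]) B s (h s) -
      \int[leb]_(s in `[0, T]) lam s (k s).
    exact: (RintegralB mT (lintegrable_B ch) lintegrable_lam_k).
  move: (\int[leb]_(s in `[0, T]) B s (h s)) (\int[leb]_(s in `[0, T]) lam s (k s)).
  by move=> p q0 ->; ring.
apply: (eq_small_increments T0 cW (lexx 0) T00 (lexx T)) => e e0.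
have K20 : 0 < 2 * K + 1 by rewrite ltr_wpDl// mulr_ge0.
have [d1 d10 dP1] := control_small_powR cw th1 (divr_gt0 e0 K20).
have LM : 0 < L + M + 2 by rewrite addrAC ltr_wpDr// addr_gt0.
have e1 := divr_gt0 e0 LM.
have [d2 d20 dP2] := within_uniform clam e1.
have [d3 d30 dP3] := within_uniform ch e1.
exists (Num.min d1 (Num.min d2 d3)); first by rewrite !lt_min d10 d20.
move=> s t s0 st tT; rewrite !lt_min => /and3P[h1 h2 h3].
have tJ : 0 <= t <= T by rewrite (le_trans s0 st).
have sJ : 0 <= s <= T by rewrite s0 (le_trans st tT).
have t0 := le_trans s0 st; have sT := le_trans st tT.
have [Z Z1 Z2] := Jz (hM sJ).
have [i1 i2 lamE] := lamC (h s).
have sub : `]s, t]%classic `<=` `[0, T]%classic.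
  move=> r /=; rewrite !in_itv/= => /andP[sr rt].
  by rewrite (le_trans s0 (ltW sr)) (le_trans rt tT).
have ms := leb_measurable_itv `]s, t].
pose c r := cutoff T (fun s => A s (h s) + k s) r.
have [i3 _] := vintegrable_linear (lam t) mT icut.
have hprim r : 0 <= r <= T -> \int[leb]_(z in `[0, r]) lam t (c z) = lam t (h r).
  move=> /andP[r0 rT].
  have ir : vintegrable `[0, r] c.
    move=> i; apply: lintegrableS (icut i) => z /=; rewrite !in_itv/= => /andP[-> zr].
    exact: le_trans zr rT.
  by rewrite (vintegrable_linear (lam t) (leb_measurable_itv _) ir).2 [in RHS]hE.
pose total r := lam t (c r) - lam r (A r (h s)) - B r (h s) + q r.
have is1 : lintegrable `]s, t] (fun r => lam r (A r (h s))) by exact: lintegrableS i1.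
have is2 : lintegrable `]s, t] (fun r => B r (h s)) by exact: lintegrableS i2.
have is3 : lintegrable `]s, t] (fun r => lam t (c r)) by exact: lintegrableS i3.
have isq : lintegrable `]s, t] q by exact: lintegrableS iq.
have is31 := lintegrableB ms is3 is1.
have is312 := lintegrableB ms is31 is2.
have itot : lintegrable `]s, t] total := lintegrableD ms is312 isq.
have ias : lintegrable `]s, t] a by exact: lintegrableS ia.
have totE : \int[leb]_(r in `]s, t]) total r =
    \int[leb]_(r in `]s, t]) lam t (c r) - \int[leb]_(r in `]s, t]) lam r (A r (h s)) -
    \int[leb]_(r in `]s, t]) B r (h s) + \int[leb]_(r in `]s, t]) q r.
  rewrite (RintegralD ms is312 isq) (RintegralB ms is31 is2).
  by rewrite (RintegralB ms is3 is1).
have totL : `|\int[leb]_(r in `]s, t]) total r| <= e * (primitive a t - primitive a s).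
  rewrite (primitive_split ia s0 st tT) -(RintegralZl _ ms ias).
  apply: (leb_norm_Rintegral_le ms itot (lintegrableZ e ms ias)).
  apply: (leb_aeS Ba) => r Br rst; have rT := sub r rst.
  have rI : 0 <= r <= T by move: rT; rewrite /= in_itv.
  have rst' : s < r <= t by move: rst; rewrite /= in_itv.
  have /andP[sr rt] := rst'.
  rewrite /total /c cutoff_in//.
  have dl : `|lam t - lam r| <= e / (L + M + 2).
    apply/ltW/dP2 => //; rewrite ger0_norm ?subr_ge0//.
    by apply: le_lt_trans h2; rewrite lerB// ltW.
  have dh : `|h r - h s| <= e / (L + M + 2).
    apply/ltW/dP3 => //; rewrite ger0_norm ?subr_ge0 ?(ltW sr)//.
    by apply: le_lt_trans h3; rewrite lerB.
  have := total_bound rI (Br rT) sJ (lamL t tJ) dl dh.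
  by rewrite (mulrVK (unitf_gt0 LM)).
have e2 : K * w s t `^ th + K * w s t `^ th <= e * w s t.
  have := ler_wpM2l K0 (dP1 s t s0 st tT h1).
  have w0 := control_ge0 cw s0 st tT.
  move: (w s t `^ th) => z hz.
  have : K * (e / (2 * K + 1) * w s t) * 2 <= e * w s t.
    have -> : K * (e / (2 * K + 1) * w s t) * 2 = (2 * K) / (2 * K + 1) * (e * w s t).
      by ring.
    by rewrite ler_piMl ?mulr_ge0 ?(ltW e0)// ler_pdivrMr// mul1r lerDl.
  exact: double_le hz.
apply: (@le_trans _ _ (e * (primitive a t - primitive a s) +
  (K * w s t `^ th + K * w s t `^ th))); last first.
  have -> : e * W s t = e * (primitive a t - primitive a s) + e * w s t.
    exact: (etrans (mulrDr _ _ _) (addrC _ _)).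
  by rewrite lerD2l.
have tmem : t \in `[0, T] by rewrite in_itv.
have smem : s \in `[0, T] by rewrite in_itv.
have [_ lamt] := lamE t tmem; have [_ lams] := lamE s smem.
apply: (duality_arith (I3 := \int[leb]_(r in `]s, t]) lam t (c r))
  (ltz := lam t (h s)) _ _ totE _ totL (Jh s0 st tT) (Z1 s t s0 st tT)).
- rewrite -(primitive_split i3 s0 st tT) (hprim t tJ) (hprim s sJ).
  by rewrite addrC subrK.
- rewrite lamt lams (young_integralE tT (Z2 t tJ)) (young_integralE sT (Z2 s sJ)).
  rewrite (primitive_rest i1 t0 tT) (primitive_rest i1 s0 sT).
  rewrite (primitive_rest i2 t0 tT) (primitive_rest i2 s0 sT).
  rewrite -(primitive_split i1 s0 st tT) -(primitive_split i2 s0 st tT).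
  move: (\int[leb]_(r in `[0, T]) lam r (A r (h s)))
    (\int[leb]_(r in `[0, t]) lam r (A r (h s)))
    (\int[leb]_(r in `[0, s]) lam r (A r (h s)))
    (\int[leb]_(r in `[0, T]) B r (h s)) (\int[leb]_(r in `[0, t]) B r (h s))
    (\int[leb]_(r in `[0, s]) B r (h s)).
  by move=> *; ring.
- by rewrite (primitive_split iq s0 st tT).
Qed.

End Duality.

(** * Variation of the running cost *)

Section RunningCost.
Context {R : realType} {E : normedVectType R}.

Hint Resolve leb_measurable_itv : core.

Lemma segment_max (V : normedModType R) (F : V -> R^o) (x z : V) :
  (forall t : R, 0 <= t <= 1 -> differentiable F (x + t *: (z - x))) ->
  exists2 t : R, 0 <= t <= 1 &
    forall s : R, 0 <= s <= 1 -> `|F (x + s *: (z - x))| <= `|F (x + t *: (z - x))|.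
Proof.
move=> dF; pose h s : R := F (x + s *: (z - x)).
have c1 : {within `[0, 1], continuous h}.
  apply: derivable_within_continuous => t; rewrite in_itv/= => t01.
  by have [] := is_derive_line (dF t t01).
have c2 : {within `[0, 1], continuous (fun s => `|h s|)}.
  have cn : {within setT, continuous (fun z : R => `|z|)}.
    by apply: continuous_subspaceT; exact: norm_continuous.
  exact: (within_comp c1 (fun _ _ => I) cn).
have [t t01 tmax] := EVT_max ler01 c2.
exists t; first by move: t01; rewrite in_itv.
by move=> s s01; apply: tmax; rewrite in_itv.
Qed.

(* At a point z' of the segment where |F| is maximal, the mean value inequality gives
   |F z'| <= |F x| + (c |F z'| + del) rho, and c rho <= 1/2 absorbs the |F z'| on the
   right. *)
Lemma frechet_growth (V : normedModType R) (F : V -> R^o) (x : V) (c del rho : R) :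
  0 <= c -> 0 <= del -> 0 < rho -> c * rho <= 2^-1 ->
  (forall z, `|z - x| <= rho -> differentiable F z) ->
  (forall z, `|z - x| <= rho -> `|frechet F z| <= c * `|F z| + del) ->
  forall z, `|z - x| <= rho ->
    `|F z| <= 2 * `|F x| + 2 * (del * rho) /\
    `|F z - F x| <= (c * (2 * `|F x| + 2 * (del * rho)) + del) * `|z - x|.
Proof.
move=> c0 del0 rho0 crho dF DF.
have seg z t : `|z - x| <= rho -> 0 <= t <= 1 -> `|x + t *: (z - x) - x| <= rho.
  move=> zx /andP[t0 t1]; rewrite addrAC subrr add0r normrZ ger0_norm//.
  by rewrite (le_trans _ zx)// ler_piMl.
have mv z K : `|z - x| <= rho -> 0 <= K ->
    (forall t : R, 0 <= t <= 1 -> `|F (x + t *: (z - x))| <= K) ->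
    `|F z - F x| <= (c * K + del) * `|z - x|.
  move=> zx K0 FK; apply: mean_value_le => t t01; have sx := seg z t zx t01.
  split; first exact: dF.
  rewrite -frechetE; last exact: dF.
  rewrite (le_trans (opnormP _ _))// ler_wpM2r// (le_trans (DF _ sx))// lerD2r.
  by rewrite ler_wpM2l// FK.
have bnd z : `|z - x| <= rho -> `|F z| <= 2 * `|F x| + 2 * (del * rho).
  move=> zx; have [t t01 tmax] := segment_max (fun t t01 => dF _ (seg z t zx t01)).
  pose z' := x + t *: (z - x); have zx' : `|z' - x| <= rho := seg z t zx t01.
  have K0 : 0 <= `|F z'| by [].
  have h1 : `|F z' - F x| <= (c * `|F z'| + del) * `|z' - x|.
    apply: mv => // s /andP[s0 s1].
    have -> : x + s *: (z' - x) = x + (s * t) *: (z - x).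
      by rewrite /z' addrAC subrr add0r scalerA.
    apply: tmax; case/andP: t01 => t0 t1.
    by rewrite mulr_ge0//= mulr_ile1.
  have h2 : `|F z'| <= `|F x| + (c * `|F z'| + del) * rho.
    rewrite -(subrK (F x) (F z')) addrC (le_trans (ler_normD _ _))// lerD2l.
    rewrite addrC subrK (le_trans h1)// ler_wpM2l// addr_ge0// mulr_ge0//.
  have h3 : `|F z| <= `|F z'|.
    have := tmax 1; rewrite scale1r (addrC x) subrK; apply.
    by rewrite ler01 lexx.
  have h4 : c * rho * `|F z'| <= 2^-1 * `|F z'| by rewrite ler_wpM2r.
  apply: (le_trans h3).
  have h5 : (c * `|F z'| + del) * rho = c * rho * `|F z'| + del * rho by ring.
  move: h2 h4; rewrite h5; move: (c * rho * `|F z'|) (del * rho) => p q; lra.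
move=> z zx; split; first exact: bnd.
apply: mv => // [|t t01].
  by rewrite addr_ge0// mulr_ge0// mulr_ge0// ltW.
by apply: bnd; exact: seg.
Qed.

Lemma lmeasurable_norm (T : R) (u : R -> E) : lmeasurable 0 T u ->
  lmeas `[0, T] (fun t => `|u t|).
Proof.
move=> mu; have c1 : {within [set p : R * E | p.1 \in `[0, T] /\ setT p.2],
    continuous (fun p : R * E => `|p.2|)}.
  apply: continuous_subspaceT => p; apply: (@continuous_comp _ _ _ snd (fun z : E => `|z|)).
    exact: cvg_snd.
  exact: norm_continuous.
exact: (@caratheodory_measurable_ae R E T setT (fun _ v => `|v|) u c1 mu
  (leb_aeT (fun _ _ => I))).
Qed.

Lemma le1_powR (z r : R) : 0 <= z -> 1 <= r -> z <= 1 + z `^ r.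
Proof.
move=> z0 r1; have [z1|z1] := leP z 1.
  by rewrite (le_trans z1)// lerDl powR_ge0.
rewrite (@le_trans _ _ (z `^ r))// ?lerDr//.
by rewrite -[leLHS](powRr1 z0) ler_powR// ltW.
Qed.

End RunningCost.

(** * The minimum condition *)

Lemma nonpos_Rintegral_ae d (S : measurableType d) (R : realType)
    (mu : {measure set S -> \bar R}) (D : set S) (h : S -> R) : measurable D ->
  mu.-integrable D (EFin \o h) -> (forall t, D t -> h t <= 0) ->
  0 <= \int[mu]_(t in D) h t -> {ae mu, forall t, D t -> h t = 0}.
Proof.
move=> mD ih hneg hpos.
have absE : (\int[mu]_(t in D) `|(h t)%:E| = 0)%E.
  have ia : mu.-integrable D (EFin \o (fun t => `|h t|)) by exact: integrable_norm ih.
  have h1 : \int[mu]_(t in D) `|h t| = - \int[mu]_(t in D) h t.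
    rewrite -(mulN1r (\int[mu]_(t in D) h t)) -(RintegralZl (-1) mD ih).
    by apply: eq_Rintegral => t; rewrite inE => Dt; rewrite mulN1r ler0_norm// hneg.
  have h2 : \int[mu]_(t in D) `|h t| = 0.
    apply/eqP; rewrite eq_le; apply/andP; split; last by apply: Rintegral_ge0.
    by rewrite h1 oppr_le0.
  rewrite -[LHS]fineK; last exact: integrable_fin_num ia.
  by congr EFin.
have := (ae_eq_integral_abs mu mD (measurable_int _ ih)).1 absE.
by apply: filterS => t h0 Dt; have := h0 Dt => -[].
Qed.

Lemma cost_quotient_ge0 (R : realFieldType) (I0 I1 Y0 Y1 Q e : R) : 0 < e ->
  I0 + Y0 <= I1 + Y1 -> I1 <= I0 + e * Q -> 0 <= Q + e^-1 * (Y1 - Y0).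
Proof.
move=> e0 h1 h2.
have -> : Q + e^-1 * (Y1 - Y0) = e^-1 * (e * Q + (Y1 - Y0)).
  by rewrite [RHS]mulrDr mulrA mulVf ?mul1r// gt_eqF.
by rewrite mulr_ge0 ?invr_ge0 ?(ltW e0)//; lra.
Qed.

Lemma lerB_nonneg (R : realDomainType) (a b m : R) : 0 <= a -> b <= m -> - m <= a - b.
Proof. lra. Qed.

Lemma norm_between (R : realDomainType) (a b z : R) : 0 <= a -> - a <= z -> z <= b ->
  `|z| <= `|b| + a.
Proof.
move=> a0 az zb; rewrite ler_norml; have := ler_norm b; have := normr_ge0 b.
by move=> b0 bn; apply/andP; split; lra.
Qed.

(** * The variational inequality for the minimiser *)

Section MaximumPrinciple.
Context {R : realType} {E : normedVectType R} {d : nat}.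

Hint Resolve leb_measurable_itv : core.

Variables (T : R) (U : set E) (xi : E).
Variables (f : R -> E -> E) (g : R -> E -> 'L(E, E)).
Variables (phi : R -> E -> E -> R) (psi : R -> E -> 'L('rV[R]_d, R^o)).
Variables (kappa kappa' Cphi delta p rho c : R) (dd : R -> R).
Variables (eta : R -> 'rV[R]_d) (x u : R -> E).
Hypothesis T0 : 0 < T.
Hypothesis f_cont : {within [set p : R * E | p.1 \in `[0, T]],
  continuous (fun p => f p.1 p.2)}.
Hypothesis g_cont : {within [set p : R * E | p.1 \in `[0, T]],
  continuous (fun p => g p.1 p.2)}.
Hypothesis kappa_gt : 2^-1 < kappa.
Hypothesis psi_holder : forall M : R, 0 <= M -> exists K : R,
  holder_on [set p : R * E | p.1 \in `[0, T] /\ `|p.2| <= M] kappa K psi.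
Hypothesis U_convex : convex_set U.
Hypothesis phi_cont : {within [set p : R * E * E | p.1.1 \in `[0, T] /\ U p.2],
  continuous (fun p => phi p.1.1 p.1.2 p.2)}.
Hypothesis phi_convex : forall (t : R) (y : E), t \in `[0, T] -> convex_function U (phi t y).
Hypothesis Cphi_gt0 : 0 < Cphi.
Hypothesis delta_gt0 : 0 < delta.
Hypothesis p_gt1 : 1 < p.
Hypothesis phi_coercive : forall (t : R) (y v : E), t \in `[0, T] -> U v ->
  Cphi * (`|v| `^ p - `|y| `^ delta) <= phi t y v.
Hypothesis f_diff : forall (t : R) (y : E), t \in `[0, T] -> differentiable (f t) y.
Hypothesis Df_cont : {within [set p : R * E | p.1 \in `[0, T]],
  continuous (fun p => Df f p.1 p.2)}.
Hypothesis g_diff : forall (t : R) (y : E), t \in `[0, T] -> differentiable (g t) y.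
Hypothesis Dg_cont : {within [set p : R * E | p.1 \in `[0, T]],
  continuous (fun p => Dg g p.1 p.2)}.
Hypothesis phi_diff : forall (t : R) (y v : E), t \in `[0, T] -> U v ->
  differentiable (fun z => phi t z v : R^o) y.
Hypothesis Dphi_cont : {within [set p : R * E * E | p.1.1 \in `[0, T] /\ U p.2],
  continuous (fun p => Dphi phi p.1.1 p.1.2 p.2)}.
Hypothesis rho_gt0 : 0 < rho.
Hypothesis c_ge0 : 0 <= c.
Hypothesis dd_ge0 : forall t : R, t \in `[0, T] -> 0 <= dd t.
Hypothesis dd_int : leb.-integrable `[0, T] (fun t => (dd t)%:E).
Hypothesis Dphi_bound : forall y v : R -> E, admissible T U xi f g phi psi eta y v ->
  {ae leb, forall t : R, t \in `[0, T] -> forall z : E, `|z - y t| <= rho ->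
    `|Dphi phi t z (v t)| <= c * `|phi t z (v t)| + dd t}.
Hypothesis psi_diff : forall (t : R) (y : E), t \in `[0, T] -> differentiable (psi t) y.
Hypothesis kappa'_gt : 2^-1 < kappa'.
Hypothesis Dpsi_holder :
  locally_holder_on [set p : R * E | p.1 \in `[0, T]] kappa' (Dpsi psi).
Hypothesis eta_obs : observation_path T eta.
Hypothesis xu_min : global_minimiser T U xi f g phi psi eta x u.

Let mT : measurable (`[0, T]%classic : set (lebT R)) := leb_measurable_itv _.

(* eta has finite variation of order iota^-1 > 2, and kap + iota > 1 is Young's
   condition. *)
Let kap := Num.min kappa (Num.min kappa' 1).
Let iota := 3 / 4 - kap / 2.

Let exponents : [/\ 2^-1 < kap, kap <= kappa, kap <= kappa' & kap <= 1].
Proof.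
rewrite /kap; split.
- by rewrite !lt_min kappa_gt kappa'_gt/= invf_lt1// ltr1n.
- by rewrite ge_min lexx.
- by rewrite !ge_min lexx orbT.
- by rewrite !ge_min lexx !orbT.
Qed.

(** [iota] is the midpoint of 1 - kap and 1/2, an interval that is non-empty because kap > 1/2. *)
Let exponents_iota : [/\ 0 < kap, 0 < iota, iota < 2^-1 & 1 < kap + iota].
Proof.
have [+ _ _ +] := exponents; rewrite /iota; move: kap => k; split; lra.
Qed.

Let mu : lmeasurable 0 T u. Proof. by case: xu_min => -[[[]]]. Qed.
Let xu_state : solves_state_eq xi f g T x u. Proof. by case: xu_min => -[[[]]]. Qed.
Let ax : abs_continuous 0 T x. Proof. by case: xu_state. Qed.
Let cx : {within `[0, T], continuous x}. Proof. exact: abs_continuous_within ax. Qed.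
Let uU : {ae leb, forall t : lebT R, `[0, T]%classic t -> U (u t)}.
Proof. by case: xu_min => -[[_ h]]. Qed.
Let iphi : lintegrable `[0, T] (fun t => phi t (x t) (u t)).
Proof. by case: xu_min => -[_ []]. Qed.

Let along_curve (W : normedModType R) (F : R -> E -> E -> W) (y : R -> E) :
  {within [set p : R * E * E | p.1.1 \in `[0, T] /\ U p.2],
    continuous (fun p => F p.1.1 p.1.2 p.2)} ->
  {within `[0, T], continuous y} ->
  {within [set p : R * E | p.1 \in `[0, T] /\ U p.2],
    continuous (fun p => F p.1 (y p.1) p.2)}.
Proof.
move=> cF cy; set D := [set p : R * E | _].
have c1 : {within D, continuous (fun p : R * E => p.1)}.
  by apply: continuous_subspaceT => q; exact: cvg_fst.
have c2 : {within D, continuous (fun p : R * E => p.2)}.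
  by apply: continuous_subspaceT => q; exact: cvg_snd.
have c3 : {within D, continuous (fun p : R * E => y p.1)}.
  by apply: (@within_comp _ _ _ _ `[0, T]%classic y fst) => // q [].
have h (q : R * E) : D q -> [set p : R * E * E | p.1.1 \in `[0, T] /\ U p.2]
  ((q.1, y q.1), q.2) by [].
exact: (within_comp (within_pair (within_pair c1 c3) c2) h cF).
Qed.

Let phi_measurable (y v : R -> E) : {within `[0, T], continuous y} ->
  lmeasurable 0 T v -> {ae leb, forall t : lebT R, `[0, T]%classic t -> U (v t)} ->
  lmeas `[0, T] (fun t => phi t (y t) (v t)).
Proof.
move=> cy mv Uv.
exact: (@caratheodory_measurable_ae R E T U (fun t w => phi t (y t) w) v
  (along_curve phi_cont cy) mv Uv).
Qed.

(** Coercivity bounds |u|^p by a multiple of the integrable running cost plus a bounded function,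
    and |u| <= 1 + |u|^p. *)
Lemma control_integrable : lintegrable `[0, T] (fun t => `|u t|).
Proof.
have [Mx Mx0 xM] := within_bounded cx.
have m1 : lmeas `[0, T] (fun _ : R => 1 + Mx `^ delta : R) by exact: measurable_cst.
have i1 : lintegrable `[0, T] (fun _ : R => 1 + Mx `^ delta : R).
  by apply: (leb_bounded_integrable m1 (M := `|1 + Mx `^ delta|)).
apply: (leb_le_integrable mT (lmeasurable_norm mu) _
  (lintegrableD mT (lintegrableZ Cphi^-1 mT iphi) i1)).
apply: (leb_aeS uU) => t Ut tT; have := Ut tT => Uut.
have tI : t \in `[0, T] by exact: tT.
have tI' : 0 <= t <= T by rewrite in_itv in tI.
have := phi_coercive (x t) tI Uut; rewrite mulrC -ler_pdivlMr// mulrC => h1.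
have h2 : `|x t| `^ delta <= Mx `^ delta.
  by apply: ge0_ler_powR; rewrite ?nnegrE ?(ltW delta_gt0) ?(ltW Mx0)// xM.
have h3 := le1_powR (normr_ge0 (u t)) (ltW p_gt1).
rewrite ger0_norm//; move: h1 h2 h3.
move: (Cphi^-1 * _) (`|u t| `^ p) (`|x t| `^ delta) (Mx `^ delta) => q1 q2 q3 q4; lra.
Qed.

(** At most the radius of the growth condition, and small enough for [c * rho1 <= 1/2], as
    [frechet_growth] demands; [c + 1] avoids a division by 0. *)
Let rho1 := Num.min rho (2 * (c + 1))^-1.

Let rho1_prop : [/\ 0 < rho1, rho1 <= rho & c * rho1 <= 2^-1].
Proof.
have c1 : 0 < 2 * (c + 1) by rewrite mulr_gt0// ltr_wpDl.
rewrite /rho1; split.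
- by rewrite lt_min rho_gt0 invr_gt0.
- by rewrite ge_min lexx.
apply: (@le_trans _ _ (c * (2 * (c + 1))^-1)).
  by rewrite ler_wpM2l// ge_min lexx orbT.
by rewrite ler_pdivrMr// mulrA mulVf// mul1r lerDl.
Qed.

(** The bounds of [frechet_growth] along the minimiser: [growth] for the values of [phi] in the tube
    of radius [rho1], and [dominant] for their variation there. Both are integrable because the
    running cost and [dd] are. *)
Definition growth t := 2 * `|phi t (x t) (u t)| + 2 * (dd t * rho1).
Definition dominant t := c * growth t + dd t.

Let dd_meas : lintegrable `[0, T] dd := dd_int.

Lemma growth_integrable : lintegrable `[0, T] growth.
Proof.
apply: lintegrableD => //; first exact: (lintegrableZ 2 mT (integrable_norm iphi)).
apply: (lintegrableZ 2 mT); apply: eq_lintegrable (lintegrableZ rho1 mT dd_meas).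
by move=> t; rewrite mulrC.
Qed.

Lemma dominant_integrable : lintegrable `[0, T] dominant.
Proof. exact: (lintegrableD mT (lintegrableZ c mT growth_integrable) dd_meas). Qed.

Lemma growth_ge0 t : 0 <= t <= T -> 0 <= growth t.
Proof.
move=> tT; have [r0 _ _] := rho1_prop.
by rewrite addr_ge0 ?mulr_ge0 ?(ltW r0)// dd_ge0// in_itv.
Qed.

Lemma dominant_ge0 t : 0 <= t <= T -> 0 <= dominant t.
Proof.
by move=> tT; rewrite addr_ge0 ?mulr_ge0 ?growth_ge0// dd_ge0// in_itv.
Qed.

(** The growth condition is invoked for the minimiser itself. Perturbed trajectories are covered as
    points of the tube around [x], the control still being [u]. *)
Lemma phi_growth : {ae leb, forall t : lebT R, `[0, T]%classic t ->
  [/\ U (u t), `|Dphi phi t (x t) (u t)| <= dominant t &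
    forall z, `|z - x t| <= rho1 -> `|phi t z (u t)| <= growth t /\
      `|phi t z (u t) - phi t (x t) (u t)| <= dominant t * `|z - x t|]}.
Proof.
have [r0 r1 cr] := rho1_prop.
apply: (leb_aeS (leb_aeI uU (Dphi_bound xu_min.1))) => t [Ut Dt] tT.
have Uut := Ut tT; have tI : t \in `[0, T] by exact: tT.
have tI' : 0 <= t <= T by rewrite in_itv in tI.
have h := @frechet_growth R E (fun z => phi t z (u t) : R^o) (x t) c (dd t) rho1 c_ge0
  (dd_ge0 tI) r0 cr (fun z _ => phi_diff z tI Uut)
  (fun z zx => Dt tI z (le_trans zx r1)).
have xx : `|x t - x t| <= rho by rewrite subrr normr0 ltW.
split=> [//||z zx]; last exact: h.
apply: (le_trans (Dt tI (x t) xx)); rewrite /dominant lerD2r ler_wpM2l//.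
have : 0 <= dd t * rho1 by rewrite mulr_ge0 ?(ltW r0)// dd_ge0.
have : 0 <= `|phi t (x t) (u t)| by [].
rewrite /growth; move: (`|phi _ _ _|) (dd t * rho1) => a1 a2; lra.
Qed.


(** The linearised field without its inhomogeneity: the operator [A] of the abstract costate
    equation. *)
Let lin0 s z := Df f s (x s) z + Dg g s (x s) z (u s).

Let lin0_linear s : linear (lin0 s).
Proof.
move=> a v v'; rewrite /lin0 linearP.
have -> : Dg g s (x s) (a *: v + v') (u s) =
    a *: Dg g s (x s) v (u s) + Dg g s (x s) v' (u s) by rewrite linearP.
by rewrite addrACA -scalerDr.
Qed.

Let lin0_bound : exists2 L, 0 <= L & forall s, 0 <= s <= T ->
  (forall v, `|lin0 s v| <= L * (1 + `|u s|) * `|v|) /\ `|g s (x s)| <= L.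
Proof.
have [L3 L30 L3P] := tube_bounded 1 cx g_cont.
have [L4 L40 L4P] := tube_bounded 1 cx Df_cont.
have [L5 L50 L5P] := tube_bounded 1 cx Dg_cont.
have z1 : `|0 : E| <= 1 by rewrite normr0.
exists (L3 + L4 + L5) => [|s sT]; first by rewrite !addr_ge0// ltW.
have := L3P s 0 sT z1; have := L4P s 0 sT z1; have := L5P s 0 sT z1.
rewrite !addr0 => h5 h4 h3; split=> [v|].
  have h1 : `|Df f s (x s) v| <= L4 * `|v|.
    by rewrite (le_trans (opnormP _ _))// ler_wpM2r.
  have h2 : `|Dg g s (x s) v (u s)| <= L5 * `|v| * `|u s|.
    rewrite (le_trans (opnormP _ _))// ler_wpM2r//.
    by rewrite (le_trans (opnormP _ _))// ler_wpM2r.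
  apply: (le_trans (ler_normD _ _)); apply: (le_trans (lerD h1 h2)).
  have ring_id (l3 l4 l5 n m : R) : (l3 + l4 + l5) * (1 + n) * m =
    l4 * m + l5 * m * n + (l3 * m + l5 * m + l3 * n * m + l4 * n * m) by ring.
  by rewrite ring_id lerDl !addr_ge0// !mulr_ge0// ltW.
by rewrite (le_trans h3)// -addrA lerDl addr_ge0// ltW.
Qed.

Let lin0_measurable v : vmeas `[0, T] (fun s => lin0 s v).
Proof.
have m0 : lmeasurable 0 T (fun _ : R => 0 : E) by exact: measurable_cst.
have cv : {within `[0, T], continuous (fun _ : R => v)} by move=> ?; exact: cvg_cst.
move=> i; have := lin_measurable g_cont Df_cont Dg_cont cx mu m0 cv i.
congr (measurable_fun _ _); apply/funext => s.
by rewrite /lin linear0 addr0.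
Qed.

Let Dphi_integrable z : lintegrable `[0, T] (fun s => Dphi phi s (x s) (u s) z).
Proof.
have cz : {within [set p : R * E | p.1 \in `[0, T] /\ U p.2],
    continuous (fun _ : R * E => z)} by move=> ?; exact: cvg_cst.
have cD := within_clin_eval (along_curve Dphi_cont cx) cz.
have mD := @caratheodory_measurable_ae R E T U (fun t w => Dphi phi t (x t) w z) u cD mu uU.
apply: (leb_le_integrable mT mD _ (lintegrableZ `|z| mT dominant_integrable)).
apply: (leb_aeS phi_growth) => t h tT; have [_ Dt _] := h tT.
by rewrite (le_trans (opnormP _ _))// mulrC ler_wpM2l.
Qed.

(** Time, the given paths and [eta] are dominated by one control, so that their Hoelder estimates
    can be combined. *)
Let eta_control (w0 : R -> R -> R) : control T w0 ->
  exists2 w, control T w & forall s t, 0 <= s -> s <= t -> t <= T ->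
    [/\ t - s <= w s t, w0 s t <= w s t & `|eta t - eta s| <= w s t `^ iota].
Proof.
move=> cw0; have [_ i0 i1 _] := exponents_iota.
have ct : control T (fun s t : R => t - s).
  apply: (@control_increments _ T id) => //.
  by apply: continuous_subspaceT => t; exact: cvg_id.
have [w cw wP] := observation_control T0 eta_obs (control_add ct cw0) i0 i1.
exists w => // s t s0 st tT; have [h1 h2] := wP s t s0 st tT.
have h3 := control_ge0 cw0 s0 st tT.
have h4 : 0 <= t - s by rewrite subr_ge0.
by split=> //; apply: le_trans h1; rewrite ?lerDl ?lerDr.
Qed.

Lemma costate_wellposed : exists lam, [/\ costate_eq T f g phi psi eta x u lam,
  {within `[0, T], continuous lam} &
  forall mu, costate_eq T f g phi psi eta x u mu ->
    forall t, t \in `[0, T] -> mu t = lam t].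
Proof.
have [k0 i0 i1 ki1] := exponents_iota; have [_ _ kk' k1] := exponents.
have k'0 : 0 < kappa' := lt_le_trans k0 kk'.
have [L L0 LP] := lin0_bound.
have m1 : lmeas `[0, T] (fun _ : R => 1 : R) by exact: measurable_cst.
have i_1 : lintegrable `[0, T] (fun _ : R => 1 : R).
  by apply: (leb_bounded_integrable m1 (M := 1)) => t _; rewrite normr1.
have ia : lintegrable `[0, T] (fun s => L * (1 + `|u s|)).
  exact: (lintegrableZ L mT (lintegrableD mT i_1 control_integrable)).
have a0 t : 0 <= t <= T -> 0 <= L * (1 + `|u t|).
  by move=> _; rewrite mulr_ge0// addr_ge0.
apply: (costate_exists_unique T0 ia a0 lin0_linear
  (fun s v sT => (LP s sT).1 v) lin0_measurable Dphi_integrable) => z.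
have [Mx Mx0 xM] := within_bounded cx.
have [wx cwx xw] := abs_continuous_control T0 ax.
have [w cw wP] := eta_control cwx.
have [K K0 [DK DH]] := locally_holder_ball (Mx + `|z|) k'0 Dpsi_holder.
have tw s t : 0 <= s -> s <= t -> t <= T -> t - s <= w s t.
  by move=> s0 st tT; have [] := wP s t s0 st tT.
have etaw s t : 0 <= s -> s <= t -> t <= T -> `|eta t - eta s| <= w s t `^ iota.
  by move=> s0 st tT; have [] := wP s t s0 st tT.
have xw' s t : 0 <= s -> s <= t -> t <= T -> `|x t - x s| <= w s t.
  move=> s0 st tT; apply: (le_trans (xw s t s0 st tT)).
  by have [] := wP s t s0 st tT.
have xM' t : 0 <= t <= T -> `|x t| <= (Mx + `|z|) - `|z| by rewrite addrK; exact: xM.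
have [Z Z1 Z2] := young_constant T0 cw k0 k1 i0 ki1 tw etaw kk' K0 (normr_ge0 z)
  DK DH xM' (lexx _) xw'.
exists Z => //.
have C0 := quotient_cst_ge0 T kap w kappa' K0 (normr_ge0 z).
apply: (young_primitive_continuous T0 cw ki1 (sewing_cst_ge0 ki1 C0) eta_obs.1 _ Z1
  (C := K * `|z|)) => s sT.
rewrite (le_trans (opnormP _ _))// ler_wpM2r// DK//.
by rewrite (le_trans (xM s sT))// lerDl.
Qed.


Section Spike.
Variables (S : set R) (v0 : E).
Hypothesis mS : measurable (S : set (lebT R)).
Hypothesis Uv0 : U v0.

Let k := spike S v0 u.

Lemma phi_fixed_control (y : R -> E) : {within `[0, T], continuous y} ->
  lmeas `[0, T] (fun t => phi t (y t) v0).
Proof.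
move=> cy; apply: (phi_measurable cy (v := fun _ => v0)); first exact: measurable_cst.
exact: leb_aeT.
Qed.

Let jump y t : R := if t \in S then phi t (y t) v0 - phi t (y t) (u t) else 0.

Let jump_measurable (y : R -> E) : {within `[0, T], continuous y} ->
  lmeas `[0, T] (jump y).
Proof.
move=> cy; apply: (leb_measurable_patch mS); last exact: measurable_cst.
by apply: measurable_funB; [exact: phi_fixed_control|exact: (phi_measurable cy mu uU)].
Qed.

(** The control [u + e_ n *: k] never enters a limit: by convexity its cost is below the chord from
    [u] to [v0]. The quotients [q n] involve just [u], where [growth] and [dominant] apply, and the
    fixed [v0], for which [phi] is bounded on the compact tube. *)
Lemma running_cost_variation (M : R) (e_ : nat -> R) (y_ : nat -> R -> E) (h : R -> E) :
  (forall n, [/\ 0 < e_ n, e_ n <= 1 & e_ n * M <= rho1]) ->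
  e_ n @[n --> \oo] --> (0 : R) ->
  (forall n, {within `[0, T], continuous (y_ n)}) ->
  (forall n t, 0 <= t <= T -> `|y_ n t| <= M) ->
  (forall t, 0 <= t <= T -> y_ n t @[n --> \oo] --> h t) ->
  lintegrable `[0, T] (fun t => Dphi phi t (x t) (u t) (h t)) ->
  exists Q : nat -> R, [/\ forall n,
      {ae leb, forall t : lebT R, `[0, T]%classic t -> U (u t + e_ n *: k t)} /\
      lintegrable `[0, T] (fun t => phi t (x t + e_ n *: y_ n t) (u t + e_ n *: k t)),
    forall n,
      \int[leb]_(t in `[0, T]) phi t (x t + e_ n *: y_ n t) (u t + e_ n *: k t) <=
      \int[leb]_(t in `[0, T]) phi t (x t) (u t) + e_ n * Q n,
    lintegrable `[0, T] (jump x) &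
    Q n @[n --> \oo] --> \int[leb]_(t in `[0, T]) Dphi phi t (x t) (u t) (h t) +
      \int[leb]_(t in `[0, T]) jump x t].
Proof.
move=> e01 ecvg cy yM ycvg iDh.
have [r0 r1 cr] := rho1_prop.
have [Mx Mx0 xM] := within_bounded cx.
have cphi0 : {within [set p : R * E | p.1 \in `[0, T]],
    continuous (fun p => phi p.1 p.2 v0)}.
  have c1 : {within [set p : R * E | p.1 \in `[0, T]], continuous (fun p : R * E => (p, v0))}.
    by apply: continuous_subspaceT => q; exact: (cvg_pair cvg_id (cvg_cst _)).
  by apply: (within_comp c1 _ phi_cont) => q /= qT; split.
have [Lv Lv0 LvP] :=
  @tube_bounded R E R^o T x (fun t z => phi t z v0) rho1 cx cphi0.
pose xn n t := x t + e_ n *: y_ n t.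
have cxn n : {within `[0, T], continuous (xn n)}.
  by move=> t; apply: cvgD; [exact: cx|apply: cvgZl_tmp; exact: cy].
have en0 n : 0 < e_ n by have [] := e01 n.
have en1 n : e_ n <= 1 by have [] := e01 n.
have xnx n t : 0 <= t <= T -> `|e_ n *: y_ n t| <= rho1.
  move=> tT; have [e0 _ eM] := e01 n; rewrite normrZ gtr0_norm//.
  by apply: le_trans eM; rewrite ler_wpM2l ?(ltW e0)// yM.
have xnx' n t : 0 <= t <= T -> `|xn n t - x t| <= rho1.
  by move=> tT; rewrite /xn addrAC subrr add0r xnx.
have Un n : {ae leb, forall t : lebT R, `[0, T]%classic t -> U (u t + e_ n *: k t)}.
  apply: (leb_aeS uU) => t Ut tT; rewrite /k /spike; case: ifP => _.
    by apply: convex_set_segment => //; [exact: Ut|exact: ltW].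
  by rewrite scaler0 addr0; exact: Ut.
pose q n t := (e_ n)^-1 * (phi t (xn n t) (u t) - phi t (x t) (u t)) + jump (xn n) t.
(* [dominant t * M] is for the quotient in the state, [Lv + growth t] for the jump of the
   control. *)
pose dom t := dominant t * M + (Lv + growth t).
have idom : lintegrable `[0, T] dom.
  have m1 : lmeas `[0, T] (fun _ : R => Lv : R) by exact: measurable_cst.
  have i1 : lintegrable `[0, T] (fun _ : R => Lv : R).
    by apply: (leb_bounded_integrable m1 (M := `|Lv|)).
  apply: (lintegrableD mT _ (lintegrableD mT i1 growth_integrable)).
  by apply: eq_lintegrable (lintegrableZ M mT dominant_integrable) => t; rewrite mulrC.
have jumpL y t : 0 <= t <= T -> `|y t - x t| <= rho1 ->
    `|phi t (y t) (u t)| <= growth t -> `|jump y t| <= Lv + growth t.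
  move=> tT yx yg; rewrite /jump; case: ifP => _; last first.
    by rewrite normr0 addr_ge0 ?(ltW Lv0)// growth_ge0.
  apply: (le_trans (ler_normB _ _)); apply: lerD => //.
  by have := LvP t (y t - x t) tT yx; rewrite addrC subrK.
have qdom : {ae leb, forall t : lebT R, `[0, T]%classic t -> forall n, `|q n t| <= dom t}.
  apply: (leb_aeS phi_growth) => t gt tT n; have [_ _ gz] := gt tT.
  have tI : 0 <= t <= T by move: tT; rewrite /= in_itv.
  have [g1 g2] := gz (xn n t) (xnx' n t tI).
  apply: (le_trans (ler_normD _ _)); apply: lerD; last exact: jumpL (xnx' n t tI) g1.
  rewrite normrM gtr0_norm ?invr_gt0// mulrC ler_pdivrMr//.
  apply: (le_trans g2); rewrite -mulrA ler_wpM2l ?dominant_ge0//.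
  rewrite /xn addrAC subrr add0r normrZ gtr0_norm// mulrC ler_wpM2r ?(ltW (en0 n))//.
  exact: yM.
have mq n : lmeas `[0, T] (q n).
  apply: measurable_funD; last exact: jump_measurable.
  apply: measurable_funM; first exact: measurable_cst.
  by apply: measurable_funB; [exact: (phi_measurable (cxn n) mu uU)|exact: (phi_measurable cx mu uU)].
have iq n : lintegrable `[0, T] (q n).
  apply: (leb_le_integrable mT (mq n) _ idom).
  by apply: (leb_aeS qdom) => t h1 h2; exact: h1.
have ijump : lintegrable `[0, T] (jump x).
  apply: (leb_le_integrable mT (jump_measurable cx) _ idom).
  apply: (leb_aeS phi_growth) => t gt tT; have [_ _ gz] := gt tT.
  have tI : 0 <= t <= T by move: tT; rewrite /= in_itv.
  have xx : `|x t - x t| <= rho1 by rewrite subrr normr0 ltW.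
  apply: (le_trans (jumpL x t tI xx (gz _ xx).1)).
  have M0 : 0 <= M := le_trans (normr_ge0 _) (yM 0%N t tI).
  by rewrite /dom lerDr mulr_ge0// dominant_ge0.
have qcvg : {ae leb, forall t : lebT R, `[0, T]%classic t -> q n t @[n --> \oo] -->
    Dphi phi t (x t) (u t) (h t) + jump x t}.
  apply: (leb_aeS uU) => t Ut tT; have Uut := Ut tT.
  have tI : 0 <= t <= T by move: tT; rewrite /= in_itv.
  have xc : xn n t @[n --> \oo] --> x t.
    rewrite -[X in _ --> X]addr0 -(scale0r (h t)).
    by apply: cvgD; [exact: cvg_cst|apply: cvgZ => //; exact: ycvg].
  have cphi v (Uv : U v) : phi t (xn n t) v @[n --> \oo] --> phi t (x t) v.
    exact: (cvg_comp _ _ xc (differentiable_continuous (phi_diff (x t) tT Uv))).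
  apply: cvgD; first exact: (differentiable_cvg (phi_diff (x t) tT Uut) en0 ecvg (ycvg t tI)).
  rewrite /jump; case: (t \in S); last exact: cvg_cst.
  by apply: cvgB; exact: cphi.
have iq0 := lintegrableD mT iDh ijump.
have [_ Qcvg] := dominated_Rintegral mT mq (lintegrable_measurable iq0) qcvg idom qdom.
have phin_le n : {ae leb, forall t : lebT R, `[0, T]%classic t ->
    phi t (xn n t) (u t + e_ n *: k t) <= phi t (x t) (u t) + e_ n * q n t}.
  apply: (leb_aeS uU) => t Ut tT; have Uut := Ut tT.
  have -> : phi t (x t) (u t) + e_ n * q n t = phi t (xn n t) (u t) + e_ n * jump (xn n) t.
    rewrite /q mulrDr mulrA divff ?gt_eqF// mul1r addrA; congr (_ + _).
    by rewrite addrC subrK.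
  rewrite /k /spike /jump; case: ifP => _; last by rewrite scaler0 mulr0 !addr0.
  exact: (convex_function_segment (phi_convex (xn n t) tT) Uut Uv0 (ltW (en0 n)) (en1 n)).
have iup n := lintegrableD mT iphi (lintegrableZ (e_ n) mT (iq n)).
(* The perturbed running cost is bounded above by an integrable function through convexity and below
   by [- B0] through coercivity, so it is integrable. *)
have iphin n : lintegrable `[0, T] (fun t => phi t (xn n t) (u t + e_ n *: k t)).
  have mphin := phi_measurable (cxn n) (spike_control v0 (e_ n) mS mu) (Un n).
  pose B0 := Cphi * (Mx + rho1) `^ delta.
  have m1 : lmeas `[0, T] (fun _ : R => B0 : R) by exact: measurable_cst.
  have i1 : lintegrable `[0, T] (fun _ : R => B0 : R).
    by apply: (leb_bounded_integrable m1 (M := `|B0|)).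
  apply: (leb_le_integrable mT mphin _ (lintegrableD mT (integrable_norm (iup n)) i1)).
  apply: (leb_aeS (leb_aeI (Un n) (phin_le n))) => t [Ut ple] tT.
  have tI : 0 <= t <= T by move: tT; rewrite /= in_itv.
  have h1 := ple tT; have h2 := phi_coercive (xn n t) tT (Ut tT).
  have h3 : `|xn n t| `^ delta <= (Mx + rho1) `^ delta.
    apply: ge0_ler_powR; rewrite ?nnegrE ?(ltW delta_gt0) ?addr_ge0 ?(ltW Mx0) ?(ltW r0)//.
    by rewrite (le_trans (ler_normD _ _))// lerD ?xM ?xnx.
  have h4 : - B0 <= phi t (xn n t) (u t + e_ n *: k t).
    apply: le_trans h2; rewrite -mulrN; apply: ler_wpM2l; first exact: ltW.
    exact: lerB_nonneg (powR_ge0 _ _) h3.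
  have B00 : 0 <= B0 by rewrite mulr_ge0 ?powR_ge0// ltW.
  exact: norm_between B00 h4 h1.
exists (fun n => \int[leb]_(t in `[0, T]) q n t); split=> [n|n||].
- by split; [exact: Un|exact: iphin].
- have h1 := leb_le_Rintegral mT (iphin n) (iup n) (phin_le n).
  apply: (le_trans h1); rewrite (RintegralD mT iphi (lintegrableZ (e_ n) mT (iq n))).
  by rewrite (RintegralZl _ mT (iq n)).
- exact: ijump.
- by have := Qcvg; rewrite (RintegralD mT iDh ijump).
Qed.

Lemma volterra_sol_increment M b (G : R -> E -> E) y s t : lintegrable `[0, T] b ->
  volterra_sol T M b G y -> 0 <= s -> s <= t -> t <= T ->
  `|y t - y s| <= @vintK R E * (primitive b t - primitive b s).
Proof.
move=> ib [yE iG Gb _ _] s0 st tT; rewrite yE.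
apply: (vint_increment_le (cutoff_vintegrable iG) ib _ s0 st tT) => r rT.
by rewrite cutoff_in//; exact: Gb.
Qed.

Lemma spike_inequality lam : costate_eq T f g phi psi eta x u lam ->
  {within `[0, T], continuous lam} ->
  lintegrable `[0, T] (fun t => if t \in S then
    lam t (g t (x t) (v0 - u t)) + (phi t (x t) v0 - phi t (x t) (u t)) else 0) /\
  0 <= \int[leb]_(t in `[0, T]) (if t \in S then
    lam t (g t (x t) (v0 - u t)) + (phi t (x t) v0 - phi t (x t) (u t)) else 0).
Proof.
move=> lamC clam; have T00 := ltW T0.
have [r0 r1 cr] := rho1_prop.
have mk : lmeasurable 0 T k := spike_lmeasurable v0 mS mu.
have N0 : 0 <= 1 + `|v0| by rewrite addr_ge0.
have [M [b [e_ [y_ [h [k_ [[ib b0] [e01 ecvg] ysol hsol [kcvg yk]]]]]]]] :=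
  state_variation T0 f_cont g_cont f_diff g_diff Df_cont Dg_cont cx mu mk N0
    (fun t _ => spike_norm S v0 u t) r0 control_integrable.
have yc n : {within `[0, T], continuous (y_ n)} by case: (ysol n).
have yM n t : 0 <= t <= T -> `|y_ n t| <= M by case: (ysol n) => _ _ _ + _; apply.
have hM t : 0 <= t <= T -> `|h t| <= M by case: hsol => _ _ _ + _; apply.
have ch : {within `[0, T], continuous h} by case: hsol.
have ycvg t : 0 <= t <= T -> y_ n t @[n --> \oo] --> h t.
  move=> tT; apply/cvgrPdist_lt => e e0; near=> n.
  rewrite distrC (le_lt_trans (yk n t tT))// (le_lt_trans (ler_norm _))//.
  by near: n; move/cvgr0Pnorm_lt : kcvg; apply.
have zI : (0 : R) <= 0 <= T by apply/andP; split.
have M0 : 0 <= M := le_trans (normr_ge0 _) (hM 0 zI).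
have [L L0 LP] := lin0_bound.
(* One integrable bound for the linearised field, for [Dphi] and for [g k]; the factor [2 + |v0|]
   exceeds both 1 and the constant [1 + |v0|] of the spike. *)
pose a s := L * (2 + `|v0|) * (1 + `|u s|) + dominant s.
have m1 : lmeas `[0, T] (fun _ : R => 1 : R) by exact: measurable_cst.
have i_1 : lintegrable `[0, T] (fun _ : R => 1 : R).
  by apply: (leb_bounded_integrable m1 (M := 1)) => t _; rewrite normr1.
have ia : lintegrable `[0, T] a.
  apply: (lintegrableD mT _ dominant_integrable).
  exact: (lintegrableZ _ mT (lintegrableD mT i_1 control_integrable)).
have Lv0 : 0 <= L * (2 + `|v0|) by rewrite mulr_ge0// addr_ge0.
have a0 t : 0 <= t <= T -> 0 <= a t.
  by move=> tT; rewrite addr_ge0 ?dominant_ge0// mulr_ge0// addr_ge0.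
have Aa s v : 0 <= s <= T -> `|lin0 s v| <= a s * `|v|.
  move=> sT; apply: (le_trans ((LP s sT).1 v)); rewrite ler_wpM2r// /a.
  rewrite -[leLHS]addr0; apply: lerD; last exact: dominant_ge0.
  rewrite ler_wpM2r ?addr_ge0// ler_peMr//.
  by apply: (@le_trans _ _ 2); [rewrite ler1n|rewrite lerDl].
have Ba : {ae leb, forall s : lebT R, `[0, T]%classic s ->
    `|Dphi phi s (x s) (u s)| <= a s}.
  apply: (leb_aeS phi_growth) => t gt tT; have [_ g1 _] := gt tT.
  by apply: (le_trans g1); rewrite lerDr mulr_ge0// addr_ge0.
have ka s : 0 <= s <= T -> `|g s (x s) (k s)| <= a s.
  move=> sT; rewrite (le_trans (opnormP _ _))// /a -[leLHS]addr0.
  apply: lerD; last exact: dominant_ge0.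
  rewrite -mulrA; apply: ler_pM => //; first exact: (LP s sT).2.
  apply: (le_trans (spike_norm S v0 u s)); rewrite ler_wpM2r ?addr_ge0//.
  by rewrite lerD2r ler1n.
have mgk : vmeas `[0, T] (fun s => g s (x s) (k s)).
  have c0 : {within `[0, T], continuous (fun _ : R => 0 : E)} by move=> ?; exact: cvg_cst.
  move=> i; have := lin_measurable g_cont Df_cont Dg_cont cx mu mk c0 i.
  congr (measurable_fun _ _); apply/funext => s; congr (ecoord i _).
  by rewrite /lin !linear0 -[(0 : 'L(E, E)) (u s)]/(0 : E) !add0r.
have iDh : lintegrable `[0, T] (fun t => Dphi phi t (x t) (u t) (h t)) :=
  lintegrable_B ia Ba lamC ch.
have [k0 i0 i1 ki1] := exponents_iota; have [_ kk kk' k1] := exponents.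
have k'0 : 0 < kappa' := lt_le_trans k0 kk'.
have [Mx Mx0 xM] := within_bounded cx.
have [wx cwx xw] := abs_continuous_control T0 ax.
have K1 : 0 < @vintK R E := vintK_gt0.
(* Since [b] bounds all the fields, its primitive controls the increments of every [y_ n] and of [h]
   at once. *)
have cwy := control_scale K1 (primitive_control ib b0).
have [w cw wP] := eta_control (control_add cwx cwy).
have wy0 s t : 0 <= s -> s <= t -> t <= T ->
    0 <= @vintK R E * (primitive b t - primitive b s).
  by move=> s0 st tT; exact: (control_ge0 cwy).
have [K K0 [DK DH]] := locally_holder_ball (Mx + M) k'0 Dpsi_holder.
have tw s t : 0 <= s -> s <= t -> t <= T -> t - s <= w s t.
  by move=> s0 st tT; have [] := wP s t s0 st tT.
have etaw s t : 0 <= s -> s <= t -> t <= T -> `|eta t - eta s| <= w s t `^ iota.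
  by move=> s0 st tT; have [] := wP s t s0 st tT.
have xw' s t : 0 <= s -> s <= t -> t <= T -> `|x t - x s| <= w s t.
  move=> s0 st tT; apply: (le_trans (xw s t s0 st tT)).
  have [_ h2 _] := wP s t s0 st tT; apply: le_trans h2.
  by rewrite lerDl wy0.
have xM' t : 0 <= t <= T -> `|x t| <= (Mx + M) - M by rewrite addrK; exact: xM.
have small (G : R -> E -> E) y : volterra_sol T M b G y -> small_curve T w M x y.
  move=> ys; split=> [|s t s0 st tT]; first by case: ys.
  have [_ h2 _] := wP s t s0 st tT; apply: le_trans h2; apply: lerD; first exact: xw.
  exact: volterra_sol_increment ib ys s0 st tT.
have MM : 0 <= Mx + M by rewrite addr_ge0// ltW.
have [K2 psiK] := psi_holder MM.
have psiK' : holder_on [set p : R * E | p.1 \in `[0, T] /\ `|p.2| <= Mx + M]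
    kappa `|K2| psi.
  move=> p1 p2 h1 h2; apply: (le_trans (psiK p1 p2 h1 h2)).
  by rewrite ler_wpM2r ?ler_norm// addr_ge0 ?powR_ge0.
have e01' n : 0 < e_ n /\ e_ n <= 1 by have [] := e01 n.
have [J [_ JX Yint Jcvg]] := young_variation T0 cw k0 k1 i0 ki1 tw etaw kk' K0 M0
  psi_diff DK DH xM' kk (normr_ge0 K2) psiK' (fun n => small _ _ (ysol n))
  (small _ _ hsol) e01' ecvg ycvg.
have C0 := quotient_cst_ge0 T kap w kappa' K0 M0.
have dual := costate_duality T0 ia a0 lin0_linear Aa Ba lamC clam mgk ka hsol cw ki1
  (sewing_cst_ge0 ki1 C0) JX
  (fun z zM => young_constant T0 cw k0 k1 i0 ki1 tw etaw kk' K0 M0 DK DH xM' zM xw').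
have [Q [phin Qle ijump Qcvg]] := running_cost_variation e01 ecvg yc yM ycvg iDh.
have ge0 n : 0 <= Q n + (e_ n)^-1 *
    (young_integral 0 T (fun t => psi t (x t + e_ n *: y_ n t)) eta -
     young_integral 0 T (fun t => psi t (x t)) eta).
  have [e0 _ _] := e01 n; have [Un iphin] := phin n.
  have adm : admissible T U xi f g phi psi eta (fun t => x t + e_ n *: y_ n t)
      (fun t => u t + e_ n *: k t).
    split; [split; [split|]|split].
    - exact: spike_control.
    - exact: (perturbed_process T0 e0 ib (ysol n) xu_state).
    - exact: Un.
    - exact: iphin.
    - exact: Yint.
  exact: (cost_quotient_ge0 e0 (xu_min.2 _ _ adm) (Qle n)).
have lim0 : 0 <= \int[leb]_(t in `[0, T]) Dphi phi t (x t) (u t) (h t) +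
    \int[leb]_(t in `[0, T]) jump x t + (J T - J 0).
  by apply: (cvgr_to_ge (cvgD Qcvg Jcvg)); exact: nearW.
have ilk := lintegrable_lam_k ia clam mgk ka.
have jumpE t : lam t (g t (x t) (k t)) + jump x t = if t \in S then
    lam t (g t (x t) (v0 - u t)) + (phi t (x t) v0 - phi t (x t) (u t)) else 0.
  by rewrite /k /spike /jump; case: ifP => // _; rewrite !linear0 addr0.
split; first exact: (eq_lintegrable jumpE (lintegrableD mT ilk ijump)).
have -> : \int[leb]_(t in `[0, T]) (if t \in S then
    lam t (g t (x t) (v0 - u t)) + (phi t (x t) v0 - phi t (x t) (u t)) else 0) =
    \int[leb]_(t in `[0, T]) (lam t (g t (x t) (k t)) + jump x t).
  by apply: eq_Rintegral => t _; exact/esym/jumpE.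
rewrite (RintegralD mT ilk ijump) -dual.
by apply: (le_trans lim0); rewrite [leLHS]addrC [leLHS]addrA; exact: lexx.
Unshelve. all: by end_near. Qed.

End Spike.

Lemma hamiltonian_le lam v0 : costate_eq T f g phi psi eta x u lam ->
  {within `[0, T], continuous lam} -> U v0 ->
  {ae leb, forall t : lebT R, `[0, T]%classic t ->
    hamiltonian f g phi t (x t) (lam t) (u t) <= hamiltonian f g phi t (x t) (lam t) v0}.
Proof.
move=> lamC clam Uv0.
pose hd t := lam t (g t (x t) (v0 - u t)) + (phi t (x t) v0 - phi t (x t) (u t)).
have hdE t : hd t = hamiltonian f g phi t (x t) (lam t) v0 -
    hamiltonian f g phi t (x t) (lam t) (u t).
  rewrite /hd /hamiltonian.
  have -> : lam t (g t (x t) (v0 - u t)) = lam t (g t (x t) v0) - lam t (g t (x t) (u t)).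
    by rewrite linearB; exact: linearB.
  have lamD v : lam t (f t (x t) + g t (x t) v) = lam t (f t (x t)) + lam t (g t (x t) v).
    exact: linearD.
  by rewrite !lamD; ring.
(* With the whole line as spike set, the inequality yields the measurability of [hd], which is
   needed before the set where [hd] is negative can serve as spike set. *)
have mhd : lmeas `[0, T] hd.
  have [i1 _] := spike_inequality (@measurableT _ (lebT R)) Uv0 lamC clam.
  have := lintegrable_measurable i1; congr (measurable_fun _ _).
  by apply/funext => t; rewrite in_setT.
pose S : set R := `[0, T]%classic `&` hd @^-1` `]-oo, 0[%classic.
have mS : measurable (S : set (lebT R)) by exact: mhd.
have [iS posS] := spike_inequality mS Uv0 lamC clam.
have neg t : `[0, T]%classic t -> (if t \in S then hd t else 0) <= 0.
  move=> _; case: ifP => //; rewrite inE => -[_]; rewrite /= in_itv/=.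
  exact: ltW.
apply: (leb_aeS (nonpos_Rintegral_ae mT iS neg posS)) => t h tT.
rewrite -subr_ge0 -hdE leNgt; apply/negP => hd0; have := h tT.
rewrite ifT; first by move=> h0; move: hd0; rewrite /hd h0 ltxx.
by rewrite inE; split=> //=; rewrite in_itv.
Qed.

Theorem minimum_condition lam : costate_eq T f g phi psi eta x u lam ->
  {within `[0, T], continuous lam} ->
  {ae leb, forall t : lebT R, `[0, T]%classic t ->
    (hamiltonian f g phi t (x t) (lam t) (u t))%:E =
    ereal_inf [set (hamiltonian f g phi t (x t) (lam t) v)%:E | v in U]}.
Proof.
move=> lamC clam.
have [U0|nU] := pselect (U !=set0); last first.
  by apply: (leb_aeS uU) => t Ut tT; exfalso; apply: nU; exists (u t); exact: Ut.
have [v_ Uv vdense] := dense_sequence U0.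
have hle := leb_ae_nat (fun n => hamiltonian_le lamC clam (Uv n)).
apply: (leb_aeS (leb_aeI uU hle)) => t [Ut Ht] tT.
have Uut := Ut tT; pose H v := hamiltonian f g phi t (x t) (lam t) v.
(* Continuity of the Hamiltonian relative to [U] carries the inequality from the dense sequence to
   every control value. *)
have cH : {within U, continuous H}.
  have ct : {within U, continuous (fun v : E => ((t, x t), v))}.
    by apply: continuous_subspaceT => v; exact: (cvg_pair (cvg_cst _) cvg_id).
  have h1 (v : E) : U v -> [set p : R * E * E | p.1.1 \in `[0, T] /\ U p.2] ((t, x t), v).
    by move=> Uv'; split.
  have c1 := within_comp ct h1 phi_cont.
  have c2 : {within U, continuous (fun v => lam t (f t (x t) + g t (x t) v))}.
    apply: continuous_subspaceT => v.
    apply: (@continuous_comp _ _ _ (fun w => f t (x t) + g t (x t) w) (lam t)).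
      by apply: cvgD; [exact: cvg_cst|exact: clin_continuous].
    exact: clin_continuous.
  by move=> v; apply: cvgD; [exact: c1|exact: c2].
apply/eqP; rewrite eq_le; apply/andP; split; last first.
  by apply: ereal_inf_lbound; exists (u t).
apply: le_ereal_inf_tmp => _ [v Uv' <-]; rewrite lee_fin; apply/ler_addgt0Pr => e e0.
have [dl dl0 dlP] := (within_continuous_dist _ _).1 cH v e Uv' e0.
have [n vn] := vdense v dl Uv' dl0.
apply: (le_trans (Ht n tT)); rewrite -lerBlDl.
apply: (le_trans (ler_norm _)); rewrite distrC; exact/ltW/dlP.
Qed.

End MaximumPrinciple.

Theorem theorem2 (R : realType) (E : normedVectType R) (d : nat)
    (T : R) (U : set E) (xi : E)
    (f : R -> E -> E) (g : R -> E -> 'L(E, E))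
    (phi : R -> E -> E -> R) (psi : R -> E -> 'L('rV[R]_d, R^o))
    (kappa Cpsi alpha Cphi delta r Cs Ce beta gamma : R)
    (rho c : R) (dd : R -> R) (kappa' : R)
    (eta : R -> 'rV[R]_d) (x u : R -> E)
    (T_gt0 : 0 < T)
    (* (i) *)
    (f_cont : {within [set p : R * E | p.1 \in `[0, T]],
       continuous (fun p => f p.1 p.2)})
    (g_cont : {within [set p : R * E | p.1 \in `[0, T]],
       continuous (fun p => g p.1 p.2)})
    (* (ii) *)
    (kappa_gt : 2^-1 < kappa) (Cpsi_ge0 : 0 <= Cpsi) (alpha_ge0 : 0 <= alpha)
    (psi_holder : forall M : R, 0 <= M ->
       exists2 K : R, K <= Cpsi * (1 + M `^ alpha) &
         holder_on [set p : R * E | p.1 \in `[0, T] /\ `|p.2| <= M] kappa K psi)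
    (* (iii) *)
    (U_closed : closed U) (U_convex : convex_set U)
    (* (iv) *)
    (phi_cont : {within [set p : R * E * E | p.1.1 \in `[0, T] /\ U p.2],
       continuous (fun p => phi p.1.1 p.1.2 p.2)})
    (phi_convex : forall (t : R) (y : E), t \in `[0, T] -> convex_function U (phi t y))
    (Cphi_gt0 : 0 < Cphi) (delta_gt0 : 0 < delta) (r_gt1 : 1 < r)
    (phi_coercive : forall (t : R) (y v : E), t \in `[0, T] -> U v ->
       Cphi * (`|v| `^ r - `|y| `^ delta) <= phi t y v)
    (* (v) *)
    (Cs_ge0 : 0 <= Cs) (Ce_ge0 : 0 <= Ce)
    (beta_ge0 : 0 <= beta) (gamma_ge0 : 0 <= gamma)
    (a_priori : forall (v : R -> E) (T1 : R) (y : R -> E),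
       Lr_control T U r v -> 0 < T1 <= T -> solves_state_eq xi f g T1 y v ->
       (Lr_norm r 0 T1 (derive1 y)
          <= (Cs * (1 + fine (Lr_norm r 0 T v) `^ beta))%R%:E)%E /\
       (sup_norm 0 T1 y
          <= (Ce * (1 + fine (Lr_norm r 0 T v) `^ gamma))%R%:E)%E)
    (exponents1 : gamma * (alpha + kappa - 2^-1) + beta / 2 < r)
    (exponents2 : gamma * delta < r)
    (* (vi) *)
    (f_diff : forall (t : R) (y : E), t \in `[0, T] -> differentiable (f t) y)
    (Df_cont : {within [set p : R * E | p.1 \in `[0, T]],
       continuous (fun p => Df f p.1 p.2)})
    (g_diff : forall (t : R) (y : E), t \in `[0, T] -> differentiable (g t) y)
    (Dg_cont : {within [set p : R * E | p.1 \in `[0, T]],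
       continuous (fun p => Dg g p.1 p.2)})
    (* (vii) *)
    (phi_diff : forall (t : R) (y v : E), t \in `[0, T] -> U v ->
       differentiable (fun z => phi t z v : R^o) y)
    (Dphi_cont : {within [set p : R * E * E | p.1.1 \in `[0, T] /\ U p.2],
       continuous (fun p => Dphi phi p.1.1 p.1.2 p.2)})
    (* (viii) *)
    (rho_gt0 : 0 < rho) (c_ge0 : 0 <= c)
    (dd_ge0 : forall t : R, t \in `[0, T] -> 0 <= dd t)
    (dd_int : leb.-integrable `[0, T] (fun t => (dd t)%:E))
    (Dphi_bound : forall y v : R -> E, admissible T U xi f g phi psi eta y v ->
       {ae leb, forall t : R, t \in `[0, T] ->
          forall z : E, `|z - y t| <= rho ->
            `|Dphi phi t z (v t)| <= c * `|phi t z (v t)| + dd t})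
    (* (ix) *)
    (psi_diff : forall (t : R) (y : E), t \in `[0, T] -> differentiable (psi t) y)
    (kappa'_gt : 2^-1 < kappa')
    (Dpsi_holder :
       locally_holder_on [set p : R * E | p.1 \in `[0, T]] kappa' (Dpsi psi))
    (eta_obs : observation_path T eta)
    (xu_min : global_minimiser T U xi f g phi psi eta x u) :
  exists lambda : R -> 'L(E, R^o),
    [/\ costate_eq T f g phi psi eta x u lambda,
        (forall mu : R -> 'L(E, R^o), costate_eq T f g phi psi eta x u mu ->
           forall t : R, t \in `[0, T] -> mu t = lambda t) &
        {ae leb, forall t : R, t \in `[0, T] ->
           (hamiltonian f g phi t (x t) (lambda t) (u t))%:E =
           ereal_inf [set (hamiltonian f g phi t (x t) (lambda t) v)%:E
                     | v in U]}].
Proof.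
have psi_ball M : 0 <= M -> exists K : R,
    holder_on [set p : R * E | p.1 \in `[0, T] /\ `|p.2| <= M] kappa K psi.
  by move=> /psi_holder[K _ hK]; exists K.
have [lam [lamC clam lamU]] := costate_wellposed T_gt0 g_cont kappa_gt Cphi_gt0 delta_gt0
  r_gt1 phi_coercive Df_cont Dg_cont phi_diff Dphi_cont rho_gt0 c_ge0 dd_ge0 dd_int
  Dphi_bound kappa'_gt Dpsi_holder eta_obs xu_min.
exists lam; split=> //.
exact: (minimum_condition T_gt0 f_cont g_cont kappa_gt psi_ball U_convex phi_cont
  phi_convex Cphi_gt0 delta_gt0 r_gt1 phi_coercive f_diff Df_cont g_diff Dg_cont phi_diff
  rho_gt0 c_ge0 dd_ge0 dd_int Dphi_bound psi_diff kappa'_gt Dpsi_holder eta_obs xu_min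
  lamC clam).
Qed.
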